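(* Let $p$ be a prime, $q=p^s$ ($s\ge1$), $k=\mathbb{F}_q$, and let $n>m\ge0$. Let $0\le a_1\le\dots\le a_n\le q-2$ and $0\le b_1\le\dots\le b_m\le q-2$ be integers, $\chi_i=\omega^{a_i}$, $\rho_j=\omega^{b_j}$, and assume the orders of all $\chi_i,\rho_j$ divide $p-1$. Then for every $a\in k^\times$, the Frobenius Newton polygon of the hypergeometric sum $\mathrm{Hyp}(\chi;\rho)(a)$ (normalized by $\mathrm{ord}_q$) coincides with the irregular Hodge polygon, i.e. the convex polygon starting at $(0,0)$ whose slopes are the numbers $\theta(1),\dots,\theta(n)$ (arranged in increasing order), where with $\alpha_i=a_i/(q-1)$, $\beta_j=b_j/(q-1)$, $$\theta(k)=(n-m)\alpha_k+\#\{i\mid\beta_i<\alpha_k\}+(n-k)-\sum_{i=1}^n\alpha_i+\sum_{j=1}^m\beta_j.$$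
   Context: $K$ is a finite extension of $\mathbb{Q}_p$ with residue field $k$ containing $\pi$ with $\pi^{p-1}=-p$; $\psi:\mathbb{F}_p\to K^\times$ is the nontrivial additive character attached to $\pi$ by Dwork's theory ($\psi(1)\equiv1+\pi \bmod \pi^2$). $\omega:k^\times\to K^\times$ is the Teichmüller character. For $r\ge1$ and $a\in k^\times$ set $$\mathrm{Hyp}_r(a)=\sum_{\substack{x_i,y_j\in\mathbb{F}_{q^r}^\times\\ x_1\cdots x_n=ay_1\cdots y_m}}\psi\Bigl(\mathrm{Tr}_{\mathbb{F}_{q^r}/\mathbb{F}_p}\bigl(\textstyle\sum_i x_i-\sum_j y_j\bigr)\Bigr)\prod_i\chi_i(\mathrm{Nm}_{\mathbb{F}_{q^r}/k}x_i)\prod_j\rho_j^{-1}(\mathrm{Nm}_{\mathbb{F}_{q^r}/k}y_j),$$ so $\mathrm{Hyp}(\chi;\rho)(a)=\mathrm{Hyp}_1(a)$. The $L$-function $L(a,T)=\exp\bigl(\sum_{r\ge1}\mathrm{Hyp}_r(a)T^r/r\bigr)$ has the property that $L(a,T)^{(-1)^{n+m}}=\prod_{i=1}^n(1-\gamma_iT)$ is a polynomial of degree $n$; the $\gamma_i$ are the Frobenius eigenvalues. The Frobenius Newton polygon is the convex polygon starting at $(0,0)$ with slopes $\mathrm{ord}_q(\gamma_1),\dots,\mathrm{ord}_q(\gamma_n)$ in increasing order ($\mathrm{ord}_q$ the $p$-adic valuation normalized by $\mathrm{ord}_q(q)=1$). *)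

(* Defs.v *)
From HB Require Import structures.
From mathcomp Require Import all_boot all_order all_algebra.
Set Implicit Arguments. Unset Strict Implicit. Unset Printing Implicit Defensive.
Import Order.TTheory GRing.Theory Num.Theory.
Local Open Scope ring_scope.

Section Defs.
Variable (Om : fieldType).

(* v : Om -> rat is a (rank one, rational valued) non-archimedean valuation;
   its value at 0 is irrelevant (ord 0 = +oo is encoded by val_ge / val_gt). *)
Definition is_valuation (v : Om -> rat) : Prop :=
  (forall x y : Om, x != 0 -> y != 0 -> v (x * y) = v x + v y) /\
  (forall x y : Om, x != 0 -> y != 0 -> x + y != 0 ->
     v x <= v (x + y) \/ v y <= v (x + y)).

Definition val_ge (v : Om -> rat) (x : Om) (c : rat) : Prop := x = 0 \/ c <= v x.
Definition val_gt (v : Om -> rat) (x : Om) (c : rat) : Prop := x = 0 \/ c < v x.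

(* Dwork: pi^(p-1) = -p, psi1 = psi(1) is a p-th root of unity with
   psi(1) = 1 + pi mod pi^2. *)
Definition dwork_pi (p : nat) (pi : Om) : Prop := pi ^+ p.-1 = - (p%:R).
Definition dwork_psi (v : Om -> rat) (p : nat) (pi psi1 : Om) : Prop :=
  psi1 ^+ p = 1 /\ val_ge v (psi1 - (1 + pi)) (2%:R * v pi).

(* Teichmueller character of k (extended by omega 0 = 0): multiplicative,
   omega 1 = 1, and x |-> omega x mod the maximal ideal is additive, i.e.
   omega is the multiplicative lift of an embedding of k into the residue
   field. *)
Definition teichmuller (k : finFieldType) (v : Om -> rat) (om : k -> Om) : Prop :=
  om 0 = 0 /\ om 1 = 1 /\ (forall x y, om (x * y) = om x * om y) /\
  (forall x y, val_gt v (om (x + y) - om x - om y) 0).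

(* Absolute trace Tr_{L/F_p} for #|L| = p^e, given by sum of Frobenius conjugates *)
Definition trace_p (L : finFieldType) (p e : nat) (x : L) : L :=
  \sum_(i < e) x ^+ (p ^ i).

Definition Fp_index (L : finFieldType) (p : nat) (y : L) : nat :=
  odflt 0%N (omap (@nat_of_ord p) [pick i : 'I_p | (i%:R : L) == y]).

Definition psiF (L : finFieldType) (p : nat) (psi1 : Om) (y : L) : Om :=
  psi1 ^+ Fp_index p y.

(* Norm N_{L/k} for [L : k] = r, #|k| = q: x^(1 + q + ... + q^(r-1)) *)
Definition norm_k (L : finFieldType) (q r : nat) (x : L) : L :=
  x ^+ (\sum_(i < r) q ^ i)%N.

Definition pullback (k L : finFieldType) (iota : k -> L) (z : L) : k :=
  odflt 0 [pick c : k | iota c == z].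

(* Hyp_r(a), computed in L = F_{q^r} (with structure embedding iota : k -> L),
   q = p^s, chi_i = omega^(A_i), rho_j = omega^(B_j). *)
Definition Hyp (k L : finFieldType) (iota : k -> L) (p s r n m : nat)
  (psi1 : Om) (om : k -> Om) (A B : seq nat) (a : k) : Om :=
  \sum_(x : {ffun 'I_n -> L} | [forall i, x i != 0])
   \sum_(y : {ffun 'I_m -> L} | [forall j, y j != 0] &&
                                (\prod_i x i == iota a * \prod_j y j))
     psiF p psi1 (trace_p p (s * r) (\sum_i x i - \sum_j y j)) *
     (\prod_(i < n) om (pullback iota (norm_k (p ^ s) r (x i))) ^+ nth 0%N A i) *
     (\prod_(j < m) (om (pullback iota (norm_k (p ^ s) r (y j))))^-1 ^+ nth 0%N B j).

End Defs.

Definition theta (q n m : nat) (A B : seq nat) (kk : nat) : rat :=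
  let frac (e : nat) : rat := e%:R / (q.-1)%:R in
  let ak := frac (nth 0%N A kk.-1) in
  (n - m)%:R * ak + (count (fun b => frac b < ak) B)%:R + (n - kk)%:R
  - \sum_(e <- A) frac e + \sum_(e <- B) frac e.

Definition hodge_slopes (q n m : nat) (A B : seq nat) : seq rat :=
  [seq theta q n m A B kk | kk <- iota 1 n].

(* the convex polygon from (0,0) with the given slopes in increasing order,
   recorded by the heights of its vertices at abscissae 0, 1, ..., size sl *)
Definition polygon (sl : seq rat) : seq rat :=
  let t := sort (fun x y : rat => x <= y) sl in
  [seq \sum_(j < i) nth 0 t j | i <- iota 0 (size sl).+1].

(* Main.v *)
(* Let Q = q^r.  By Dwork's splitting function the character psi o Tr is the product of the
   conjugates of an Artin-Hasse exponential at a Teichmueller point, up to an error that the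
   truncation degree D makes as small as desired.  Hence s Hyp_r is close to
   (Q - 1)^d tr (M^(s r)), with d = n + m - 1, for one finite matrix M (the transfer matrix)
   indexed by a Frobenius index i mod s and by the exponent vectors U, modulo the relation
   x_1 ... x_n = a y_1 ... y_m, each normalized so that some x-coordinate of U vanishes.
   Newton's identities turn this into the coefficientwise closeness of
   \prod_i (1 - gamma_i X^s) and the alternating product of the det (1 - p^j X M)^C(d, j),
   0 <= j <= d.

   The Gauss norms of det (1 - X M) are exact: with w U = \sum_t U_t, the principal minors of M
   on the windows {w <= const}, rescaled by powers of a (p-1)-th root of the splitting parameter,
   are units, because modulo the maximal ideal M becomes a tensor product of one-variable
   matrices that an explicit base change makes triangular.  The exponent vectors U are
   n orthants, one for each x-index k, with corner of weight (p - 1) theta(k); the alternating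
   product over j is a d-fold finite difference that collapses each orthant to its corner.
   Therefore \sum_i min (0, ord gamma_i - sigma) = \sum_k min (0, theta(k) - sigma) for every
   sigma, and the two multisets of slopes agree. *)
Require Import Defs.
From HB Require Import structures.
From mathcomp Require Import all_boot all_order all_algebra all_fingroup all_solvable all_field.
From mathcomp Require Import zify ring lra.
Set Implicit Arguments. Unset Strict Implicit. Unset Printing Implicit Defensive.
Import Order.TTheory GRing.Theory Num.Theory.
Local Open Scope ring_scope.

(** * Valuations *)

(** [Om] is only an algebraically closed field with a rational valuation. It need not be complete,
    so Fredholm determinants and limits are avoided: every series is replaced by a polynomial with
    explicit precision. The matrix grows with the truncation degree [D], yet at a fixed slope cutoff
    its Gauss norm is attained at an index bounded independently of [D]. This decides the order of
    choices: the index bound [K] comes first, and [D] is then taken so large that the precision of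
    the power sums beats both the valuation of [K!] lost in Newton's identities and the size of the
    coefficients compared. Two hypotheses carry the exactness. The orders divide [p - 1], so every
    exponent is a multiple of [(p^s - 1) / (p - 1)] and one p-power Frobenius step carries the same
    twist at each of the [s] stages. And [m < n], so each use of the torus relation costs weight: to
    leading order the relation disappears, and only then does the matrix factor into one-variable
    matrices. *)

Section Valuation.
Variables (Om : fieldType) (v : Om -> rat).
Hypothesis vP : is_valuation v.

Lemma nuM x y : x != 0 -> y != 0 -> v (x * y) = v x + v y.
Proof. by case: vP => + _; exact. Qed.

Lemma nu1 : v 1 = 0.
Proof. by have := nuM (oner_neq0 Om) (oner_neq0 Om); rewrite mulr1; lra. Qed.

Lemma nuX x i : x != 0 -> v (x ^+ i) = i%:R * v x.
Proof.
move=> x0; elim: i => [|i IHi]; first by rewrite expr0 nu1 mul0r.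
by rewrite exprS nuM ?expf_neq0 // IHi -natr1; lra.
Qed.

Lemma nuV x : x != 0 -> v x^-1 = - v x.
Proof.
move=> x0; have := nuM x0 (invr_neq0 x0).
by rewrite divff // nu1; lra.
Qed.

Lemma nu_unity x i : (0 < i)%N -> x ^+ i = 1 -> v x = 0.
Proof.
move=> i0 xi; have x0 : x != 0.
  by apply: contra_eq_neq xi => ->; rewrite expr0n gtn_eqF // eq_sym oner_eq0.
have := nuX i x0; rewrite xi nu1 => /esym/eqP; rewrite mulf_eq0.
by rewrite pnatr_eq0 gtn_eqF // => /eqP.
Qed.

Lemma nuN x : v (- x) = v x.
Proof.
have [->|x0] := eqVneq x 0; first by rewrite oppr0.
rewrite -mulN1r nuM ?oppr_eq0 ?oner_eq0 //.
by rewrite (@nu_unity (-1) 2) ?add0r // sqrrN expr1n.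
Qed.

Notation ge := (val_ge v).
Notation gt := (val_gt v).

Lemma vge0 c : ge 0 c. Proof. by left. Qed.
Lemma vge1 : ge 1 0. Proof. by right; rewrite nu1. Qed.

Lemma vgtW x c : gt x c -> ge x c.
Proof. by case=> [->|xc]; [left | right; exact: ltW]. Qed.

Lemma vgeW b x c : c <= b -> ge x b -> ge x c.
Proof. by move=> cb [->|xb]; [left | right; exact: le_trans xb]. Qed.

Lemma vgt_ge b x c : c < b -> ge x b -> gt x c.
Proof. by move=> cb [->|xb]; [left | right; exact: lt_le_trans xb]. Qed.

Lemma vgeN x c : ge (- x) c <-> ge x c.
Proof.
rewrite /val_ge nuN; split=> -[/eqP|]; rewrite ?oppr_eq0; try by right.
  by move=> /eqP; left.
by move=> /eqP ->; left; rewrite oppr0.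
Qed.

Lemma vgtN x c : gt (- x) c <-> gt x c.
Proof.
rewrite /val_gt nuN; split=> -[/eqP|]; rewrite ?oppr_eq0; try by right.
  by move=> /eqP; left.
by move=> /eqP ->; left; rewrite oppr0.
Qed.

Lemma vgeD x y c : ge x c -> ge y c -> ge (x + y) c.
Proof.
move=> [->|xc]; first by rewrite add0r.
move=> [->|yc]; first by rewrite addr0; right.
have [->|x0] := eqVneq x 0; first by rewrite add0r; right.
have [->|y0] := eqVneq y 0; first by rewrite addr0; right.
have [->|xy0] := eqVneq (x + y) 0; first by left.
by case: (proj2 vP _ _ x0 y0 xy0) => h; right; apply: le_trans h.
Qed.

Lemma vgtD x y c : gt x c -> gt y c -> gt (x + y) c.
Proof.
move=> [->|xc]; first by rewrite add0r.
move=> [->|yc]; first by rewrite addr0; right.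
have [->|x0] := eqVneq x 0; first by rewrite add0r; right.
have [->|y0] := eqVneq y 0; first by rewrite addr0; right.
have [->|xy0] := eqVneq (x + y) 0; first by left.
by case: (proj2 vP _ _ x0 y0 xy0) => h; right; apply: lt_le_trans h.
Qed.

Lemma vgeB x y c : ge x c -> ge y c -> ge (x - y) c.
Proof. by move=> xc yc; apply: vgeD => //; apply/vgeN. Qed.

Lemma vgtB x y c : gt x c -> gt y c -> gt (x - y) c.
Proof. by move=> xc yc; apply: vgtD => //; apply/vgtN. Qed.

Lemma vgeM x y b c : ge x b -> ge y c -> ge (x * y) (b + c).
Proof.
move=> [->|xb]; first by rewrite mul0r; left.
move=> [->|yc]; first by rewrite mulr0; left.
have [->|x0] := eqVneq x 0; first by rewrite mul0r; left.
have [->|y0] := eqVneq y 0; first by rewrite mulr0; left.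
by right; rewrite nuM // lerD.
Qed.

Lemma vgtM x y b c : gt x b -> ge y c -> gt (x * y) (b + c).
Proof.
move=> [->|xb]; first by rewrite mul0r; left.
move=> [->|yc]; first by rewrite mulr0; left.
have [->|x0] := eqVneq x 0; first by rewrite mul0r; left.
have [->|y0] := eqVneq y 0; first by rewrite mulr0; left.
by right; rewrite nuM // ltr_leD.
Qed.

Lemma vgeM0 x y c : ge x c -> ge y 0 -> ge (x * y) c.
Proof. by move=> xc yc; rewrite -[c]addr0; exact: vgeM. Qed.

Lemma vgtM0 x y c : gt x c -> ge y 0 -> gt (x * y) c.
Proof. by move=> xc yc; rewrite -[c]addr0; exact: vgtM. Qed.

Lemma vgeX x c i : ge x c -> ge (x ^+ i) (i%:R * c).
Proof.
move=> xc; elim: i => [|i IHi]; first by rewrite expr0 mul0r; exact: vge1.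
by rewrite exprS -natr1 mulrDl mul1r addrC; apply: vgeM.
Qed.

Lemma vgeX0 x i : ge x 0 -> ge (x ^+ i) 0.
Proof. by move=> /(vgeX i); rewrite mulr0. Qed.

Lemma vge_sum (I : Type) (r : seq I) (P : pred I) F c :
  (forall i, P i -> ge (F i) c) -> ge (\sum_(i <- r | P i) F i) c.
Proof.
by move=> FP; apply: (big_ind (fun x => ge x c)) => //; [left | move=> *; apply: vgeD].
Qed.

Lemma vgt_sum (I : Type) (r : seq I) (P : pred I) F c :
  (forall i, P i -> gt (F i) c) -> gt (\sum_(i <- r | P i) F i) c.
Proof.
by move=> FP; apply: (big_ind (fun x => gt x c)) => //; [left | move=> *; apply: vgtD].
Qed.

Lemma vge_prod (I : Type) (r : seq I) (P : pred I) F (c : I -> rat) :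
  (forall i, P i -> ge (F i) (c i)) ->
  ge (\prod_(i <- r | P i) F i) (\sum_(i <- r | P i) c i).
Proof.
move=> FP; apply: (big_ind2 (fun x b => ge x b)) => //; first exact: vge1.
by move=> *; apply: vgeM.
Qed.

Lemma vge_prod0 (I : Type) (r : seq I) (P : pred I) F :
  (forall i, P i -> ge (F i) 0) -> ge (\prod_(i <- r | P i) F i) 0.
Proof.
move=> FP; apply: (big_ind (fun x => ge x 0)) => //; first exact: vge1.
by move=> *; apply: vgeM0.
Qed.

Lemma vge_nat i : ge i%:R 0.
Proof.
by elim: i => [|i IHi]; [left | rewrite -natr1; apply: vgeD => //; exact: vge1].
Qed.

(** Exact valuations of sums are obtained below by exhibiting a dominant term [y]. *)
Lemma nu_eq x y c : gt (x - y) c -> y != 0 -> v y = c -> x != 0 /\ v x = c.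
Proof.
move=> xyc y0 yc.
have x0 : x != 0.
  apply/eqP => x0; case: xyc; rewrite x0 sub0r; last by rewrite nuN yc ltxx.
  by move/eqP; rewrite oppr_eq0 (negPf y0).
split=> //; apply/eqP; rewrite eq_le; apply/andP; split; last first.
  have : ge x c by rewrite -(subrK y x); apply: vgeD; [exact: vgtW | right; rewrite yc].
  by case=> // x00; rewrite x00 eqxx in x0.
rewrite leNgt; apply/negP => cx.
have : gt y c.
  by rewrite -(subKr x y); apply: vgtB => //; right.
by case=> [y00|]; [rewrite y00 eqxx in y0 | rewrite yc ltxx].
Qed.

(* Congruence modulo the maximal ideal, between integral elements. *)
Definition cong x y := [/\ ge x 0, ge y 0 & gt (x - y) 0].

Lemma cong_refl x : ge x 0 -> cong x x.
Proof. by move=> x0; split=> //; rewrite subrr; left. Qed.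

Lemma cong_sym x y : cong x y -> cong y x.
Proof. by case=> x0 y0 xy; split=> //; rewrite -opprB; apply/vgtN. Qed.

Lemma cong_trans y x z : cong x y -> cong y z -> cong x z.
Proof.
case=> x0 y0 xy [_ z0 yz]; split=> //.
by rewrite -(subrK y x) -addrA; apply: vgtD.
Qed.

Lemma congD x y x' y' : cong x y -> cong x' y' -> cong (x + x') (y + y').
Proof.
case=> x0 y0 xy [x0' y0' xy']; split; [exact: vgeD | exact: vgeD |].
by rewrite opprD addrACA; apply: vgtD.
Qed.

Lemma congN x y : cong x y -> cong (- x) (- y).
Proof.
case=> x0 y0 xy; split; [exact/vgeN | exact/vgeN |].
by rewrite -opprD; apply/vgtN.
Qed.

Lemma congM x y x' y' : cong x y -> cong x' y' -> cong (x * x') (y * y').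
Proof.
case=> x0 y0 xy [x0' y0' xy']; split; [exact: vgeM0 | exact: vgeM0 |].
have -> : x * x' - y * y' = (x - y) * x' + (x' - y') * y by ring.
by apply: vgtD; apply: vgtM0.
Qed.

Lemma congX x y i : cong x y -> cong (x ^+ i) (y ^+ i).
Proof.
move=> xy; elim: i => [|i IHi]; first by apply: cong_refl; exact: vge1.
by rewrite !exprS; apply: congM.
Qed.

Lemma cong_sum (I : Type) (r : seq I) (P : pred I) F G :
  (forall i, P i -> cong (F i) (G i)) ->
  cong (\sum_(i <- r | P i) F i) (\sum_(i <- r | P i) G i).
Proof.
move=> FG; apply: (big_ind2 (fun x y => cong x y)) => //.
  by apply: cong_refl; left.
by move=> *; apply: congD.
Qed.

Lemma cong_prod (I : Type) (r : seq I) (P : pred I) F G :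
  (forall i, P i -> cong (F i) (G i)) ->
  cong (\prod_(i <- r | P i) F i) (\prod_(i <- r | P i) G i).
Proof.
move=> FG; apply: (big_ind2 (fun x y => cong x y)) => //.
  by apply: cong_refl; exact: vge1.
by move=> *; apply: congM.
Qed.

Lemma cong_unit x y : cong x y -> y != 0 -> v y = 0 -> x != 0 /\ v x = 0.
Proof. by case=> _ _ xy y0 vy; apply: nu_eq xy y0 vy. Qed.

(** Factors are exchanged one at a time. Since [0 <= c], the [F i] are integral too, so the
    precision [c] survives multiplication by the other factors. *)
Lemma vge_prodB (I : Type) (r : seq I) (P : pred I) F G c :
  0 <= c -> (forall i, P i -> ge (G i) 0) ->
  (forall i, P i -> ge (F i - G i) c) ->
  ge (\prod_(i <- r | P i) F i - \prod_(i <- r | P i) G i) c.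
Proof.
move=> c0 G0 FG.
have F0 i : P i -> ge (F i) 0.
  move=> Pi; rewrite -(subrK (G i) (F i)); apply: vgeD; last exact: G0.
  by apply: vgeW c0 _; exact: FG.
elim: r => [|i r IHr]; first by rewrite !big_nil subrr; left.
rewrite !big_cons; case: ifP => // Pi.
set A := \prod_(_ <- _ | _) F _; set B := \prod_(_ <- _ | _) G _.
have -> : F i * A - G i * B = (F i - G i) * A + (A - B) * G i by ring.
apply: vgeD; apply: vgeM0 => //; [exact: FG | exact: vge_prod0 | exact: G0].
Qed.

End Valuation.

(** * Roots near an approximate zero *)

Section RootNear.
Variables (Om : closedFieldType) (v : Om -> rat).
Hypothesis vP : is_valuation v.

Lemma deriv_prod_XsubC (rs : seq Om) x : all (fun z => x != z) rs ->
  (\prod_(z <- rs) ('X - z%:P))^`().[x] =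
  (\prod_(z <- rs) ('X - z%:P)).[x] * \sum_(z <- rs) (x - z)^-1.
Proof.
elim: rs => [|z rs IHr] /=; first by rewrite !big_nil derivC horner0 mulr0.
case/andP => xz /IHr IH; rewrite !big_cons derivM !hornerE IH derivXsubC hornerE /=.
by field; rewrite subr_eq0.
Qed.

(* The logarithmic derivative of h at x is the sum of the 1/(x - z) over the roots z. *)
Lemma root_near (h : {poly Om}) x : h^`().[x] != 0 ->
  exists2 z, root h z & h.[x] = 0 \/ val_ge v (x - z) (v h.[x] - v h^`().[x]).
Proof.
move=> h'x; have [rs rsE] := closed_field_poly_normal h.
have h0 : h != 0 by apply: contraNneq h'x => ->; rewrite deriv0 horner0.
have [hx0|hx0] := eqVneq h.[x] 0; first by exists x; [apply/eqP | left].
have rroot z : z \in rs -> root h z.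
  by rewrite rsE rootZ ?lead_coef_eq0 // root_prod_XsubC.
have xrs : all (fun z => x != z) rs.
  by apply/allP => z /rroot/eqP hz; apply: contraNneq hx0 => ->; rewrite hz.
have h'xE : h^`().[x] = h.[x] * \sum_(z <- rs) (x - z)^-1.
  rewrite {1}rsE derivZ hornerZ deriv_prod_XsubC // mulrA.
  by congr (_ * _); rewrite {2}rsE hornerZ.
case: (boolP (has (fun z => v (x - z) >= v h.[x] - v h^`().[x]) rs)).
  by case/hasP => z /rroot rz zv; exists z => //; right; right.
(* If every root were farther away, each inverse would have valuation strictly above that of their
   sum [S]. *)
move/hasPn => no; exfalso; set S := \sum_(_ <- _) _ in h'xE.
have S0 : S != 0 by apply: contraNneq h'x => S0; rewrite h'xE S0 mulr0.
have vS : v S = v h^`().[x] - v h.[x] by rewrite h'xE nuM //; lra.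
suff : val_gt v S (v h^`().[x] - v h.[x]) by case=> [/eqP|]; rewrite ?(negPf S0) // vS ltxx.
rewrite /S big_seq; apply: vgt_sum => // z zrs; right.
have xz : x - z != 0 by rewrite subr_eq0; exact: (allP xrs).
by rewrite nuV //; have := no z zrs; rewrite -ltNge; lra.
Qed.

End RootNear.

(** * Power sums and determinants *)

Section LogDerivative.
Variable R : comNzRingType.
Implicit Types (f g : {poly R}) (Pi : nat -> R).

Lemma low_coefM f g k : (forall i, (i <= k)%N -> f`_i = 0) ->
  forall i, (i <= k)%N -> (f * g)`_i = 0.
Proof.
move=> f0 i ik; rewrite coefM big1 // => j _.
by rewrite f0 ?mul0r // (leq_trans _ ik) // -ltnS.
Qed.

(* f = exp (- \sum_(i > 0) Pi i X^i / i) : the reciprocal roots of f have power sums Pi i. *)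
Definition power_sums f Pi :=
  forall k, k%:R * f`_k = - \sum_(i < k) Pi i.+1 * f`_(k - i.+1).

Definition trunc_gen Pi k := \poly_(i < k.+1) (if i == 0%N then 0 else Pi i).

Lemma coef_trunc_genM f Pi k i : (i <= k)%N ->
  (trunc_gen Pi k * f)`_i = \sum_(j < i) Pi j.+1 * f`_(i - j.+1).
Proof.
move=> ik; rewrite coefM big_ord_recl coef_poly /= mul0r add0r.
apply: eq_bigr => j _; rewrite coef_poly /bump /= add1n ltnS.
by rewrite (leq_trans (ltn_ord j) ik).
Qed.

(** The recursion says that [X f' / f] is minus the generating series of [Pi], tested modulo each
    [X^(k+1)]. In this form multiplicativity is the Leibniz rule. *)
Lemma power_sumsP f Pi :
  power_sums f Pi <-> forall k i, (i <= k)%N -> ('X * f^`() + trunc_gen Pi k * f)`_i = 0.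
Proof.
have E k i : (i <= k)%N -> ('X * f^`() + trunc_gen Pi k * f)`_i =
    i%:R * f`_i + \sum_(j < i) Pi j.+1 * f`_(i - j.+1).
  move=> ik; rewrite coefD coef_trunc_genM // coefXM coef_deriv.
  by case: i ik => [|i] _ /=; rewrite ?mul0r // mulr_natl.
split=> [H k i ik|H k]; first by rewrite E // H addNr.
by apply/eqP; rewrite -addr_eq0 -(E k k) // H.
Qed.

Lemma power_sums1 : power_sums 1 (fun=> 0).
Proof.
move=> k; rewrite big1 ?oppr0 => [|i _]; last by rewrite mul0r.
by rewrite coef1; case: k => [|k]; rewrite /= ?mul0r ?mulr0.
Qed.

Lemma power_sumsM f g Pi Pi' : power_sums f Pi -> power_sums g Pi' ->
  power_sums (f * g) (fun i => Pi i + Pi' i).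
Proof.
move=> /power_sumsP Hf /power_sumsP Hg; apply/power_sumsP => k i ik.
have -> : trunc_gen (fun i => Pi i + Pi' i) k = trunc_gen Pi k + trunc_gen Pi' k.
  apply/polyP => j; rewrite coefD !coef_poly; case: ifP => _; last by rewrite addr0.
  by case: ifP => _ //; rewrite addr0.
have -> : 'X * (f * g)^`() + (trunc_gen Pi k + trunc_gen Pi' k) * (f * g) =
  ('X * f^`() + trunc_gen Pi k * f) * g + ('X * g^`() + trunc_gen Pi' k * g) * f.
  by rewrite derivM; ring.
by rewrite coefD !(@low_coefM _ _ k) ?addr0 // => j jk; rewrite ?Hf ?Hg.
Qed.

Lemma eq_power_sums f Pi Pi' : (forall i, (0 < i)%N -> Pi i = Pi' i) ->
  power_sums f Pi -> power_sums f Pi'.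
Proof.
by move=> PP H k; rewrite H; congr (- _); apply: eq_bigr => i _; rewrite PP.
Qed.

Lemma power_sums_prod (I : Type) (r : seq I) (P : pred I) (F : I -> {poly R})
    (Pi : I -> nat -> R) : (forall i, P i -> power_sums (F i) (Pi i)) ->
  power_sums (\prod_(i <- r | P i) F i) (fun k => \sum_(i <- r | P i) Pi i k).
Proof.
move=> H; elim: r => [|i r IHr].
  by rewrite big_nil; apply: eq_power_sums power_sums1 => i _; rewrite big_nil.
rewrite big_cons; case: ifP => Pi0.
  by apply: eq_power_sums (power_sumsM (H i Pi0) IHr) => k _; rewrite big_cons Pi0.
by apply: eq_power_sums IHr => k _; rewrite big_cons Pi0.
Qed.

Lemma power_sumsX f Pi n : power_sums f Pi ->
  power_sums (f ^+ n) (fun k => n%:R * Pi k).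
Proof.
move=> H; elim: n => [|n IHn].
  by rewrite expr0; apply: eq_power_sums power_sums1 => i _; rewrite mul0r.
rewrite exprS; apply: eq_power_sums (power_sumsM H IHn) => k _.
by rewrite -natr1 mulrDl mul1r addrC.
Qed.

(** The reciprocal roots are the s-th roots of [c], whose i-th power sum vanishes unless [s] divides
    [i]. *)
Lemma power_sums_binomial (c : R) (s : nat) : (0 < s)%N ->
  power_sums (1 - c *: 'X^s)
    (fun i => if (s %| i)%N then s%:R * c ^+ (i %/ s) else 0).
Proof.
move=> s0 k.
have coefE i : (1 - c *: 'X^s)`_i = (i == 0%N)%:R - c * (i == s)%:R.
  by rewrite coefB coef1 coefZ coefXn.
rewrite coefE; under eq_bigr => i _ do rewrite coefE mulrBr.
rewrite sumrB.
have -> : \sum_(i < k) (if (s %| i.+1)%N then s%:R * c ^+ (i.+1 %/ s) else 0) *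
    (k - i.+1 == 0)%N%:R = if (0 < k)%N && (s %| k)%N then s%:R * c ^+ (k %/ s) else 0.
  case: k => [|k]; first by rewrite big_ord0.
  rewrite big_ord_recr /= subnn eqxx mulr1 big1 ?add0r // => i _.
  have -> : (k.+1 - i.+1 == 0)%N = false by have := ltn_ord i; lia.
  by rewrite mulr0.
have -> : \sum_(i < k) (if (s %| i.+1)%N then s%:R * c ^+ (i.+1 %/ s) else 0) *
    (c * (k - i.+1 == s)%N%:R) =
    if (s < k)%N && (s %| k)%N then s%:R * c ^+ (k %/ s) else 0.
  have [sk|sk] /= := ltnP s k; last first.
    rewrite big1 // => i _; have -> : (k - i.+1 == s)%N = false.
      by have := ltn_ord i; lia.
    by rewrite !mulr0.
  have hk : ((k - s).-1 < k)%N by lia.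
  rewrite (bigD1 (Ordinal hk)) //= big1 ?addr0 => [|i]; last first.
    rewrite -val_eqE /= => ik.
    have -> : (k - i.+1 == s)%N = false by have := ltn_ord i; lia.
    by rewrite !mulr0.
  have -> : (k - (k - s).-1.+1 == s)%N by lia.
  rewrite mulr1 prednK ?subn_gt0 // dvdn_subl //; last exact: ltnW.
  case: ifP => sdk; last by rewrite mul0r.
  rewrite -mulrA -exprSr; congr (_ * c ^+ _).
  by rewrite -{2}(subnK (ltnW sk)) divnDr // divnn s0 addn1.
have [->|k0] := posnP k.
  by rewrite /= !mul0r subrr oppr0.
case: (ltngtP k s) => [ks|sk|->] /=.
- by rewrite gtnNdvd // mulr0 !subrr oppr0 mulr0.
- by rewrite mulr0 subrr mulr0 subrr oppr0.
by rewrite dvdnn divnn s0 expr1; ring.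
Qed.

End LogDerivative.

(** * Characteristic series: traces of powers and principal minors *)

Section DetSeries.
Variables (R : comNzRingType) (n : nat).
Implicit Types (A : 'M[{poly R}]_n) (M : 'M[R]_n).

Lemma deriv_prod (I : finType) (F : I -> {poly R}) :
  (\prod_i F i)^`() = \sum_i \prod_j (if j == i then (F j)^`() else F j).
Proof.
have E i : \prod_j (if j == i then (F j)^`() else F j) =
    (F i)^`() * \prod_(j | j != i) F j.
  rewrite (bigD1 i) //= eqxx; congr (_ * _).
  by apply: eq_bigr => j /negPf ->.
rewrite (eq_bigr _ (fun i _ => E i)).
suff H (r : seq I) : uniq r -> (\prod_(i <- r) F i)^`() =
    \sum_(i <- r) (F i)^`() * \prod_(j <- r | j != i) F j.
  exact: H (index_enum_uniq I).
elim: r => [|i r IHr] /=; first by rewrite !big_nil derivC.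
case/andP => ir ur; rewrite !big_cons derivM IHr // eqxx /=; congr (_ * _ + _).
  by rewrite big_seq_cond [RHS]big_seq_cond; apply: eq_bigl => j;
     case: eqP => [->|] //=; rewrite ?andbF ?andbT // (negPf ir).
rewrite big_distrr /= big_seq [RHS]big_seq; apply: eq_bigr => j jr.
rewrite big_cons ifT; first by rewrite mulrCA.
by apply: contraNneq ir => ->.
Qed.

(** The determinant is differentiated one row at a time, and each resulting determinant is expanded
    along the differentiated row. *)
Lemma jacobi A :
  (\det A)^`() = \sum_i \sum_j (A i j)^`() * cofactor A i j.
Proof.
have E i : \sum_j (A i j)^`() * cofactor A i j =
    \det (\matrix_(k, j) (if k == i then (A k j)^`() else A k j)).
  rewrite (expand_det_row _ i); apply: eq_bigr => j _; rewrite mxE eqxx.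
  congr (_ * _); rewrite /cofactor; congr (_ * \det _).
  by apply/matrixP => a b; rewrite !mxE eq_sym (negPf (neq_lift _ _)).
rewrite (eq_bigr _ (fun i _ => E i)) /determinant.
rewrite exchange_big /= raddf_sum /=; apply: eq_bigr => s _.
rewrite -mulr_sumr; case: (odd_perm s); rewrite ?expr1 ?expr0 ?mul1r ?mulN1r ?derivN.
  congr (- _); rewrite deriv_prod; apply: eq_bigr => i _.
  by apply: eq_bigr => j _; rewrite mxE.
rewrite deriv_prod; apply: eq_bigr => i _.
by apply: eq_bigr => j _; rewrite mxE.
Qed.

Definition det_series M : {poly R} := \det (1%:M - 'X *: map_mx polyC M).

(** No eigenvalues are used, so any commutative ring will do: by [jacobi], [D'] is minus the trace
    of [\adj A *m P], and [\adj A] is [D] times the truncated geometric series [B] in [X P], up to a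
    multiple of [X^(k+1)]. *)
Lemma power_sums_det M : power_sums (det_series M) (fun i => \tr (M ^+ i)).
Proof.
apply/power_sumsP => k i ik.
set P := map_mx polyC M; set A := 1%:M - 'X *: P; set D := det_series M.
have DE : D^`() = - \tr (\adj A *m P).
  rewrite /D /det_series jacobi -/P -/A mxtrace_mulC /mxtrace -sumrN.
  apply: eq_bigr => a _; rewrite mxE -sumrN; apply: eq_bigr => b _.
  rewrite [\adj A _ _]mxE; rewrite -mulNr; congr (_ * _).
  rewrite !mxE derivB derivM derivX derivC mulr0 addr0 mul1r derivMn (derivC 1).
  by rewrite mul0rn sub0r.
pose B := \sum_(j < k.+1) 'X^j *: P ^+ j.
have AB : A *m B = 1%:M - 'X^(k.+1) *: P ^+ k.+1.
  rewrite /A mulmxBl mul1mx /B; elim: (k.+1) => [|j IHj].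
    by rewrite big_ord0 mulmx0 subrr expr0 scale1r expr0 subrr.
  rewrite big_ord_recr /= mulmxDr opprD addrACA IHj.
  by rewrite -scalemxAl -scalemxAr scalerA -exprS -[P *m _]/(P * P ^+ j) -exprS addrA subrK.
have adjE : \adj A = D *: B + 'X^(k.+1) *: (\adj A *m P ^+ k.+1).
  have : \adj A *m (A *m B) = D *: B.
    by rewrite mulmxA mul_adj_mx mul_scalar_mx.
  by move <-; rewrite AB mulmxBr mulmx1 -scalemxAr subrK.
have trE : \tr (\adj A *m P) = D * \sum_(j < k.+1) 'X^j * (\tr (M ^+ j.+1))%:P
     + 'X^(k.+1) * \tr (\adj A *m P ^+ k.+1 *m P).
  rewrite {1}adjE mulmxDl -!scalemxAl mxtraceD !mxtraceZ; congr (_ * _ + _).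
  rewrite /B mulmx_suml raddf_sum; apply: eq_bigr => j _ /=.
  rewrite -scalemxAl mxtraceZ; congr (_ * _).
  by rewrite -[_ *m P]/(P ^+ j * P) -exprSr /P -rmorphXn /= -trace_map_mx.
rewrite DE trE mulrN mulrDr opprD addrAC.
have -> : trunc_gen (fun i => \tr (M ^+ i)) k * D =
   'X * (D * \sum_(j < k.+1) 'X^j * (\tr (M ^+ j.+1))%:P) - 
   'X^(k.+1) * ((\tr (M ^+ k.+1))%:P * D).
  rewrite mulrCA (mulrC _ D) mulrA -mulrA [X in _ = _ * X - _]mulr_sumr.
  rewrite big_ord_recr /= mulrDr [X in _ + X - _](_ : _ = 'X^(k.+1) * ((\tr (M ^+ k.+1))%:P * D)); last first.
    by rewrite (exprS 'X k); ring.
  rewrite addrK; congr (_ * _); apply/polyP => j; rewrite coef_poly coef_sum.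
  under eq_bigr => l _ do rewrite mulrA -exprS coefMC coefXn.
  case: j => [|j]; first by rewrite big1 // => l _; rewrite mul0r.
  rewrite ltnS /=; case: ltnP => jk; last first.
    by rewrite big1 // => l _; rewrite eqSS gtn_eqF ?mul0r // (leq_trans (ltn_ord l)).
  rewrite (bigD1 (Ordinal jk)) //= eqxx mul1r big1 ?addr0 // => l.
  by rewrite -val_eqE eqSS eq_sym /= => /negPf ->; rewrite mul0r.
set S := \sum_(j < k.+1) _; set t1 := \tr (_ *m P); set t2 := (\tr _)%:P.
have -> : - ('X * (D * S)) + ('X * (D * S) - 'X^(k.+1) * (t2 * D)) - 'X * ('X^(k.+1) * t1) =
  'X^(k.+1) * (- ('X * t1) - t2 * D) by ring.
by rewrite coefXnM ltnS ik.
Qed.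

End DetSeries.

Section PrincipalMinors.
Variables (R : comNzRingType) (n : nat).
Implicit Types (M : 'M[R]_n) (S : {set 'I_n}).

(** Keeping the full size, with identity rows outside [S], avoids reindexing by the elements of
    [S]. *)
Definition pminor M S : R :=
  \det (\matrix_(i, j) (if i \in S then M i j else (i == j)%:R)).

Lemma det_seriesE M :
  det_series M = \sum_(S : {set 'I_n}) pminor M S *: (- 'X) ^+ #|S|.
Proof.
rewrite /det_series /determinant.
transitivity (\sum_(s : 'S_n) \sum_(S : {set 'I_n}) (-1) ^+ s *
   ((\prod_i (if i \in S then M i (s i) else (i == s i)%:R)) *: (- 'X : {poly R}) ^+ #|S|)).
  apply: eq_bigr => s _; rewrite -mulr_sumr; congr (_ * _).
  under eq_bigr => i _ do rewrite !mxE addrC.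
  rewrite bigA_distr; apply: eq_bigr => S _.
  rewrite -mul_polyC rmorph_prod /= mulrC -prodr_const [X in _ = X * _]big_mkcond -big_split /=.
  apply: eq_bigr => i _; case: ifP => _; first by rewrite mulNr.
  by rewrite mul1r polyCMn.
rewrite exchange_big /=; apply: eq_bigr => S _; rewrite /pminor /determinant.
rewrite scaler_suml; apply: eq_bigr => s _.
rewrite -!mul_polyC mulrA; congr (_ * _); rewrite rmorphM rmorph_sign; congr (_ * _%:P).
by apply: eq_bigr => i _; rewrite mxE.
Qed.

Lemma coef_det_series M k : (det_series M)`_k =
  (-1) ^+ k * \sum_(S : {set 'I_n} | #|S| == k) pminor M S.
Proof.
rewrite det_seriesE coef_sum [in RHS]big_mkcond mulr_sumr; apply: eq_bigr => S _.
rewrite coefZ -[- 'X]mulN1r exprMn.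
have -> : (-1) ^+ #|S| = ((-1) ^+ #|S|)%:P :> {poly R} by rewrite rmorph_sign.
rewrite coefCM coefXn eq_sym.
by case: eqP => [->|]; rewrite ?mulr0 // mulr1 mulrC.
Qed.

Lemma pminorZ a M S : pminor (a *: M) S = a ^+ #|S| * pminor M S.
Proof.
rewrite /pminor /determinant mulr_sumr; apply: eq_bigr => s _.
rewrite mulrCA; congr (_ * _); rewrite -prodr_const [X in _ = X * _]big_mkcond -big_split /=.
by apply: eq_bigr => i _; rewrite !mxE; case: ifP; rewrite ?mul1r.
Qed.

Lemma coef_det_seriesZ a M k :
  (det_series (a *: M))`_k = a ^+ k * (det_series M)`_k.
Proof.
rewrite !coef_det_series mulrCA; congr (_ * _); rewrite mulr_sumr.
by apply: eq_bigr => S /eqP <-; exact: pminorZ.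
Qed.

End PrincipalMinors.

(** * Gauss norms and their stability *)

Section GaussNorm.
Variables (Om : fieldType) (v : Om -> rat).
Hypothesis vP : is_valuation v.
Implicit Types (f g : {poly Om}).

(* N is the minimum of v (f_i) - i c, and k the last index where it is attained. *)
Definition gauss_norm f (c N : rat) (k : nat) :=
  [/\ forall i, val_ge v f`_i (N + i%:R * c), f`_k != 0, v f`_k = N + k%:R * c
    & forall i, (k < i)%N -> val_gt v f`_i (N + i%:R * c)].

Lemma gauss_norm1 c : gauss_norm 1 c 0 0.
Proof.
have E i : (1 : {poly Om})`_i.+1 = 0 by rewrite coef1.
split; rewrite ?coef1 ?oner_neq0 ?nu1 ?mul0r ?addr0 //.
  by case=> [|i]; rewrite ?E; [right; rewrite coef1 nu1 // mul0r addr0 | left].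
by case=> [|i] // _; rewrite E; left.
Qed.

(** Gauss's lemma: at index [k + k'] any product other than [f_k g_k'] involves an index beyond [k]
    or beyond [k'], where the inequality is strict. *)
Lemma gauss_normM f g c N N' k k' : gauss_norm f c N k -> gauss_norm g c N' k' ->
  gauss_norm (f * g) c (N + N') (k + k').
Proof.
move=> [f1 f2 f3 f4] [g1 g2 g3 g4].
have NE i j : (j <= i)%N ->
    N + N' + i%:R * c = (N + j%:R * c) + (N' + (i - j)%:R * c).
  by move=> ji; rewrite natrB //; ring.
have ge1 i j : (j <= i)%N -> val_ge v (f`_j * g`_(i - j)) (N + N' + i%:R * c).
  by move=> ji; rewrite (NE i j) //; apply: vgeM.
have gt1 i j : (j <= i)%N -> (k < j)%N || (k' < i - j)%N ->
    val_gt v (f`_j * g`_(i - j)) (N + N' + i%:R * c).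
  move=> ji /orP[h|h]; rewrite (NE i j) //; first by apply: vgtM => //; apply: f4.
  by rewrite mulrC [X in val_gt _ _ X]addrC; apply: vgtM => //; apply: g4.
have kk : f`_k * g`_k' != 0 by rewrite mulf_neq0.
have vkk : v (f`_k * g`_k') = N + N' + (k + k')%:R * c.
  by rewrite nuM // f3 g3 natrD; ring.
have top : val_gt v ((f * g)`_(k + k') - f`_k * g`_k') (N + N' + (k + k')%:R * c).
  have hk : (k < (k + k').+1)%N by lia.
  rewrite coefM (bigD1 (Ordinal hk)) //= addKn addrC addrK.
  apply: vgt_sum => // j; rewrite -val_eqE /= => jk.
  by apply: gt1; [rewrite -ltnS | move: (ltn_ord j); lia].
have [t1 t2] := nu_eq vP top kk vkk.
split=> // i.
  by rewrite coefM; apply: vge_sum => // j _; apply: ge1; rewrite -ltnS.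
move=> ki; rewrite coefM; apply: vgt_sum => // j _; have := ltn_ord j => ji.
by apply: gt1; lia.
Qed.

Lemma gauss_norm_prod (I : Type) (r : seq I) (P : pred I) (F : I -> {poly Om}) c
    (N : I -> rat) (k : I -> nat) :
  (forall i, P i -> gauss_norm (F i) c (N i) (k i)) ->
  gauss_norm (\prod_(i <- r | P i) F i) c (\sum_(i <- r | P i) N i) (\sum_(i <- r | P i) k i).
Proof.
move=> H; elim: r => [|i r IHr]; first by rewrite !big_nil; exact: gauss_norm1.
by rewrite !big_cons; case: ifP => // Pi; apply: gauss_normM => //; exact: H.
Qed.

Lemma gauss_normX f c N k n : gauss_norm f c N k ->
  gauss_norm (f ^+ n) c (n%:R * N) (n * k)%N.
Proof.
move=> H; elim: n => [|n IHn]; first by rewrite expr0 mul0r; exact: gauss_norm1.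
by rewrite exprS -natr1 mulrDl mul1r mulSn addrC; apply: gauss_normM.
Qed.

Lemma gauss_norm_scale f g a c N k : a != 0 -> (forall i, g`_i = a ^+ i * f`_i) ->
  gauss_norm f (c - v a) N k -> gauss_norm g c N k.
Proof.
move=> a0 gE [f1 f2 f3 f4].
have E i : N + i%:R * c = i%:R * v a + (N + i%:R * (c - v a)) by ring.
have aX i : val_ge v (a ^+ i) (i%:R * v a) by right; rewrite nuX.
split=> [i|||i ki]; rewrite ?gE ?E.
- exact: vgeM.
- by rewrite mulf_neq0 ?expf_neq0.
- by rewrite nuM ?expf_neq0 // nuX // f3.
by rewrite mulrC addrC; apply: vgtM => //; apply: f4.
Qed.

(** At a tie both coefficients attain the minimum and the last index is [s]; hence the non-strict
    test. *)
Lemma gauss_norm_binomial (a : Om) c s : (0 < s)%N -> a != 0 ->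
  gauss_norm (1 - a *: 'X^s) c (Num.min 0 (v a - s%:R * c))
    (if v a <= s%:R * c then s else 0%N).
Proof.
move=> s0 a0.
have coefE i : (1 - a *: 'X^s)`_i = if i == 0%N then 1 else if i == s then - a else 0.
  rewrite coefB coef1 coefZ coefXn; case: eqP => [->|_].
    by rewrite eq_sym (gtn_eqF s0) mulr0 subr0.
  by case: eqP; rewrite ?mulr1 ?mulr0 sub0r ?oppr0.
have minle : Num.min 0 (v a - s%:R * c) <= 0 by rewrite ge_min lexx.
have minle' : Num.min 0 (v a - s%:R * c) <= v a - s%:R * c by rewrite ge_min lexx orbT.
split=> [i|||i].
- rewrite coefE; case: eqP => [->|_]; first by right; rewrite nu1 // mul0r addr0.
  case: eqP => [->|_]; last by left.
  by right; rewrite nuN // -lerBrDr.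
- rewrite coefE; case: leP => _; last by rewrite eqxx oner_neq0.
  by rewrite (gtn_eqF s0) eqxx oppr_eq0.
- rewrite coefE; case: leP => vs.
    rewrite (gtn_eqF s0) eqxx nuN // -{1}(subrK (s%:R * c) (v a)); congr (_ + _).
    by apply/esym/min_idPr; rewrite subr_le0.
  rewrite eqxx nu1 // mul0r addr0; apply/esym/min_idPl.
  by rewrite subr_ge0 ltW.
case: leP => vs ki; rewrite coefE.
  by rewrite (gtn_eqF (leq_ltn_trans _ ki)) // (gtn_eqF ki); left.
rewrite (gtn_eqF ki); case: eqP => [->|_]; last by left.
right; rewrite nuN // -ltrBrDr; apply: le_lt_trans minle _.
by rewrite subr_gt0.
Qed.

(** Agreement is required only at the two indices where the minima are attained, which is why bounds
    on these indices are carried along. *)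
Lemma gauss_norm_close f g c N N' k k' C :
  gauss_norm f c N k -> gauss_norm g c N' k' ->
  N + k%:R * c < C -> N' + k'%:R * c < C ->
  val_ge v (f`_k - g`_k) C -> val_ge v (f`_k' - g`_k') C -> N = N'.
Proof.
have le f' g' N1 N2 k1 k2 : gauss_norm f' c N1 k1 -> gauss_norm g' c N2 k2 ->
    N1 + k1%:R * c < C -> val_ge v (f'`_k1 - g'`_k1) C -> N2 <= N1.
  move=> [_ h1 h2 _] [h3 _ _ _] h4 h5.
  have h6 : val_gt v (g'`_k1 - f'`_k1) (N1 + k1%:R * c).
    by rewrite -opprB; apply/vgtN => //; apply: vgt_ge h5.
  have [h7 h8] := nu_eq vP h6 h1 h2.
  by case: (h3 k1) => [/eqP|]; [rewrite (negPf h7) | rewrite h8; lra].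
move=> Hf Hg C1 C2 D1 D2; apply/eqP; rewrite eq_le.
rewrite (le _ _ _ _ _ _ Hf Hg) // (le _ _ _ _ _ _ Hg Hf) //.
by rewrite -opprB; apply/vgeN.
Qed.

(** A permutation that contributes preserves [S], so the row terms [l] and the column terms [h] add
    up to the same total for all of them. *)
Lemma vge_pminor n (M : 'M[Om]_n) (h l : 'I_n -> rat) S :
  (forall i j, val_ge v (M i j) (h j - l i)) ->
  val_ge v (pminor M S) (\sum_(i in S) (h i - l i)).
Proof.
move=> Mv; apply: vge_sum => // s _.
rewrite mulr_sign; set X := \prod_i _.
suff: val_ge v X (\sum_(i in S) (h i - l i)) by case: ifP => // _ ?; apply/vgeN.
rewrite {}/X; have [/forallP sS|] := boolP [forall i, (i \notin S) ==> (s i == i)]; last first.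
  rewrite negb_forall => /existsP[i]; rewrite negb_imply => /andP[iS si].
  by left; rewrite (bigD1 i) //= mxE (negPf iS) eq_sym (negPf si) mul0r.
have sE i : (s i \in S) = (i \in S).
  have [iS|iS] := boolP (i \in S); last by rewrite (eqP (implyP (sS i) iS)) (negPf iS).
  apply: contraLR iS => siS; have /eqP := implyP (sS (s i)) siS.
  by move/perm_inj => sii; rewrite -sii.
have -> : \sum_(i in S) (h i - l i) =
    \sum_i ((if s i \in S then h (s i) else 0) - (if i \in S then l i else 0)).
  rewrite sumrB [RHS]sumrB; congr (_ - _); last by rewrite big_mkcond.
  by rewrite big_mkcond [LHS](reindex_inj (@perm_inj _ s)).
apply: vge_prod => // i _; rewrite mxE sE; case: ifP => [_|iS]; first exact: Mv.
rewrite subrr; have := sS i; rewrite iS /= => /eqP ->; rewrite eqxx; exact: vge1.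
Qed.

(** [S] collects the indices with nonpositive cost [h i - l i - c], ties included, so it is the
    largest set of minimal total cost. Any other set of the same size, and any larger set, costs
    strictly more; hence the single minor on [S] decides both the norm and the last index. *)
Lemma gauss_norm_det n (M : 'M[Om]_n) (h l : 'I_n -> rat) c :
  let S := [set i | h i - l i <= c] in
  (forall i j, val_ge v (M i j) (h j - l i)) ->
  pminor M S != 0 -> v (pminor M S) = \sum_(i in S) (h i - l i) ->
  gauss_norm (det_series M) c (\sum_(i in S) (h i - l i - c)) #|S|.
Proof.
move=> S Mv S0 Sv; set N := \sum_(i in S) _.
have sumE (T : {set 'I_n}) : \sum_(i in T) (h i - l i) =
    \sum_(i in T) (h i - l i - c) + #|T|%:R * c.
  by rewrite [in RHS]sumrB sumr_const mulr_natl subrK.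
have inS i : (i \in S) = (h i - l i <= c) by rewrite inE.
have NT (T : {set 'I_n}) : N <= \sum_(i in T) (h i - l i - c).
  rewrite [N]big_mkcond [leRHS]big_mkcond; apply: ler_sum => i _ /=; rewrite inS.
  by case: ifP => //; case: ifP => //; lra.
have NTs (T : {set 'I_n}) : ~~ (T \subset S) -> N < \sum_(i in T) (h i - l i - c).
  case/subsetPn => i iT iS; rewrite [N]big_mkcond [ltRHS]big_mkcond.
  rewrite (bigD1 i) //= [ltRHS](bigD1 i) //= iT (negPf iS).
  move: iS; rewrite inS -ltNge => iS; apply: ltr_leD; first by lra.
  apply: ler_sum => j _ /=; rewrite inS.
  by case: ifP => //; case: ifP => //; lra.
have sgn k x b : val_ge v x b -> val_ge v ((-1) ^+ k * x) b.
  by rewrite -signr_odd mulr_sign; case: ifP => // _ ?; apply/vgeN.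
have sgn' k x b : val_gt v x b -> val_gt v ((-1) ^+ k * x) b.
  by rewrite -signr_odd mulr_sign; case: ifP => // _ ?; apply/vgtN.
have top : val_gt v ((det_series M)`_#|S| - (-1) ^+ #|S| * pminor M S) (N + #|S|%:R * c).
  rewrite coef_det_series -mulrBr; apply: sgn'.
  rewrite (bigD1 S) //= addrC addrK; apply: vgt_sum => // T /andP[/eqP TS TnS].
  apply: vgt_ge (vge_pminor T Mv); rewrite sumE TS ltrD2r; apply: NTs.
  by apply: contra TnS => sTS; rewrite eqEcard sTS TS leqnn.
have vtop : v ((-1) ^+ #|S| * pminor M S) = N + #|S|%:R * c.
  by rewrite -signr_odd mulr_sign -sumE -Sv; case: ifP => // _; rewrite nuN.
have ntop : (-1) ^+ #|S| * pminor M S != 0 by rewrite mulf_neq0 // signr_eq0.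
have [t1 t2] := nu_eq vP top ntop vtop.
split=> // [i|i Si]; rewrite coef_det_series.
  apply: sgn; apply: vge_sum => // T /eqP <-.
  by apply: vgeW (vge_pminor T Mv); rewrite sumE lerD2r NT.
apply: sgn'; apply: vgt_sum => // T /eqP Ti.
apply: vgt_ge (vge_pminor T Mv); rewrite sumE Ti ltrD2r NTs //.
by apply: contraL Si => /subset_leq_card; rewrite Ti -leqNgt.
Qed.

(* Newton's identities divide by k!, whence the loss of precision. *)
Lemma close_power_sums f g Pi Pi' (K : nat) (C : rat) :
  (forall k, (0 < k)%N -> (k%:R : Om) != 0) ->
  f`_0 = g`_0 -> power_sums f Pi -> power_sums g Pi' ->
  (forall k, (0 < k <= K)%N -> val_ge v (Pi k) 0) ->
  (forall k, (k <= K)%N -> val_ge v g`_k 0) ->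
  (forall k, (0 < k <= K)%N -> val_ge v (Pi k - Pi' k) C) ->
  forall k, (k <= K)%N -> val_ge v (f`_k - g`_k) (C - v k`!%:R).
Proof.
move=> char0 fg0 Hf Hg Pi0 g0 PP.
have f0 k : (k`!%:R : Om) != 0 by apply: char0; exact: fact_gt0.
have v0 k : 0 <= v k.+1%:R.
  by case: (vge_nat vP k.+1) => // /eqP; rewrite (negPf (char0 _ _)).
have vfact k : v k.+1`!%:R = v k.+1%:R + v k`!%:R.
  by rewrite factS natrM nuM // char0.
have vmono i j : (i <= j)%N -> v i`!%:R <= v j`!%:R.
  move=> /subnKC <-; elim: (j - i)%N => [|m IHm]; first by rewrite addn0.
  by rewrite addnS vfact; move: (v0 (i + m)%N); lra.
elim/ltn_ind=> -[|k] IHk kK; first by left; rewrite fg0 subrr.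
have kn0 : (k.+1%:R : Om) != 0 by exact: char0.
suff H : val_ge v (k.+1%:R * (f`_k.+1 - g`_k.+1)) (C - v k`!%:R).
  rewrite -[_ - _](mulKf kn0) vfact opprD addrCA -nuV //.
  by apply: vgeM => //; right.
rewrite mulrBr Hf Hg -opprD -mulN1r -[C - _]add0r; apply: vgeM => //.
  by right; rewrite nuN // nu1.
rewrite -sumrB; apply: vge_sum => // i _.
have iK : (0 < i.+1 <= K)%N by rewrite /= (leq_trans (ltn_ord i)).
have -> : Pi i.+1 * f`_(k.+1 - i.+1) - Pi' i.+1 * g`_(k.+1 - i.+1) =
   (f`_(k.+1 - i.+1) - g`_(k.+1 - i.+1)) * Pi i.+1
   + (Pi i.+1 - Pi' i.+1) * g`_(k.+1 - i.+1) by ring.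
apply: vgeD => //.
  apply: vgeM0 (Pi0 _ iK) => //.
  have := IHk (k.+1 - i.+1)%N; rewrite subSS => IH.
  apply: vgeW (IH _ _); [|lia|lia].
  by rewrite lerD2l lerN2 vmono // leq_subr.
apply: vgeM0 => //; last by apply: g0; lia.
apply: vgeW (PP _ iK) => //; rewrite lerBlDr lerDl.
by case: (vge_nat vP k`!) => // /eqP; rewrite (negPf (f0 _)).
Qed.

End GaussNorm.

(** * The Artin-Hasse exponential *)

(** By Legendre's formula; the induction passes from [n] to [n %/ p], with the number [K] of terms
    of the sum generalized. *)
Lemma logn_fact_le p n : prime p -> (0 < n)%N -> (p.-1 * logn p n`! < n)%N.
Proof.
move=> p_pr; have p1 := prime_gt1 p_pr; rewrite logn_fact // big_add1.
move: (n.+1.-1)%N => K; rewrite big_mkord; elim: K n => [|K IHK] n n0; first by rewrite big_ord0 muln0.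
rewrite big_ord_recl expn1 mulnDr.
have [m0|m0] := posnP (n %/ p)%N.
  rewrite m0 muln0 add0n big1 ?muln0 // => i _.
  by rewrite expnS divnMA m0 div0n.
under eq_bigr => i _ do rewrite expnS divnMA.
have := IHK _ m0; have := leq_trunc_div n p; move: (n %/ p)%N m0 => m m0.
by move: (\sum_(i < K) _)%N => S; nia.
Qed.

(** * Congruences modulo p over the p-integral numbers *)

Section PIntegers.
Variables (F : fieldType) (p : nat).
Hypotheses (p_pr : prime p) (F0 : forall k, (0 < k)%N -> (k%:R : F) != 0).

(* The localization of the integers at p, inside F. *)
Definition pint (x : F) := exists a : int, exists2 b, coprime p b & x * b%:R = a%:~R.
Definition pdvd (x : F) := exists2 y, pint y & x = p%:R * y.

Lemma pcoprime_gt0 b : coprime p b -> (0 < b)%N.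
Proof.
case: b => //; rewrite /coprime gcdn0 => /eqP pp.
by move: (prime_gt1 p_pr); rewrite pp.
Qed.

Lemma pint_int (a : int) : pint a%:~R.
Proof. by exists a, 1%N; rewrite ?coprimen1 // mulr1. Qed.

Lemma pint_nat (a : nat) : pint a%:R.
Proof. exact: (pint_int a). Qed.

Lemma pintD x y : pint x -> pint y -> pint (x + y).
Proof.
case=> a [b pb xE] [a' [b' pb' yE]].
exists (a * b'%:Z + a' * b%:Z), (b * b')%N; first by rewrite coprimeMr pb.
by rewrite natrM rmorphD !rmorphM /= -xE -yE -!pmulrn; ring.
Qed.

Lemma pintM x y : pint x -> pint y -> pint (x * y).
Proof.
case=> a [b pb xE] [a' [b' pb' yE]].
exists (a * a'), (b * b')%N; first by rewrite coprimeMr pb.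
by rewrite natrM rmorphM /= -xE -yE; ring.
Qed.

Lemma pintN x : pint x -> pint (- x).
Proof. by move=> xp; rewrite -mulN1r; apply: pintM => //; exact: (pint_int (-1)). Qed.

Lemma pint_sum (I : Type) (r : seq I) (P : pred I) (G : I -> F) :
  (forall i, P i -> pint (G i)) -> pint (\sum_(i <- r | P i) G i).
Proof.
by move=> H; apply: big_ind => //; [exact: (pint_nat 0) | exact: pintD].
Qed.

Lemma pint_inv_nat b : coprime p b -> pint (b%:R^-1).
Proof.
move=> pb; exists 1, b => //; rewrite mulVf //.
by apply/F0/pcoprime_gt0.
Qed.

Lemma pdvd0 : pdvd 0. Proof. by exists 0; [exact: (pint_nat 0) | rewrite mulr0]. Qed.

Lemma pdvdD x y : pdvd x -> pdvd y -> pdvd (x + y).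
Proof.
by case=> x' x'p -> [y' y'p ->]; exists (x' + y'); [exact: pintD | rewrite mulrDr].
Qed.

Lemma pdvdMl x y : pint x -> pdvd y -> pdvd (x * y).
Proof.
by move=> xp [y' y'p ->]; exists (x * y'); [exact: pintM | rewrite mulrCA].
Qed.

Lemma pdvdMr x y : pdvd x -> pint y -> pdvd (x * y).
Proof. by move=> xp yp; rewrite mulrC; exact: pdvdMl. Qed.

Lemma pdvdN x : pdvd x -> pdvd (- x).
Proof. by case=> y yp ->; exists (- y); [exact: pintN | rewrite mulrN]. Qed.

Lemma pdvd_sum (I : Type) (r : seq I) (P : pred I) (G : I -> F) :
  (forall i, P i -> pdvd (G i)) -> pdvd (\sum_(i <- r | P i) G i).
Proof.
by move=> H; apply: big_ind => //; [exact: pdvd0 | exact: pdvdD].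
Qed.

Lemma pdvd_nat n : (p %| n)%N -> pdvd n%:R.
Proof.
by case/dvdnP => k ->; exists k%:R; [exact: pint_nat | rewrite natrM mulrC].
Qed.

Lemma pdvd_frobenius_nat n : pdvd (n%:R ^+ p - n%:R).
Proof.
have le : (n <= n ^ p)%N.
  case: n => // n; apply: (@leq_trans (n.+1 ^ 1)); first by rewrite expn1.
  by apply: leq_pexp2l => //; exact: prime_gt0.
rewrite -natrX -natrB //; apply: pdvd_nat; rewrite -eqn_mod_dvd //; apply/eqP; exact: fermat_little.
Qed.

Lemma pdvd_frobenius_int (a : int) : pdvd (a%:~R ^+ p - a%:~R).
Proof.
case: a => n; first exact: pdvd_frobenius_nat.
rewrite NegzE rmorphN /= -pmulrn; have [p2|podd] := even_prime p_pr.
  rewrite p2 sqrrN opprK.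
  have -> : (n.+1%:R : F) ^+ 2 + n.+1%:R = (n.+1%:R ^+ p - n.+1%:R) + (n.+1 * p)%:R.
    by rewrite p2 natrM; ring.
  by apply: pdvdD; [exact: pdvd_frobenius_nat | apply/pdvd_nat/dvdn_mull].
rewrite exprNn -signr_odd podd expr1 mulN1r -opprD; apply: pdvdN.
exact: pdvd_frobenius_nat.
Qed.

Lemma pdvd_frobenius x : pint x -> pdvd (x ^+ p - x).
Proof.
case=> a [b pb xE].
have b0 : (b%:R : F) != 0.
  by apply/F0/pcoprime_gt0.
have -> : x ^+ p - x = (b%:R^-1) ^+ p * ((a%:~R ^+ p - a%:~R) - x * (b%:R ^+ p - b%:R)).
  rewrite -xE exprMn exprVn; move: (b%:R ^+ p) (expf_neq0 p b0) => B B0.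
  by field; rewrite B0.
have bp : pint b%:R^-1 by exact: pint_inv_nat.
apply: pdvdMl.
  by elim: p => [|i IHi]; rewrite ?expr0 ?exprS; [exact: (pint_nat 1) | exact: pintM].
apply: pdvdD; first exact: pdvd_frobenius_int.
by apply/pdvdN/pdvdMl; [exists a, b | exact: pdvd_frobenius_nat].
Qed.

Definition ppint (f : {poly F}) := forall i, pint f`_i.
Definition ppdvd (f : {poly F}) := forall i, pdvd f`_i.

Lemma ppintM f g : ppint f -> ppint g -> ppint (f * g).
Proof. by move=> fp gp i; rewrite coefM; apply: pint_sum => j _; apply: pintM. Qed.

Lemma ppdvdM f g : ppdvd f -> ppint g -> ppdvd (f * g).
Proof. by move=> fp gp i; rewrite coefM; apply: pdvd_sum => j _; apply: pdvdMr. Qed.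

Lemma ppdvdD f g : ppdvd f -> ppdvd g -> ppdvd (f + g).
Proof. by move=> fp gp i; rewrite coefD; apply: pdvdD. Qed.

Lemma ppintX f n : ppint f -> ppint (f ^+ n).
Proof.
move=> fp; elim: n => [|n IHn].
  by move=> i; rewrite expr0 coef1; exact: (pint_nat (i == 0)%N).
by rewrite exprS; apply: ppintM.
Qed.

(** Horner induction: the middle binomial coefficients are divisible by [p], and constants satisfy
    Fermat's congruence. This is the congruence behind the Dieudonne-Dwork argument of [ah_pint]. *)
Lemma ppdvd_frobenius f : ppint f -> ppdvd (f ^+ p - (f \Po 'X^p)).
Proof.
elim/poly_ind: f => [|f c IHf] fp.
  by rewrite raddf0 expr0n gtn_eqF ?prime_gt0 //= subrr => i; rewrite coef0; exact: pdvd0.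
have cp : pint c by have := fp 0%N; rewrite coefD coefMX coefC add0r.
have fp' : ppint f by move=> i; have := fp i.+1; rewrite coefD coefMX coefC addr0.
have -> : (f * 'X + c%:P) ^+ p - ((f * 'X + c%:P) \Po 'X^p) =
   ((f * 'X + c%:P) ^+ p - (f * 'X) ^+ p - c%:P ^+ p) +
   (f ^+ p - (f \Po 'X^p)) * 'X^p + (c ^+ p - c)%:P.
  by rewrite comp_poly_MXaddC exprMn polyCB polyC_exp; ring.
have Xp : ppint 'X^p by move=> i; rewrite coefXn; exact: (pint_nat (_ == _)%N).
have fXp : ppint (f * 'X).
  by apply: ppintM => // i; rewrite coefX; exact: (pint_nat (_ == _)%N).
apply: ppdvdD; first apply: ppdvdD.
- have p0 := prime_gt0 p_pr.
  rewrite exprDn (bigD1 ord0) //= (bigD1 ord_max) /=; last by rewrite -val_eqE -lt0n.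
  rewrite subn0 subnn !expr0 mulr1 mul1r bin0 binn !mulr1n.
  set A := _ ^+ _; set B := _ ^+ p; set S := \sum_(i | _) _.
  have -> : A + (B + S) - A - B = S by ring.
  apply: (big_ind ppdvd) => [|* |i]; first by move=> j; rewrite coef0; exact: pdvd0.
    exact: ppdvdD.
  rewrite -!val_eqE /= => /andP[i0 ip].
  rewrite -mulr_natr; move=> j; rewrite -polyC_natr coefMC mulrC; apply: pdvdMr.
    apply/pdvd_nat/prime_dvd_bin => //; have := ltn_ord i; move: i0 ip.
    by move: (val i) => k; lia.
  apply: ppintM; apply: ppintX => // l.
  by rewrite coefC; case: ifP => // _; exact: (pint_nat 0).
- by apply: ppdvdM => //; apply: IHf.
- move=> i; rewrite coefC; case: ifP => _; [exact: pdvd_frobenius | exact: pdvd0].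
Qed.

End PIntegers.

(** * Exponentials handled through their logarithmic derivatives *)

Section TruncatedSeries.
Variables (F : fieldType).
Hypothesis F0 : forall k, (0 < k)%N -> (k%:R : F) != 0.
Implicit Types (f g H : {poly F}).

(* X f' = H f modulo X^(L+1), i.e. f is a multiple of exp (\int H / X) to that order. *)
Definition log_deriv L f H := forall i, (i <= L)%N -> ('X * f^`() - H * f)`_i = 0.

Lemma log_derivM L f g H H' : log_deriv L f H -> log_deriv L g H' ->
  log_deriv L (f * g) (H + H').
Proof.
move=> Hf Hg i iL.
have -> : 'X * (f * g)^`() - (H + H') * (f * g) =
  ('X * f^`() - H * f) * g + ('X * g^`() - H' * g) * f by rewrite derivM; ring.
by rewrite coefD (low_coefM _ Hf) // (low_coefM _ Hg) // addr0.
Qed.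

Lemma log_deriv1 L : log_deriv L 1 0.
Proof. by move=> i _; rewrite (derivC 1) mulr0 mul0r subrr coef0. Qed.

Lemma log_derivX L f H n : log_deriv L f H -> log_deriv L (f ^+ n) (H *+ n).
Proof.
move=> Hf; elim: n => [|n IHn]; first exact: log_deriv1.
by rewrite exprS mulrS; exact: log_derivM.
Qed.

Lemma log_deriv_prod L (I : Type) (r : seq I) (P : pred I) (G : I -> {poly F}) K :
  (forall i, P i -> log_deriv L (G i) (K i)) ->
  log_deriv L (\prod_(i <- r | P i) G i) (\sum_(i <- r | P i) K i).
Proof.
move=> H; apply: (big_ind2 (fun f h => log_deriv L f h)) => //; first exact: log_deriv1.
by move=> *; apply: log_derivM.
Qed.

Lemma coef_comp_scale f (t : F) i : (f \Po (t *: 'X))`_i = t ^+ i * f`_i.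
Proof.
rewrite comp_polyE; under eq_bigr => j _ do rewrite exprZn scalerA.
rewrite coef_sum; under eq_bigr => j _ do rewrite coefZ coefXn.
have [iS|iS] := ltnP i (size f); last first.
  rewrite nth_default // mulr0 big1 // => j _.
  by rewrite gtn_eqF ?mulr0 // (leq_trans (ltn_ord j)).
rewrite (bigD1 (Ordinal iS)) //= eqxx mulr1 big1 ?addr0 1?mulrC // => j.
by rewrite -val_eqE /= eq_sym => /negPf ->; rewrite mulr0.
Qed.

Lemma log_deriv_scale L f H (t : F) : log_deriv L f H ->
  log_deriv L (f \Po (t *: 'X)) (H \Po (t *: 'X)).
Proof.
move=> Hf i iL.
have -> : 'X * (f \Po (t *: 'X))^`() - (H \Po (t *: 'X)) * (f \Po (t *: 'X)) =
   (('X * f^`() - H * f) \Po (t *: 'X)).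
  rewrite deriv_comp derivZ derivX comp_polyB !comp_polyM comp_polyX -!mul_polyC.
  by move: (f^`() \Po _) (H \Po _) (f \Po _) => f1 H1 f2; ring.
by rewrite coef_comp_scale Hf ?mulr0.
Qed.

Lemma log_deriv_compXn L f H p : (0 < p)%N -> log_deriv L f H ->
  log_deriv L (f \Po 'X^p) ((H \Po 'X^p) *+ p).
Proof.
move=> p0 Hf i iL.
have -> : 'X * (f \Po 'X^p)^`() - (H \Po 'X^p) *+ p * (f \Po 'X^p) =
   (('X * f^`() - H * f) \Po 'X^p) *+ p.
  rewrite deriv_comp derivXn comp_polyB !comp_polyM comp_polyX.
  have Xp : 'X^p = 'X * 'X^(p.-1) :> {poly F} by rewrite -exprS prednK.
  move: (f^`() \Po _) (H \Po _) (f \Po _) => f1 H1 f2; rewrite {}Xp.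
  by ring.
rewrite coefMn coef_comp_poly_Xn //; case: ifP => _; last by rewrite mul0rn.
by rewrite Hf ?mul0rn // (leq_trans (leq_div _ _)).
Qed.

(** As [H] has no constant term, the equation of degree [i + 1] determines that coefficient from the
    earlier ones after division by [i + 1]. Identities between exponentials thus reduce to
    identities between their logarithmic derivatives. *)
Lemma log_deriv_inj L f g H H' : H`_0 = 0 -> (forall i, (i <= L)%N -> H`_i = H'`_i) ->
  f`_0 = g`_0 -> log_deriv L f H -> log_deriv L g H' ->
  forall i, (i <= L)%N -> f`_i = g`_i.
Proof.
move=> H0 HH fg0 Hf Hg; elim/ltn_ind => -[//|i] IHi iL.
have E h K : log_deriv L h K -> K`_0 = 0 ->
    i.+1%:R * h`_i.+1 = \sum_(j < i.+1) K`_j.+1 * h`_(i - j).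
  move=> /(_ _ iL) /eqP; rewrite coefB subr_eq0 coefXM coef_deriv /= => /eqP E K0.
  by rewrite mulr_natl E coefM big_ord_recl K0 mul0r add0r.
apply: (mulfI (F0 (ltn0Sn i))); rewrite (E f H) // (E g H') -?HH //.
apply: eq_bigr => j _; rewrite HH ?(leq_trans _ iL) // IHi //.
  by rewrite ltnS leq_subr.
by rewrite (leq_trans (leq_subr _ _)) // ltnW.
Qed.

End TruncatedSeries.

Section ArtinHasse.
Variables (F : fieldType) (p : nat).

Fixpoint ah_seq (n : nat) : seq F :=
  if n is n'.+1 then
    rcons (ah_seq n')
      (n%:R^-1 * \sum_(m < n | (p ^ m <= n)%N) nth 0 (ah_seq n') (n - p ^ m))
  else [:: 1].

(* Coefficients of the Artin-Hasse exponential exp (\sum_m X^(p^m) / p^m). *)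
Definition ah n := nth 0 (ah_seq n) n.

Lemma size_ah_seq n : size (ah_seq n) = n.+1.
Proof. by elim: n => //= n IHn; rewrite size_rcons IHn. Qed.

Lemma nth_ah_seq n i : (i <= n)%N -> nth 0 (ah_seq n) i = ah i.
Proof.
elim: n => [|n IHn]; first by rewrite leqn0 => /eqP ->.
rewrite leq_eqVlt => /orP[/eqP -> //|i_n] /=.
by rewrite nth_rcons size_ah_seq i_n; exact: IHn.
Qed.

Lemma ah0 : ah 0 = 1. Proof. by []. Qed.

Hypotheses (p_pr : prime p) (F0 : forall k, (0 < k)%N -> (k%:R : F) != 0).

(** The coefficient form of [X E' = (\sum_m X^(p^m)) E]. Any [K >= n] bounds the sum, because
    [p ^ m <= n] forces [m < n]. *)
Lemma ah_rec n K : (n <= K)%N ->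
  n%:R * ah n = \sum_(m < K | (p ^ m <= n)%N) ah (n - p ^ m).
Proof.
have p1 := prime_gt1 p_pr.
case: n => [|n] nK.
  rewrite mul0r big_pred0 // => m; apply/negbTE; rewrite -ltnNge expn_gt0.
  by rewrite prime_gt0.
rewrite {1}/ah /= nth_rcons size_ah_seq ltnn eqxx mulrA divff ?mul1r ?F0 //.
rewrite (big_ord_widen_cond K (fun m => p ^ m <= n.+1)%N
  (fun m => nth 0 (ah_seq n) (n.+1 - p ^ m))) //.
apply: eq_big => [m|m /andP[pm _]].
  case: (leqP (p ^ m) n.+1) => //= pm.
  by rewrite (leq_trans _ pm) // ltn_expl.
apply: nth_ah_seq; have : (0 < p ^ m)%N by rewrite expn_gt0 prime_gt0.
by move: (p ^ m)%N => k; lia.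
Qed.

#[local] Opaque ah.

Lemma ah_small l : (l < p)%N -> ah l * l`!%:R = 1.
Proof.
have p1 := prime_gt1 p_pr.
elim: l => [|l IHl] lp; first by rewrite ah0 fact0 mulr1.
have E : l.+1%:R * ah l.+1 = ah l.
  rewrite (@ah_rec _ l.+1) // (bigD1 ord0) /=; last by rewrite expn0.
  rewrite big1 => [|i].
    by rewrite addr0 expn0 subn1.
  case/andP=> + i0; rewrite leqNgt => /negP[]; apply: leq_trans lp _.
  by rewrite -{1}(expn1 p) leq_exp2l // lt0n.
by rewrite factS natrM mulrA [ah _ * _]mulrC E IHl // ltnW.
Qed.

Definition AH L : {poly F} := \poly_(i < L.+1) ah i.
Definition AHlog L : {poly F} := \sum_(m < L.+1) 'X^(p ^ m).

Lemma coef_AH L i : (i <= L)%N -> (AH L)`_i = ah i.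
Proof. by move=> iL; rewrite coef_poly ltnS iL. Qed.

Lemma AHlog0 L : (AHlog L)`_0 = 0.
Proof.
rewrite coef_sum big1 // => m _; rewrite coefXn eq_sym gtn_eqF //.
by rewrite expn_gt0 prime_gt0.
Qed.

Lemma log_deriv_AH L : log_deriv L (AH L) (AHlog L).
Proof.
move=> i iL; rewrite coefB coefXM coef_deriv; apply/eqP; rewrite subr_eq0; apply/eqP.
transitivity (i%:R * ah i).
  by case: i iL => [|i] iL; rewrite ?mul0r //= coef_AH // mulr_natl.
rewrite (@ah_rec _ L.+1); last exact: ltnW.
rewrite mulr_suml coef_sum big_mkcond; apply: eq_bigr => m _.
rewrite coefXnM; case: leqP => // mi; rewrite coef_AH //.
by rewrite (leq_trans (leq_subr _ _)).
Qed.

Definition expX L (c : F) : {poly F} := \poly_(i < L.+1) (c ^+ i / i`!%:R).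

Lemma log_deriv_expX L c : log_deriv L (expX L c) (c *: 'X).
Proof.
move=> i iL; rewrite coefB coefXM coef_deriv -scalerAl coefZ coefXM.
case: i iL => [|i] iL /=; first by rewrite mulr0 subrr.
rewrite !coef_poly ltnS iL ltnS ltnW // -[_ *+ i.+1]mulr_natr factS natrM exprS.
have := F0 (fact_gt0 i); have := F0 (ltn0Sn i).
by move: (i.+1%:R) (i`!%:R) => a b a0 b0; field; rewrite a0 b0.
Qed.

(** [p] times [\sum_m X^(p^m) / p^m] is [p X] plus the same series evaluated at [X^p]; the last term
    of the truncation lies beyond degree [L]. *)
Lemma AH_frobenius L i : (i <= L)%N ->
  (AH L ^+ p)`_i = ((AH L \Po 'X^p) * expX L p%:R)`_i.
Proof.
move=> iL; have p0 := prime_gt0 p_pr.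
apply: (@log_deriv_inj _ F0 L _ _ (AHlog L *+ p)
  ((AHlog L \Po 'X^p) *+ p + p%:R *: 'X) _ _ _ _ _ _ iL).
- by rewrite coefMn AHlog0 mul0rn.
- move=> j jL; rewrite coefD -scaler_nat coefZ coefZ -scaler_nat coefZ -mulrDr -coefD.
  congr (_ * _); rewrite /AHlog raddf_sum /=.
  under [in RHS]eq_bigr => m _ do rewrite comp_Xn_poly -exprM -expnS.
  rewrite big_ord_recl expn0 expr1 addrC !coefD; congr (_ + _).
  rewrite big_ord_recr /= coefD [X in _ = _ + X]coefXn eq_sym gtn_eqF ?addr0 //.
    by rewrite (leq_ltn_trans jL) // ltnW // ltn_expl // prime_gt1.
- rewrite coefM big_ord1 /= -!horner_coef0 horner_exp horner_comp hornerXn.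
  rewrite expr0n gtn_eqF // !horner_coef0 coef_AH // ah0 coef_poly /= expr1n mul1r.
  by rewrite expr0 fact0 divr1.
- by apply: log_derivX; exact: log_deriv_AH.
- apply: log_derivM; last exact: log_deriv_expX.
  by apply: log_deriv_compXn => //; exact: log_deriv_AH.
Qed.

Lemma pdvd_expX i : (0 < i)%N -> pdvd p (p%:R ^+ i / i`!%:R : F).
Proof.
move=> i0; have p0 := F0 (prime_gt0 p_pr).
have [b pb ib] := pfactor_coprime p_pr (fact_gt0 i).
set a := logn p i`! in ib; have ai : (a < i)%N.
  have := logn_fact_le p_pr i0; rewrite -/a; apply: leq_ltn_trans.
  by rewrite leq_pmull // -ltnS prednK ?prime_gt1 // prime_gt0.
have b0 : (b%:R : F) != 0 by apply/F0/(pcoprime_gt0 p_pr).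
exists (p%:R ^+ (i - a).-1 * b%:R^-1).
  by rewrite -natrX; apply: pintM; [exact: pint_nat | exact: pint_inv_nat].
rewrite ib natrM natrX invfM mulrA mulrA -exprS prednK ?subn_gt0 //.
rewrite expfB // mulrAC; congr (_ / _); rewrite mulrAC.
Qed.

(** Dieudonne-Dwork argument: the n-th coefficient of [E^p] is that of [g^p] plus [p * ah n], where
    [g] collects the earlier coefficients. Compared with [E(X^p) exp(p X)], everything except
    [p * ah n] is known to be [g^p - g(X^p)] up to multiples of [p]. *)
Lemma ah_pint l : pint p (ah l).
Proof.
elim/ltn_ind: l => -[|l] IHl; first exact: (pint_nat _ _ 1).
have p0 := prime_gt0 p_pr.
set n := l.+1 in IHl *; have n0 : (0 < n)%N by [].
pose g : {poly F} := \poly_(i < n) ah i.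
have gE i : (i < n)%N -> g`_i = ah i by move=> il; rewrite coef_poly il.
have gp : ppint p g.
  move=> i; rewrite coef_poly; case: ifP => [/IHl //|_]; exact: (pint_nat _ _ 0).
have AHE : AH n = g + ah n *: 'X^n.
  apply/polyP => i; rewrite coefD coefZ coefXn !coef_poly ltnS leq_eqVlt.
  by case: (ltngtP i n) => [||->]; rewrite ?mulr0 ?addr0 ?mulr1 ?add0r.
suff : pdvd p (p%:R * ah n).
  by case=> y yp /(mulfI (F0 p0)) ->.
have Ep : (AH n ^+ p)`_n = (g ^+ p)`_n + p%:R * ah n.
  apply/eqP; rewrite addrC -subr_eq -coefB subrXX AHE addrC addKr -scalerAl coefZ.
  rewrite coefXnM ltnn subnn coef_sum mulrC; apply/eqP; congr (_ * _).
  transitivity (\sum_(i < p) (1 : F)); last by rewrite sumr_const card_ord.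
  apply: eq_bigr => i _; rewrite -horner_coef0 !(hornerE, horner_exp).
  by rewrite horner_coef0 gE // ah0 expr0n (gtn_eqF n0) mulr0 addr0 !expr1n mulr1.
have := AH_frobenius (leqnn n); rewrite Ep => /(canRL (addKr _)) ->.
(* Up to degree [n], the composite with [X^p] involves only coefficients of index below [n], already
   under control. *)
have compE j : (j <= n)%N -> (AH n \Po 'X^p)`_j = (g \Po 'X^p)`_j.
  move=> jn; rewrite !coef_comp_poly_Xn //; case: ifP => // pj.
  have [->|j0] := posnP j; first by rewrite div0n coef_AH // gE.
  have lt : (j %/ p < n)%N by apply: leq_trans jn; rewrite ltn_Pdiv ?prime_gt1.
  by rewrite coef_AH ?gE // ltnW.
rewrite coefM big_ord_recr /= subnn coef_poly expr0 fact0 divr1 mulr1.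
rewrite compE // addrCA; apply: pdvdD.
  apply: pdvd_sum => i _; rewrite compE ?(ltnW (ltn_ord i)) //; apply: pdvdMl.
    rewrite coef_comp_poly_Xn //; case: ifP => _ //; exact: (pint_nat _ _ 0).
  rewrite coef_poly; case: ifP => _; last exact: pdvd0.
  by apply: pdvd_expX; rewrite subn_gt0.
rewrite addrC -opprB -coefB; apply: pdvdN => //; exact: ppdvd_frobenius.
Qed.

End ArtinHasse.

(** * Dwork's splitting function *)

Section ExpComposition.
Variable F : fieldType.
Hypothesis F0 : forall k, (0 < k)%N -> (k%:R : F) != 0.

Lemma deriv_expX L : (expX L (1 : F))^`() = expX L 1 - (L`!%:R)^-1 *: 'X^L.
Proof.
apply/polyP => i; rewrite coef_deriv coefB coefZ coefXn !coef_poly !expr1n !mul1r ltnS.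
case: (ltngtP i L) => [iL|iL|->].
- rewrite ltnS ltnW // mulr0 subr0 factS natrM invfM mulrC -[_ *+ _]mulr_natr.
  by rewrite -mulrA mulVf ?mulr1 // F0.
- by rewrite ltnS leqNgt iL /= mul0rn mulr0 subr0.
by rewrite ltnS leqnn mulr1 subrr mul0rn.
Qed.

(** The truncated exponential fails its differential equation only by its top term, which becomes a
    multiple of [X^(L+1)] here because the argument is divisible by [X]. *)
Lemma log_deriv_exp_comp L (u : {poly F}) :
  log_deriv L (expX L 1 \Po ('X * u)) ('X * ('X * u)^`()).
Proof.
move=> i iL; rewrite deriv_comp deriv_expX comp_polyB comp_polyZ comp_Xn_poly.
set d := ('X * u)^`(); set f := expX L 1 \Po _.
have -> : 'X * ((f - L`!%:R^-1 *: ('X * u) ^+ L) * d) - 'X * d * f =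
    'X^(L.+1) * (- (L`!%:R^-1 *: (d * u ^+ L))).
  by rewrite exprMn exprS -!mul_polyC; ring.
by rewrite coefXnM ltnS iL.
Qed.

End ExpComposition.

Section Splitting.
Variables (Om : closedFieldType) (v : Om -> rat) (p : nat) (pi zeta : Om).
Hypotheses (vP : is_valuation v) (p_pr : prime p).
Hypotheses (pn0 : (p%:R : Om) != 0) (vp : 0 < v p%:R).

Lemma nu_coprime b : coprime p b -> (b%:R : Om) != 0 /\ v b%:R = 0.
Proof.
move=> pb; suff H : ~ val_gt v b%:R 0.
  have b0 : (b%:R : Om) != 0 by apply/eqP => b0; apply: H; left.
  split=> //; apply/eqP; rewrite eq_le; apply/andP; split.
    by rewrite leNgt; apply/negP => vb; apply: H; right.
  by case: (vge_nat vP b) => // /eqP; rewrite (negPf b0).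
move=> vb; have b0 := pcoprime_gt0 p_pr pb.
have [u] := coprimeP _ (prime_gt0 p_pr) pb; move: u => [u w] /= E.
have E1 : (u * p)%:R - (w * b)%:R = 1 :> Om.
  by rewrite -natrB ?E //; lia.
have : val_gt v (1 : Om) 0.
  rewrite -E1; apply: vgtB => //; rewrite natrM mulrC; apply: vgtM0 => //.
  - by right.
  - exact: vge_nat.
  - exact: vge_nat.
by case=> [/eqP|]; rewrite ?oner_eq0 // (nu1 vP) // ltxx.
Qed.

Lemma nat_neq0 k : (0 < k)%N -> (k%:R : Om) != 0.
Proof.
move=> k0; have [b pb ->] := pfactor_coprime p_pr k0.
by rewrite natrM natrX mulf_neq0 ?expf_neq0 //; case: (nu_coprime pb).
Qed.

Lemma nu_nat k : (0 < k)%N -> v k%:R = (logn p k)%:R * v p%:R.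
Proof.
move=> k0; have [b pb kE] := pfactor_coprime p_pr k0.
have [b0 vb] := nu_coprime pb.
by rewrite {1}kE natrM natrX (nuM vP) ?expf_neq0 // vb (nuX vP) // add0r.
Qed.

Lemma pint_vge x : pint p x -> val_ge v x 0.
Proof.
case=> a [b /nu_coprime[b0 vb] xE]; have [->|x0] := eqVneq x 0; first by left.
right; have : val_ge v (a%:~R : Om) 0.
  case: a {xE} => n; first exact: vge_nat.
  by rewrite NegzE rmorphN; apply/vgeN => //; exact: vge_nat.
by rewrite -xE; case=> [/eqP|]; [rewrite mulf_eq0 (negPf x0) (negPf b0) | rewrite (nuM vP) // vb addr0].
Qed.

Lemma vge_ah l : val_ge v (ah Om p l) 0.
Proof. by apply: pint_vge; apply: ah_pint => //; exact: nat_neq0. Qed.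

Hypothesis piE : dwork_pi p pi.

Lemma pi_neq0 : pi != 0.
Proof.
apply: contraNneq pn0 => pi0; move: piE; rewrite /dwork_pi pi0 expr0n.
have := prime_gt1 p_pr; case: p => [|[|q]] //= _ /eqP.
by rewrite eq_sym oppr_eq0 => /eqP ->.
Qed.

Local Notation g := (v pi).

Lemma nu_p : v p%:R = (p.-1)%:R * g.
Proof. by rewrite -(nuX vP) ?pi_neq0 // piE (nuN vP). Qed.

Lemma p1_gt0 : (0 : rat) < (p.-1)%:R.
Proof. by rewrite ltr0n -ltnS prednK ?prime_gt1 ?prime_gt0. Qed.

Lemma g_gt0 : 0 < g.
Proof. by move: vp; rewrite nu_p pmulr_rgt0 ?p1_gt0. Qed.

Lemma nu_fact_le i : v i`!%:R <= i%:R * g.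
Proof.
rewrite nu_nat ?fact_gt0 // nu_p mulrA ler_wpM2r ?(ltW g_gt0) //.
rewrite -natrM ler_nat mulnC; case: i => [|i]; first by rewrite fact0 logn1 muln0.
by rewrite ltnW // logn_fact_le.
Qed.

(** The logarithm of the Artin-Hasse exponential divided by [X]. Its first two terms,
    [1 + X^(p-1) / p], cancel at [pi]. *)
Definition logAH L : {poly Om} := \sum_(m < L.+1) (p ^ m)%:R^-1 *: 'X^((p ^ m).-1).

Lemma deriv_logAH L : 'X * ('X * logAH L)^`() = AHlog Om p L.
Proof.
rewrite mulr_sumr raddf_sum mulr_sumr; apply: eq_bigr => m _ /=.
have pm0 : (0 < p ^ m)%N by rewrite expn_gt0 prime_gt0.
rewrite -scalerAr -exprS prednK // derivZ derivXn -scaler_nat scalerA.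
by rewrite mulVf ?nat_neq0 // scale1r -exprS prednK.
Qed.

(** Makes the terms [m >= 2] of [logAH] at [pi] negligible: their valuation is
    [(p^m - 1 - (p - 1) m) g]. *)
Lemma expn_ge m : (2 <= m)%N -> (p.-1 * m + 2 <= p ^ m)%N.
Proof.
have p1 := prime_gt1 p_pr.
elim: m => // -[//|[|m] IHm] _; first by rewrite !expnS expn0; nia.
have := IHm isT; rewrite [(p ^ m.+3)%N]expnS; move: (p ^ m.+2)%N => k; nia.
Qed.

(** Equivalent to [(p - 1) (1 - m) >= 1 - p^m / 2], the condition that [decay_logAH] puts on the
    coefficient of degree [p^m]. *)
Lemma expn_ge2 m : (2 * (1 + p.-1 * m) <= 2 * p.-1 + p ^ m)%N.
Proof.
have p1 := prime_gt1 p_pr.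
case: m => [|m]; first by rewrite expn0; lia.
elim: m => [|m IHm]; first by rewrite expn1; lia.
rewrite expnS; move: (p ^ m.+1)%N IHm => k; nia.
Qed.

(** One Newton step at [pi]: the value of [logAH] has valuation at least [g], and its derivative
    exactly [-g], from the term [X^(p-1) / p]. So [root_near] finds a root at distance [2 g];
    algebraic closedness replaces completeness. *)
Lemma exists_gamma L : (0 < L)%N ->
  exists2 ga, (logAH L).[ga] = 0 & val_ge v (ga - pi) (2%:R * g).
Proof.
case: L => // L _; have p1 := prime_gt1 p_pr; have p0 := prime_gt0 p_pr.
have g0 := g_gt0; have pi0 := pi_neq0.
have pX m : (0 < p ^ m)%N by rewrite expn_gt0 p0.
have vpm m : v (p ^ m)%:R^-1 = - (m%:R * (p.-1%:R * g)).
  by rewrite (nuV vP) ?nat_neq0 // natrX (nuX vP) // nu_p.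
have split2 (Z : zmodType) (G : nat -> Z) :
    \sum_(m < L.+2) G m = G 0%N + (G 1%N + \sum_(m < L) G m.+2).
  by rewrite !big_ord_recl; congr (_ + (_ + _)); apply: eq_bigr.
have hE : (logAH L.+1).[pi] = \sum_(m < L) (p ^ m.+2)%:R^-1 * pi ^+ (p ^ m.+2).-1.
  rewrite /logAH (split2 _ (fun m => (p ^ m)%:R^-1 *: 'X^((p ^ m).-1))).
  rewrite !hornerD horner_sum expn0 expn1 !hornerZ !hornerXn piE invr1 expr0 mul1r.
  rewrite mulrN mulVf // addNKr; apply: eq_bigr => m _.
  by rewrite hornerZ hornerXn.
have h'E : (logAH L.+1)^`().[pi] = p%:R^-1 * (p.-1%:R * pi ^+ p.-2) +
   \sum_(m < L) (p ^ m.+2)%:R^-1 * ((p ^ m.+2).-1%:R * pi ^+ (p ^ m.+2).-2).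
  rewrite /logAH (split2 _ (fun m => (p ^ m)%:R^-1 *: 'X^((p ^ m).-1))).
  rewrite !derivD raddf_sum /= expn0 expn1 expr0 !derivZ derivXn (derivC 1) scaler0 add0r.
  rewrite !hornerD horner_sum hornerZ hornerMn hornerXn mulr_natl; congr (_ + _).
  by apply: eq_bigr => m _; rewrite derivZ derivXn hornerZ hornerMn hornerXn mulr_natl.
have expg m : p.-1%:R * m.+2%:R + 2%:R <= (p ^ m.+2)%:R :> rat.
  by rewrite -natrM -natrD ler_nat expn_ge.
have small m : val_ge v ((p ^ m.+2)%:R^-1 * pi ^+ (p ^ m.+2).-1) g.
  right; rewrite (nuM vP) ?expf_neq0 ?invr_neq0 ?nat_neq0 // vpm (nuX vP) //.
  rewrite mulrA -mulNr -mulrDl -[leLHS]mul1r ler_wpM2r ?(ltW g0) //.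
  by rewrite -[(p ^ _).-1]subn1 natrB //; have := expg m; lra.
have small' m : val_ge v ((p ^ m.+2)%:R^-1 * ((p ^ m.+2).-1%:R * pi ^+ (p ^ m.+2).-2)) 0.
  rewrite mulrCA mulrC; apply: vgeM0 => //; last exact: vge_nat.
  right; rewrite (nuM vP) ?expf_neq0 ?invr_neq0 ?nat_neq0 // vpm (nuX vP) //.
  rewrite mulrA -mulNr -mulrDl mulr_ge0 ?(ltW g0) //.
  have p2 : (2 <= p ^ m.+2)%N by apply: leq_trans (@expn_ge m.+2 isT); exact: leq_addl.
  by rewrite -[(p ^ _).-2]subn2 natrB //; have := expg m; lra.
have cop : coprime p p.-1 by rewrite coprimenP.
have [p10 vp1] := nu_coprime cop.
have head0 : p%:R^-1 * (p.-1%:R * pi ^+ p.-2) != 0 by rewrite !mulf_neq0 ?invr_neq0 ?expf_neq0.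
have vhead : v (p%:R^-1 * (p.-1%:R * pi ^+ p.-2)) = - g.
  rewrite !(nuM vP) ?mulf_neq0 ?invr_neq0 ?expf_neq0 // (nuV vP) // nu_p (nuX vP) // vp1.
  by rewrite -subn2 -subn1 !natrB //; ring.
have [h'0 vh'] : (logAH L.+1)^`().[pi] != 0 /\ v (logAH L.+1)^`().[pi] = - g.
  apply: (nu_eq vP _ head0 vhead); rewrite h'E addrC addKr.
  by apply: vgt_sum => // m _; apply: vgt_ge (small' m); rewrite oppr_lt0.
have hpi : val_ge v (logAH L.+1).[pi] g by rewrite hE; apply: vge_sum => // m _; exact: small.
have [rho /eqP rho0 [h0|near]] := root_near vP h'0.
  by exists pi => //; rewrite subrr; left.
have [h0|h0] := eqVneq (logAH L.+1).[pi] 0.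
  by exists pi => //; rewrite subrr; left.
exists rho => //; rewrite -opprB; apply/vgeN => //; apply: vgeW near.
case: hpi => [/eqP|hpi]; first by rewrite (negPf h0).
by rewrite vh'; lra.
Qed.

(* h(X) with v (h_D) >= b - D g / 2; such h take values of valuation at least
   b + D g / 2 term by term at elements of valuation g. *)
Definition decay (b : rat) (h : {poly Om}) :=
  forall D, val_ge v h`_D (b - D%:R * (g / 2%:R)).

Lemma decayM b b' h h' : decay b h -> decay b' h' -> decay (b + b') (h * h').
Proof.
move=> H H' D; rewrite coefM; apply: vge_sum => // i _.
have iD : (i <= D)%N by rewrite -ltnS.
apply: vgeW (vgeM vP (H i) (H' (D - i)%N)).
by rewrite natrB //; lra.
Qed.

Lemma decay1 : decay 0 1.
Proof.
move=> [|D]; rewrite coef1 /=; first by right; rewrite (nu1 vP) // mul0r subr0.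
by left.
Qed.

Lemma decayX b h i : decay b h -> decay (i%:R * b) (h ^+ i).
Proof.
move=> H; elim: i => [|i IHi]; first by rewrite mul0r expr0; exact: decay1.
by rewrite exprS -natr1 mulrDl mul1r addrC; exact: decayM.
Qed.

Lemma decay_logAH L T : val_ge v T 0 ->
  decay g ('X * ((p%:R * T) *: logAH L)).
Proof.
move=> T0 D; rewrite -scalerAr coefZ mulr_sumr coef_sum mulr_sumr.
apply: vge_sum => // m _; have pm0 : (0 < p ^ m)%N by rewrite expn_gt0 prime_gt0.
rewrite -scalerAr -exprS prednK // coefZ coefXn.
case: eqP => [->|_]; last by rewrite !mulr0; left.
rewrite mulr1 mulrAC; apply: vgeM0 => //; right.
have q0 : ((p ^ m)%:R : Om) != 0 by exact: nat_neq0.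
rewrite (nuM vP) ?invr_neq0 // (nuV vP) //.
have -> : v (p ^ m)%:R = m%:R * v p%:R by rewrite natrX (nuX vP).
rewrite nu_p.
have := expn_ge2 m; rewrite -(ler_nat rat) natrD !natrM natrD natrM natrX => h.
have := g_gt0; move: h; move: (_ ^+ _) => q; move: (p.-1%:R) (m%:R) (v pi) => a b c.
by nra.
Qed.

Section Unity.
Variables (L e : nat) (ga : Om).
Hypotheses (L0 : (0 < L)%N) (gaE : (logAH L).[ga] = 0)
  (gapi : val_ge v (ga - pi) (2%:R * g)).
Variable t : Om.
Hypotheses (t0 : val_ge v t 0) (te : t ^+ (p ^ e) = t).

Let T := \sum_(j < e) t ^+ (p ^ j).

Lemma T_frobenius m : \sum_(j < e) (t ^+ (p ^ j)) ^+ (p ^ m) = T.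
Proof.
elim: m => [|m IHm]; first by apply: eq_bigr => j _; rewrite expn0 expr1.
rewrite -{}IHm; case: e te => [|e'] te'; first by rewrite !big_ord0.
rewrite big_ord_recr big_ord_recl /= addrC -!exprM -!expnD add0n.
congr (_ + _); last by apply: eq_bigr => i _; rewrite -!exprM -!expnD addSnnS.
by rewrite -addSnnS expnD exprM te'.
Qed.

Lemma vge_T : val_ge v T 0.
Proof. by apply: vge_sum => // j _; apply: vgeX0. Qed.

Lemma nu_ga : ga != 0 /\ v ga = g.
Proof.
apply: (nu_eq vP _ pi_neq0 (erefl _)); apply: vgt_ge gapi.
by have := g_gt0; lra.
Qed.

(** Formally the p-th power is the exponential of [p T ga logAH(ga) = 0]; the factor [p] is what
    brings [ga] into the domain of convergence. As polynomials in [X], [Lam] and [Rr] agree through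
    degree [L]. In degree [D > L] their coefficients have valuation at least [- D g / 2], against
    [D g] for [ga^D]. *)
Lemma split_pth_power :
  val_ge v ((\prod_(j < e) (AH Om p L).[ga * t ^+ (p ^ j)]) ^+ p - 1) (L.+1%:R * (g / 2%:R)).
Proof.
pose Lam := \prod_(j < e) (AH Om p L \Po (t ^+ (p ^ j) *: 'X)) ^+ p.
pose u := (p%:R * T) *: logAH L; pose Rr := expX L 1 \Po ('X * u).
have [ga0 vga] := nu_ga.
have LamE : (\prod_(j < e) (AH Om p L).[ga * t ^+ (p ^ j)]) ^+ p = Lam.[ga].
  rewrite horner_prod -prodrXl; apply: eq_bigr => j _.
  by rewrite horner_exp horner_comp hornerZ hornerX [_ * ga]mulrC.
have RE : Rr.[ga] = 1.
  rewrite horner_comp hornerM hornerX hornerZ gaE !mulr0 horner_coef0 coef_poly /=.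
  by rewrite expr0 fact0 divr1.
have Asum : \sum_(j < e) (AHlog Om p L \Po (t ^+ (p ^ j) *: 'X)) = T *: AHlog Om p L.
  rewrite /AHlog; under eq_bigr => j _ do rewrite raddf_sum /=.
  rewrite exchange_big /= scaler_sumr; apply: eq_bigr => m _.
  under eq_bigr => j _ do rewrite comp_Xn_poly exprZn.
  by rewrite -scaler_suml T_frobenius.
have low i : (i <= L)%N -> Lam`_i = Rr`_i.
  apply: (@log_deriv_inj _ nat_neq0 L _ _
    (\sum_(j < e) (AHlog Om p L \Po (t ^+ (p ^ j) *: 'X)) *+ p) ('X * ('X * u)^`())).
  - rewrite coef_sum big1 // => j _.
    by rewrite coefMn coef_comp_scale AHlog0 // mulr0 mul0rn.
  - move=> {}i iL; congr (_`_i); rewrite /u -scalerAr derivZ -scalerAr deriv_logAH.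
    by rewrite sumrMnl Asum -scalerA scaler_nat.
  - rewrite -!horner_coef0 horner_prod horner_comp hornerM hornerX mul0r.
    rewrite horner_coef0 coef_poly /= expr0 fact0 divr1 big1 // => j _.
    rewrite horner_exp horner_comp hornerZ hornerX mulr0 horner_coef0.
    by rewrite coef_AH // ah0 expr1n.
  - apply: log_deriv_prod => j _; apply: log_derivX; apply: log_deriv_scale.
    by apply: log_deriv_AH => //; exact: nat_neq0.
  - by apply: log_deriv_exp_comp; exact: nat_neq0.
rewrite LamE -RE -hornerN -hornerD horner_coef; apply: vge_sum => // D _.
have [DL|DL] := leqP D L; first by rewrite coefB low // subrr mul0r; left.
apply: (@vgeW _ _ (D%:R * (g / 2%:R))).
  by rewrite ler_wpM2r ?ler_nat // divr_ge0 // ltW ?g_gt0.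
have gaD : val_ge v (ga ^+ D) (D%:R * g) by right; rewrite (nuX vP) // vga.
have -> : D%:R * (g / 2%:R) = - (D%:R * (g / 2%:R)) + D%:R * g by lra.
apply: vgeM => //; rewrite coefB; apply: vgeB => //.
  apply: (@vgeW _ _ 0).
    by rewrite oppr_le0 mulr_ge0 // divr_ge0 // ltW ?g_gt0.
  have ppM (a b : {poly Om}) : (forall i, val_ge v a`_i 0) ->
      (forall i, val_ge v b`_i 0) -> forall i, val_ge v (a * b)`_i 0.
    by move=> a0 b0 i; rewrite coefM; apply: vge_sum => // j _; apply: vgeM0.
  have pp1 i : val_ge v (1 : {poly Om})`_i 0 by rewrite coef1; exact: vge_nat.
  have ppX (a : {poly Om}) k : (forall i, val_ge v a`_i 0) -> forall i, val_ge v (a ^+ k)`_i 0.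
    by move=> a0; elim: k => [|k IHk]; rewrite ?expr0 ?exprS //; exact: ppM.
  move: (val D) => {D DL gaD} D; move: D.
  apply: (big_ind (fun a : {poly Om} => forall i, val_ge v a`_i 0)) => // j _.
  have : forall i, val_ge v (AH Om p L \Po (t ^+ (p ^ j) *: 'X))`_i 0.
    move=> i; rewrite coef_comp_scale coef_poly.
    apply: vgeM0 => //; first by apply: vgeX0 => //; apply: vgeX0.
    by case: ifP => _; [exact: vge_ah | left].
  exact: ppX.
move: (val D) => {D DL gaD} D; rewrite /Rr comp_polyE coef_sum; apply: vge_sum => // i _.
rewrite coefZ -[X in val_ge v _ X]add0r.
have := decayX i (decay_logAH L vge_T) D; rewrite -/u => H.
rewrite coef_poly; case: ifP => _; last by rewrite mul0r; left.
rewrite expr1n mul1r.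
have f0 : (i`!%:R : Om) != 0 by apply/nat_neq0/fact_gt0.
have : val_ge v (i`!%:R^-1 : Om) (- v i`!%:R) by right; rewrite (nuV vP).
move=> /(vgeM vP) /(_ H); apply: vgeW.
by rewrite addrA lerD2r addrC subr_ge0; exact: nu_fact_le.
Qed.

Lemma first_order_prod (I : Type) (r : seq I) (G x : I -> Om) :
  (forall i, val_ge v (x i) g) -> (forall i, val_ge v (G i - (1 + x i)) (2%:R * g)) ->
  val_ge v (\prod_(i <- r) G i - (1 + \sum_(i <- r) x i)) (2%:R * g).
Proof.
move=> xg Gx; have g0 := g_gt0; elim: r => [|i r IHr].
  by rewrite !big_nil addr0 subrr; left.
rewrite !big_cons; set A := \prod_(_ <- _) _ in IHr *; set S := \sum_(_ <- _) _ in IHr *.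
have Sg : val_ge v S g by apply: vge_sum.
have Gi0 : val_ge v (G i) 0.
  rewrite -(subrK (1 + x i) (G i)); apply: vgeD => //.
    by apply: vgeW (Gx i); lra.
  apply: vgeD => //; first by right; rewrite (nu1 vP).
  by apply: vgeW (xg i); lra.
have -> : G i * A - (1 + (x i + S)) =
    (A - (1 + S)) * G i + (G i - (1 + x i)) * (1 + S) + x i * S by ring.
apply: vgeD => //; first apply: vgeD => //.
- exact: vgeM0.
- apply: vgeM0 => //; apply: vgeD => //; first by right; rewrite (nu1 vP).
  by apply: vgeW Sg; lra.
by rewrite mulr_natl mulr2n; apply: vgeM.
Qed.

Hypothesis zetaE : dwork_psi v p pi zeta.

Lemma zeta_first_order a : val_ge v (zeta ^+ a - (1 + a%:R * (zeta - 1))) (2%:R * g).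
Proof.
have [_ z1] := zetaE; have g0 := g_gt0.
have zg : val_ge v (zeta - 1) g.
  have -> : zeta - 1 = (zeta - (1 + pi)) + pi by ring.
  by apply: vgeD => //; [apply: vgeW z1; lra | right].
have := @first_order_prod 'I_a (index_enum _) (fun=> zeta) (fun=> zeta - 1) (fun=> zg).
rewrite prodr_const sumr_const card_ord [a%:R * _]mulr_natl; apply => i.
by rewrite addrCA addrN addr0 subrr; left.
Qed.

(** [split_pth_power] bounds the product of all [Psi - zeta^i]. Since [Psi] is closer than [g] to
    [zeta^a], while distinct p-th roots of unity are at distance exactly [g], the other [p - 1]
    factors have valuation [g]; dividing them out costs [(p - 1) g]. *)
Lemma dwork_splitting a : val_gt v (T - a%:R) 0 ->
  val_ge v (\prod_(j < e) (AH Om p L).[ga * t ^+ (p ^ j)] - zeta ^+ a)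
    (L.+1%:R * (g / 2%:R) - p.-1%:R * g).
Proof.
move=> Ta; have [zp z1] := zetaE; have g0 := g_gt0; have [ga0 vga] := nu_ga.
set Psi := \prod_(j < e) _.
have w0 : val_gt v ((zeta - 1) - pi) g.
  by rewrite -addrA -opprD; apply: vgt_ge z1; lra.
have [wn0 vw] := nu_eq vP w0 pi_neq0 (erefl _).
have Psi1 : val_ge v (Psi - (1 + ga * T)) (2%:R * g).
  rewrite /T mulr_sumr; apply: first_order_prod => j.
    by rewrite -[g]addr0; apply: vgeM => //; [right; rewrite vga | apply: vgeX0].
  set x := ga * _; have xg : val_ge v x g.
    by rewrite -[g]addr0; apply: vgeM => //; [right; rewrite vga | apply: vgeX0].
  have ah1 : ah Om p 1 = 1.
    by have := ah_small p_pr nat_neq0 (prime_gt1 p_pr); rewrite mulr1.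
  rewrite /AH horner_poly; case: L L0 => // L' _.
  rewrite !big_ord_recl ah0 /= ah1 !mul1r expr0 expr1 addrA [X in X - _]addrC addrK.
  apply: vge_sum => // i _; rewrite mulrC; apply: vgeM0 => //; last exact: vge_ah.
  apply: vgeW (vgeX vP _ xg); rewrite ler_wpM2r ?(ltW g0) // ler_nat.
  by rewrite /bump /= !add1n.
have near : val_gt v (Psi - zeta ^+ a) g.
  have -> : Psi - zeta ^+ a = (Psi - (1 + ga * T)) - (zeta ^+ a - (1 + a%:R * (zeta - 1)))
     + (T - a%:R) * ga + ((ga - pi) - ((zeta - 1) - pi)) * a%:R by ring.
  apply: vgtD => //; first apply: vgtD => //.
  - apply: (@vgt_ge _ _ (2%:R * g)); first by lra.
    by apply: vgeB => //; exact: zeta_first_order.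
  - by rewrite -[g]add0r; apply: vgtM => //; right; rewrite vga.
  apply: vgtM0 => //; last exact: vge_nat.
  by apply: vgtB => //; apply: vgt_ge gapi; lra.
have sep i j : (i < j < p)%N -> zeta ^+ j - zeta ^+ i != 0 /\ v (zeta ^+ j - zeta ^+ i) = g.
  move=> /andP[ij jp]; have z0 : zeta != 0.
    by apply: contra_eq_neq zp => ->; rewrite expr0n gtn_eqF ?prime_gt0 // eq_sym oner_eq0.
  have vz : v zeta = 0 by apply: (nu_unity vP _ zp); exact: prime_gt0.
  have [k0 vk] : ((j - i)%N%:R : Om) != 0 /\ v ((j - i)%N%:R : Om) = 0.
    apply: nu_coprime; rewrite prime_coprime // gtnNdvd // ?subn_gt0 //.
    by rewrite (leq_ltn_trans (leq_subr _ _)).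
  have kw0 : (j - i)%N%:R * (zeta - 1) != 0 by rewrite mulf_neq0.
  have vkw : v ((j - i)%N%:R * (zeta - 1)) = g by rewrite (nuM vP) // vk add0r.
  have h : val_gt v ((zeta ^+ (j - i) - 1) - (j - i)%N%:R * (zeta - 1)) g.
    rewrite -addrA -opprD; apply: vgt_ge (zeta_first_order _); lra.
  have [d0 vd] := nu_eq vP h kw0 vkw.
  have -> : zeta ^+ j - zeta ^+ i = zeta ^+ i * (zeta ^+ (j - i) - 1).
    by rewrite mulrBr mulr1 -exprD subnKC // ltnW.
  by split; [rewrite mulf_neq0 ?expf_neq0 | rewrite (nuM vP) ?expf_neq0 // (nuX vP) // vz mulr0 add0r].
(* The order of [zeta] divides the prime [p], and it is not 1 because [zeta - 1] is as large as
   [pi]. *)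
have prim : p.-primitive_root zeta.
  have [k kprim kp] := prim_order_exists (prime_gt0 p_pr) zp.
  case/primeP: (p_pr) => _ /(_ _ kp) /orP[/eqP k1|/eqP <- //].
  by case/eqP: wn0; rewrite -(expr1 zeta) -k1 (prim_expr_order kprim) subrr.
pose b := (a %% p)%N; have bp : (b < p)%N by rewrite ltn_mod prime_gt0.
have zab : zeta ^+ a = zeta ^+ b by rewrite /b (prim_expr_mod prim).
have fact : Psi ^+ p - 1 = (Psi - zeta ^+ b) * \prod_(i < p | val i != b) (Psi - zeta ^+ i).
  have := congr1 (fun f => f.[Psi]) (factor_Xn_sub_1 prim).
  rewrite hornerD hornerN hornerXn hornerC => <-.
  rewrite big_mkord horner_prod (bigD1 (Ordinal bp)) //= hornerXsubC; congr (_ * _).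
  by apply: eq_bigr => i _; rewrite hornerXsubC.
have others i : (i < p)%N -> i != b -> Psi - zeta ^+ i != 0 /\ v (Psi - zeta ^+ i) = g.
  move=> ip ib.
  have [d0 vd] : zeta ^+ b - zeta ^+ i != 0 /\ v (zeta ^+ b - zeta ^+ i) = g.
    case: (ltngtP i b) ib => // [ib _|bi _]; first by apply: sep; rewrite ib.
    have [x0 vx] : zeta ^+ i - zeta ^+ b != 0 /\ v (zeta ^+ i - zeta ^+ b) = g.
      by apply: sep; rewrite bi.
    by rewrite -opprB oppr_eq0 (nuN vP).
  apply: (nu_eq vP _ d0 vd); rewrite -zab.
  by have -> : Psi - zeta ^+ i - (zeta ^+ a - zeta ^+ i) = Psi - zeta ^+ a by ring.
have [W0 vW] : \prod_(i < p | val i != b) (Psi - zeta ^+ i) != 0 /\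
   v (\prod_(i < p | val i != b) (Psi - zeta ^+ i)) = p.-1%:R * g.
  have -> : (p.-1 = #|[pred i : 'I_p | val i != b]|)%N.
    have := cardC (pred1 (Ordinal bp)); rewrite card_ord card1 => {1}<-; apply: eq_card => i.
    by rewrite !inE -val_eqE.
  rewrite mulr_natl -sumr_const.
  apply: (big_ind2 (fun x c => x != 0 /\ v x = c)) => [|x c y d [x0 vx] [y0 vy]|i ib].
  - by rewrite oner_neq0 (nu1 vP).
  - by rewrite mulf_neq0 // (nuM vP) // vx vy.
  by apply: others.
have := split_pth_power; rewrite -/Psi fact zab => H.
have [->|d0] := eqVneq (Psi - zeta ^+ b) 0; first by left.
case: H => [/eqP|H]; first by rewrite mulf_eq0 (negPf d0) (negPf W0).
by right; move: H; rewrite (nuM vP) // vW; lra.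
Qed.

End Unity.
End Splitting.

(** * Teichmueller lifts *)

Lemma finField_prim_root (L : finFieldType) :
  exists g : L, (#|L|.-1).-primitive_root g.
Proof.
have N0 : (0 < #|L|.-1)%N by move: (finNzRing_gt1 L); case: #|L| => [|[]].
have : has (#|L|.-1).-primitive_root (enum (predC1 (0 : L))).
  apply: has_prim_root => //; last by rewrite -cardE cardC1.
    apply/allP => x; rewrite mem_enum => /= x0; apply/unity_rootP.
    by apply: (mulfI x0); rewrite -exprS prednK ?expf_card ?mulr1 // (cardD1 x).
  exact: enum_uniq.
by case/hasP => g _ gp; exists g.
Qed.

Lemma closed_prim_root (F : closedFieldType) N : (N%:R : F) != 0 ->
  exists z : F, N.-primitive_root z.
Proof.
move=> NF; have N0 : (0 < N)%N by case: N NF => //; rewrite eqxx.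
have [rs rsE] := closed_field_poly_normal ('X^N - 1 : {poly F}).
have lc : lead_coef ('X^N - 1 : {poly F}) = 1 by apply/eqP; exact: monic_Xn_sub_1.
rewrite lc scale1r in rsE.
have urs : uniq rs by rewrite -separable_prod_XsubC -rsE separable_Xn_sub_1.
have : has N.-primitive_root rs.
  apply: has_prim_root => //.
    by apply/allP => x; rewrite -root_prod_XsubC -rsE.
  by rewrite -ltnS -(size_prod_XsubC rs id) -rsE size_Xn_sub_1.
by case/hasP => z _ zp; exists z.
Qed.

Section MinimalPolynomial.
Variables (k L : finFieldType) (io : {rmorphism k -> L}) (g : L).

(** The minimal polynomial of [g] over [k], found by a search over coefficient tuples, which is
    decidable because [k] is finite. *)
Lemma minimal_annihilator (h : {poly k}) : h != 0 -> root (map_poly io h) g ->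
  exists f : {poly k}, [/\ f \is monic, root (map_poly io f) g &
    forall H : {poly k}, root (map_poly io H) g -> f %| H].
Proof.
move=> h0 hg.
pose P n := [exists t : n.-tuple k, (Poly t != 0) && root (map_poly io (Poly t)) g].
have exP : exists n, P n.
  exists (size h); apply/existsP; exists (in_tuple h).
  by rewrite polyseqK h0.
case: (ex_minnP exP) => n /existsP[t /andP[t0 tg]] minn.
set f0 := Poly t in t0 tg; pose f := (lead_coef f0)^-1 *: f0.
have lf0 : (lead_coef f0)^-1 != 0 by rewrite invr_eq0 lead_coef_eq0.
have f0g : root (map_poly io f0) g := tg.
exists f; split.
- by rewrite monicE lead_coefZ mulVf // lead_coef_eq0.
- by rewrite /f linearZ /= rootZ // fmorph_eq0.
move=> H Hg; rewrite /f dvdpZl // /dvdp; apply: contraT => r0.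
have rg : root (map_poly io (H %% f0)) g.
  have := Hg; rewrite {1}(divp_eq H f0) rmorphD rmorphM /= /root hornerD hornerM.
  by rewrite (eqP f0g) mulr0 add0r.
have : (n <= size (H %% f0)%R)%N.
  by apply: minn; apply/existsP; exists (in_tuple (H %% f0)); rewrite polyseqK r0.
rewrite leqNgt => /negP[]; apply: (leq_trans (ltn_modpN0 _ t0)).
by apply: leq_trans (size_Poly _) _; rewrite size_tuple.
Qed.

End MinimalPolynomial.

Section TeichmullerLift.
Variables (Om : closedFieldType) (v : Om -> rat) (p : nat).
Hypotheses (vP : is_valuation v) (p_pr : prime p).
Hypotheses (pn0 : (p%:R : Om) != 0) (vp : 0 < v p%:R).

Lemma unity_integral N x : (0 < N)%N -> x ^+ N = 1 -> val_ge v x 0.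
Proof. by move=> N0 xN; right; rewrite (nu_unity vP N0 xN). Qed.

(** If [x] and [y] are congruent, the cofactor of [x - y] in [x^N - y^N] is congruent to
    [N y^(N-1)], a unit. *)
Lemma unity_inj N x y : coprime p N -> x ^+ N = 1 -> y ^+ N = 1 ->
  val_gt v (x - y) 0 -> x = y.
Proof.
move=> pN xN yN xy; have N0 := pcoprime_gt0 p_pr pN.
have [Nn0 vN] := nu_coprime vP p_pr pn0 vp pN.
have xi := unity_integral N0 xN; have yi := unity_integral N0 yN.
have := subrXX x y N; rewrite xN yN subrr => /esym/eqP.
rewrite mulf_eq0 subr_eq0 => /orP[/eqP //|/eqP S0].
have cxy : cong v x y by [].
have : cong v (\sum_(i < N) x ^+ (N.-1 - i) * y ^+ i) (\sum_(i < N) y ^+ N.-1).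
  apply: cong_sum => // i _.
  have iN : (i <= N.-1)%N by rewrite -ltnS prednK.
  rewrite -{2}(subnK iN) exprD; apply: congM => //; first exact: congX.
  by apply: cong_refl; apply: vgeX0.
rewrite S0 sumr_const card_ord -mulr_natl; case=> _ _; rewrite sub0r => /(vgtN vP).
have y0 : y != 0 by apply: contra_eq_neq yN => ->; rewrite expr0n gtn_eqF // eq_sym oner_eq0.
case=> [/eqP|]; first by rewrite mulf_eq0 (negPf Nn0) (negPf (expf_neq0 _ y0)).
by rewrite (nuM vP) ?expf_neq0 // vN (nuX vP) // (nu_unity vP N0 yN) mulr0 addr0 ltxx.
Qed.

Lemma monic_root_integral (f : {poly Om}) x : f \is monic ->
  (forall i, val_ge v f`_i 0) -> root f x -> val_ge v x 0.
Proof.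
move=> fm fi /eqP fx; have [->|x0] := eqVneq x 0; first by left.
right; rewrite leNgt; apply/negP => vx.
have f0 : (0 < size f)%N by rewrite size_poly_gt0 monic_neq0.
move: fx; rewrite horner_coef -(prednK f0) big_ord_recr /=.
have -> : f`_(size f).-1 = 1 by apply/eqP; rewrite -monicE.
rewrite mul1r addrC => /eqP; rewrite addr_eq0 => /eqP E.
have : val_gt v (x ^+ (size f).-1) ((size f).-1%:R * v x).
  rewrite E; apply/(vgtN vP); apply: vgt_sum => // i _.
  rewrite mulrC; apply: vgtM0 => //; right; rewrite (nuX vP) //.
  by rewrite ltr_nM2r // ltr_nat.
case=> [/eqP|]; first by rewrite (negPf (expf_neq0 _ x0)).
by rewrite (nuX vP) // ltxx.
Qed.

Definition pcong (f g : {poly Om}) := forall i, cong v f`_i g`_i.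

Lemma pcong_horner f g x : pcong f g -> val_ge v x 0 -> cong v f.[x] g.[x].
Proof.
move=> fg x0; pose n := maxn (size f) (size g).
rewrite (@horner_coef_wide _ n f) ?leq_maxl // (@horner_coef_wide _ n g) ?leq_maxr //.
apply: cong_sum => // i _; apply: congM => //.
by apply: cong_refl; apply: vgeX0.
Qed.

Section Coefficientwise.
Variables (k : finFieldType) (om : k -> Om).
Hypothesis omP : teichmuller v om.

Lemma om0 : om 0 = 0. Proof. by case: omP. Qed.
Lemma om1 : om 1 = 1. Proof. by case: omP => _ []. Qed.
Lemma omM x y : om (x * y) = om x * om y. Proof. by case: omP => _ [_ []]. Qed.

Lemma omX x i : om (x ^+ i) = om x ^+ i.
Proof. by elim: i => [|i IHi]; rewrite ?expr0 ?om1 // !exprS omM IHi. Qed.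

Lemma om_neq0 x : x != 0 -> om x != 0.
Proof.
move=> x0; apply/eqP => omx; have := omM x x^-1.
by rewrite divff // om1 omx mul0r => /eqP; rewrite oner_eq0.
Qed.

Lemma om_integral x : val_ge v (om x) 0.
Proof.
have [->|x0] := eqVneq x 0; first by left; exact: om0.
have k0 : (0 < #|k|.-1)%N by move: (finNzRing_gt1 k); case: #|k| => [|[]].
apply: (unity_integral k0); rewrite -omX.
suff -> : x ^+ #|k|.-1 = 1 by exact: om1.
by apply: (mulfI x0); rewrite -exprS prednK ?expf_card ?mulr1 // (cardD1 x).
Qed.

Lemma omD x y : cong v (om (x + y)) (om x + om y).
Proof.
split; [exact: om_integral | by apply: vgeD => //; exact: om_integral |].
by rewrite opprD addrA; case: omP => _ [_ [_]].
Qed.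

Lemma omN x : cong v (om (- x)) (- om x).
Proof.
have := omD (- x) x; rewrite addNr om0 => /(congN vP) h.
have := congD vP (cong_refl (om_integral (- x))) h.
by rewrite oppr0 addr0 opprD addrA subrr add0r.
Qed.

Lemma om_sum (I : Type) (r : seq I) (P : pred I) (G : I -> k) :
  cong v (om (\sum_(i <- r | P i) G i)) (\sum_(i <- r | P i) om (G i)).
Proof.
elim: r => [|i r IHr]; first by rewrite !big_nil om0; apply: cong_refl; left.
rewrite !big_cons; case: ifP => // _; apply: (cong_trans vP (omD _ _)).
by apply: congD => //; apply: cong_refl; exact: om_integral.
Qed.

Definition lift_poly (f : {poly k}) : {poly Om} := map_poly om f.

Lemma coef_lift f i : (lift_poly f)`_i = om f`_i.
Proof. by rewrite coef_map_id0 ?om0. Qed.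

Lemma lift_integral f i : val_ge v (lift_poly f)`_i 0.
Proof. by rewrite coef_lift; exact: om_integral. Qed.

Lemma liftB f g : pcong (lift_poly (f - g)) (lift_poly f - lift_poly g).
Proof.
move=> i; rewrite coefB !coef_lift coefB; apply: (cong_trans vP (omD _ _)).
by apply: congD => //; [apply: cong_refl; exact: om_integral | exact: omN].
Qed.

Lemma liftM f g : pcong (lift_poly (f * g)) (lift_poly f * lift_poly g).
Proof.
move=> i; rewrite coefM coef_lift coefM; apply: (cong_trans vP (om_sum _ _ _)).
apply: cong_sum => // j _; rewrite omM !coef_lift; apply: cong_refl.
by apply: vgeM0 => //; exact: om_integral.
Qed.

Lemma lift_Xn i : lift_poly 'X^i = 'X^i.
Proof.
apply/polyP => j; rewrite coef_lift !coefXn; case: eqP => _; [exact: om1 | exact: om0].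
Qed.

Lemma lift0 : lift_poly 0 = 0.
Proof. by apply/polyP => j; rewrite coef_lift !coef0 om0. Qed.

Lemma liftC c : lift_poly c%:P = (om c)%:P.
Proof. by apply/polyP => j; rewrite coef_lift !coefC; case: ifP => // _; exact: om0. Qed.

End Coefficientwise.

(** The sums over [L] need a Teichmueller map of [L] extending [om]. A generator [g] of the group of
    [L] is sent to a root of unity [eta] near a root of the lifted minimal polynomial of [g] over
    [k]. Polynomial relations over [k] at [g] then hold at [eta] modulo the maximal ideal, which
    gives additivity and compatibility. *)
Lemma teichmuller_lift (k L : finFieldType) (io : {rmorphism k -> L}) (om : k -> Om) :
  coprime p #|L|.-1 -> teichmuller v om ->
  exists2 omL : L -> Om, teichmuller v omL & forall c, omL (io c) = om c.
Proof.
move=> pN omP; set N := #|L|.-1 in pN; have N0 := pcoprime_gt0 p_pr pN.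
have [Nn0 vN] := nu_coprime vP p_pr pn0 vp pN.
have [g gp] := finField_prim_root L; rewrite -/N in gp.
have [xi xip] := closed_prim_root Nn0.
have [f [fm fg fdiv]] : exists f : {poly k}, [/\ f \is monic, root (map_poly io f) g &
    forall H : {poly k}, root (map_poly io H) g -> f %| H].
  apply: (@minimal_annihilator _ _ io g ('X^N - 1)); first exact/monic_neq0/monic_Xn_sub_1.
  rewrite rmorphB /= map_polyXn rmorph1 /root !hornerE.
  by rewrite (prim_expr_order gp) subrr.
have sf : size (lift_poly om f) = size f.
  by apply: size_poly_eq; rewrite -lead_coefE (monicP fm) (om1 omP) oner_neq0.
have lm : lift_poly om f \is monic.
  by rewrite monicE lead_coefE sf coef_lift // -lead_coefE (monicP fm) (om1 omP).
have [rho rhoP] : exists rho, root (lift_poly om f) rho.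
  apply/closed_rootP; rewrite sf; apply: contraTneq fg => /eqP.
  move/size_poly1P => [c c0 ->]; rewrite map_polyC rootC fmorph_eq0 //.
have rhoi : val_ge v rho 0.
  by apply: (monic_root_integral lm) rhoP => i; exact: lift_integral.
have frho : (lift_poly om f).[rho] = 0 by apply/eqP.
(* [lift_poly] is multiplicative only up to congruence, so the conclusion is a congruence; allowing
   every [x] congruent to [rho] prepares the passage from [rho] to [eta]. *)
have vanish x : cong v rho x -> forall H : {poly k}, root (map_poly io H) g ->
    cong v (lift_poly om H).[x] 0.
  move=> cx H /fdiv/dvdpP[h ->]; have [_ xint _] := cx.
  apply: (cong_trans vP (pcong_horner (liftM omP h f) xint)); rewrite hornerM.
  have lint h' y : val_ge v y 0 -> val_ge v (lift_poly om h').[y] 0.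
    move=> yi; rewrite horner_coef; apply: vge_sum => // i _.
    by apply: vgeM0; [|exact: lift_integral|exact: vgeX0].
  rewrite -[X in cong v _ X](mulr0 (lift_poly om h).[x]); apply: congM => //.
    by apply: cong_refl; exact: lint.
  rewrite -frho; apply: cong_sym => //; rewrite !horner_coef.
  apply: cong_sum => // i _; apply: congM => //; last exact: congX.
  by apply: cong_refl; exact: lift_integral.
have rhoN : cong v (rho ^+ N - 1) 0.
  have := vanish rho (cong_refl rhoi) ('X^N - 1).
  rewrite rmorphB /= map_polyXn rmorph1 /root !hornerE.
  rewrite (prim_expr_order gp) subrr eqxx => /(_ isT) h.
  have := pcong_horner (liftB omP 'X^N 1%:P) rhoi.
  rewrite lift_Xn // liftC // om1 // !hornerE => /(cong_sym vP) h'.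
  exact: cong_trans h' h.
(* The product of the [rho - xi ^+ i] is [rho ^+ N - 1], which lies in the maximal ideal, so one of
   its factors does. *)
have [i near] : exists i : nat, cong v rho (xi ^+ i).
  have E : \prod_(i < N) (rho - xi ^+ i) = rho ^+ N - 1.
    have := congr1 (fun f => f.[rho]) (factor_Xn_sub_1 xip).
    rewrite hornerD hornerN hornerXn hornerC => <-.
    by rewrite big_mkord horner_prod; apply: eq_bigr => i _; rewrite hornerXsubC.
  have xii i : val_ge v (xi ^+ i) 0.
    by apply: vgeX0 => //; apply: (unity_integral N0); exact: prim_expr_order.
  case: (boolP [exists i : 'I_N, (rho == xi ^+ i) || (0 < v (rho - xi ^+ i))]).
    case/existsP => i ri; exists i; split => //.
    by case/orP: ri => [/eqP ->|]; [left; rewrite subrr | right].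
  rewrite negb_exists => /forallP no; exfalso.
  have [P0 vPr] : \prod_(i < N) (rho - xi ^+ i) != 0 /\
      v (\prod_(i < N) (rho - xi ^+ i)) = 0.
    apply: (big_ind (fun x => x != 0 /\ v x = 0)) => [|x y [x0 vx] [y0 vy]|i _].
    - by rewrite oner_neq0 (nu1 vP).
    - by rewrite mulf_neq0 // (nuM vP) // vx vy addr0.
    have := no i; rewrite negb_or -leNgt => /andP[ri vi].
    have ri0 : rho - xi ^+ i != 0 by rewrite subr_eq0.
    split=> //; apply/eqP; rewrite eq_le vi /=.
    have : val_ge v (rho - xi ^+ i) 0 by apply: vgeB.
    by case=> // /eqP; rewrite (negPf ri0).
  case: rhoN => _ _; rewrite subr0 -E; case=> [/eqP|]; first by rewrite (negPf P0).
  by rewrite vPr ltxx.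
pose eta := xi ^+ i; have etaN : eta ^+ N = 1.
  by rewrite /eta exprAC (prim_expr_order xip) expr1n.
pose log x := odflt 0%N (omap (@nat_of_ord N) [pick j : 'I_N | g ^+ j == x]).
pose omL x := if x == 0 then 0 else eta ^+ log x.
have glog x : x != 0 -> g ^+ log x = x.
  move=> x0; rewrite /log; case: pickP => [j /eqP //|none].
  have xN : x ^+ N = 1.
    by apply: (mulfI x0); rewrite -exprS prednK ?expf_card ?mulr1 // (cardD1 x).
  by have [j xj] := prim_rootP gp xN; have := none j; rewrite xj eqxx.
have g0 : g != 0.
  apply: contra_eq_neq (prim_expr_order gp) => ->.
  by rewrite expr0n gtn_eqF // eq_sym oner_eq0.
have omLg j : omL (g ^+ j) = eta ^+ j.
  rewrite /omL expf_eq0 (negPf g0) andbF.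
  have /eqP := glog _ (expf_neq0 j g0); rewrite (eq_prim_root_expr gp) => /eqP E.
  by rewrite -(expr_mod _ etaN) E expr_mod.
have omL0 : omL 0 = 0 by rewrite /omL eqxx.
have etai : val_ge v eta 0 by apply: (unity_integral N0).
(* Writing each element of [L] as a polynomial over [k] evaluated at [g] turns sums in [L] into
   relations that [diff] transports. *)
pose Hx x : {poly k} := if x == 0 then 0 else 'X^(log x).
have HxE x : (map_poly io (Hx x)).[g] = x.
  rewrite /Hx; case: eqP => [->|/eqP x0]; first by rewrite rmorph0 horner0.
  by rewrite map_polyXn hornerXn glog.
have HxL x : (lift_poly om (Hx x)).[eta] = omL x.
  rewrite /Hx /omL; case: eqP => _; first by rewrite lift0 // horner0.
  by rewrite lift_Xn // hornerXn.
have diff (H1 H2 : {poly k}) : (map_poly io H1).[g] = (map_poly io H2).[g] ->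
    val_gt v ((lift_poly om H1).[eta] - (lift_poly om H2).[eta]) 0.
  move=> E; have r : root (map_poly io (H1 - H2)) g.
    by rewrite /root rmorphB hornerD hornerN E subrr.
  have h1 := vanish _ near _ r.
  have h2 := pcong_horner (liftB omP H1 H2) etai.
  have := cong_trans vP (cong_sym vP h2) h1.
  by rewrite hornerD hornerN => -[_ _]; rewrite subr0.
have omLP : teichmuller v omL.
  split=> //; split; first by rewrite -[1](expr0 g) omLg expr0.
  split=> x y.
    have [->|x0] := eqVneq x 0; first by rewrite !(mul0r, omL0).
    have [->|y0] := eqVneq y 0; first by rewrite !(mulr0, omL0).
    by rewrite -(glog x x0) -(glog y y0) -exprD !omLg exprD.
  have := diff (Hx (x + y) - Hx x) (Hx y).
  rewrite rmorphB hornerD hornerN !HxE addrAC subrr add0r => /(_ erefl) h.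
  have [_ _] := pcong_horner (liftB omP (Hx (x + y)) (Hx x)) etai.
  rewrite hornerD hornerN !HxL => h'.
  move: h; rewrite HxL; set W := (lift_poly om _).[eta] => h.
  have -> : omL (x + y) - omL x - omL y = (W - omL y) - (W - (omL (x + y) - omL x)) by ring.
  exact: vgtB.
exists omL => // c; have [->|c0] := eqVneq c 0.
  by rewrite rmorph0 omL0 om0.
have cN : c ^+ N = 1.
  apply: (fmorph_inj io); rewrite rmorphXn rmorph1 /=.
  have ic0 : io c != 0 by rewrite fmorph_eq0.
  by apply: (mulfI ic0); rewrite -exprS prednK ?expf_card ?mulr1 // (cardD1 (io c)).
apply: (unity_inj pN).
- by rewrite -omX // -rmorphXn cN rmorph1 om1.
- by rewrite -omX // cN om1.
rewrite -HxL -[om c](hornerC _ eta) -liftC //; apply: diff.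
by rewrite HxE map_polyC hornerC.
Qed.

End TeichmullerLift.

(** * The Dwork trace formula *)

Lemma sum_unique_pred (R : nzRingType) (I : finType) (P : pred I) (b : bool) :
  (forall i j, P i -> P j -> i = j) -> (b <-> exists i, P i) ->
  \sum_i (P i)%:R = b%:R :> R.
Proof.
move=> uniqP bP; case: b bP => bP.
  have [i Pi] := proj1 bP isT; rewrite (bigD1 i) //= Pi big1 ?addr0 // => j ji.
  by case: (boolP (P j)) => // Pj; rewrite (uniqP j i) ?eqxx in ji.
rewrite big1 // => i _; case: (boolP (P i)) => // Pi.
by have := proj2 bP (ex_intro _ i Pi).
Qed.

Section Lattice.
Variables (T : finType) (sg : pred T) (t0 : T).
Hypothesis sg0 : sg t0.

Definition sgv t : int := if sg t then 1 else -1.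

(* Equality of exponent vectors modulo the line spanned by the relation
   \prod_(sg t) z_t = a \prod_(~~ sg t) z_t. *)
Definition eqe (x y : T -> int) := [forall t, x t - y t == sgv t * (x t0 - y t0)].

Lemma eqeP x y : reflect (exists k, forall t, x t = y t + sgv t * k) (eqe x y).
Proof.
apply: (iffP forallP) => [H|[k H] t].
  by exists (x t0 - y t0) => t; have /eqP <- := H t; ring.
by rewrite !H; apply/eqP; rewrite /sgv sg0; ring.
Qed.

Variables (p L B : nat) (c : T -> nat).
Hypotheses (p1 : (1 < p)%N) (BL : (2 * L <= B)%N).

Local Notation vec := {ffun T -> 'I_B.+1}.

(** [U / (p - 1)] is the exponent of a monomial twisted by [c], with denominators cleared: [U + c]
    is divisible by [p - 1] modulo the relation line. A vanishing coordinate of positive sign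
    selects one representative on each line. *)
Definition valid (U : vec) :=
  [exists t, sg t && (U t == 0%N :> nat)] &&
  [forall t, ((p.-1)%:Z %| (U t + c t)%:Z - sgv t * (U t0 + c t0)%:Z)%Z].

(** Dwork's operator sends exponents divisible by [p^n] to their quotients; here [U'] is reached
    from [U] after multiplication by the monomial of exponent [lam]. *)
Definition rel_step n (U : vec) (lam : T -> nat) (U' : vec) :=
  eqe (fun t => (U t + p.-1 * lam t)%:Z) (fun t => (p ^ n * U' t)%:Z).

Lemma valid_eqe_inj (U V : vec) k : valid U -> valid V ->
  (forall t, (U t)%:Z = (V t)%:Z + sgv t * k) -> U = V.
Proof.
move=> /andP[/existsP[i /andP[si /eqP Ui]] _] /andP[/existsP[j /andP[sj /eqP Vj]] _] UV.
have k0 : k = 0 by move: (UV i) (UV j); rewrite /sgv si sj Ui Vj; lia.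
by apply/ffunP => t; apply: val_inj; move: (UV t); rewrite k0 mulr0 addr0 => -[].
Qed.

Lemma sg_minimum (W : T -> int) : exists k, sg k /\
  (forall t, sg t -> W k <= W t).
Proof.
have [k sk kmin] := @Order.TotalTheory.arg_minP _ _ _ t0 sg W sg0.
by exists k.
Qed.

(** [W] is moved along its line until its least coordinate of positive sign is 0. Multiplied by [D],
    the coordinates become [X t - X k] or [X t + X k], which gives both nonnegativity and the bound
    [B]. *)
Lemma valid_witness (W : T -> int) (D : nat) (X : T -> nat) :
  (0 < D)%N ->
  (forall t, ((p.-1)%:Z %| (W t + (c t)%:Z) - sgv t * (W t0 + (c t0)%:Z))%Z) ->
  (exists kap, forall t, D%:Z * W t = (X t)%:Z + sgv t * kap) ->
  (exists2 k, sg k & forall t, (X t + X k <= D * B)%N) ->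
  exists2 V : vec, valid V & exists kap, forall t, (V t)%:Z = W t + sgv t * kap.
Proof.
move=> D0 Wc [kap WX] [k1 sk1 Xb].
have [k [sk kmin]] := sg_minimum W.
have XW t : D%:Z * (W t - sgv t * W k) = (X t)%:Z - sgv t * (X k)%:Z.
  by have := WX t; have := WX k; rewrite /sgv sk; case: (sg t); nia.
have Xk : (X k <= X k1)%N.
  have := kmin k1 sk1; have := WX k; have := WX k1; rewrite /sgv sk sk1; nia.
have V0 t : 0 <= W t - sgv t * W k.
  have := XW t; rewrite /sgv; case: (boolP (sg t)) => st; last by nia.
  by have := kmin t st; lia.
have VB t : W t - sgv t * W k <= B%:Z.
  have := XW t; have := Xb t; rewrite /sgv; case: (boolP (sg t)) => st; nia.
exists [ffun t => inord (absz (W t - sgv t * W k)%R)]; last first.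
  exists (- W k) => t; rewrite ffunE inordK; last by move: (V0 t) (VB t); lia.
  by move: (V0 t); lia.
have VE t : ([ffun t => inord (absz (W t - sgv t * W k)%R) : 'I_B.+1] t : nat)%:Z = W t - sgv t * W k.
  by rewrite ffunE inordK; move: (V0 t) (VB t); lia.
apply/andP; split.
  apply/existsP; exists k; rewrite sk /=; have := VE k; rewrite /sgv sk; lia.
apply/forallP => t; rewrite !PoszD !VE.
have := Wc t; rewrite /sgv sg0; congr (_ %| _)%Z; case: (sg t); ring.
Qed.

(** The intermediate vector is unique by normalization, and it stays in the box: its [p^n]-fold is
    at most [B + 2 L (p^n - 1)], which [2 L <= B] bounds by [p^n B]. So the finite matrix composes
    without truncation error. *)
Lemma rel_stepS n (U U' : vec) (lam l : T -> nat) :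
  valid U -> valid U' -> (forall t, l t <= L)%N ->
  (forall t, p.-1 * lam t <= L * (p ^ n).-1)%N ->
  forall R : nzRingType,
  \sum_(V : vec) (valid V && (rel_step n U lam V && rel_step 1 V l U'))%:R =
  (rel_step n.+1 U (fun t => lam t + p ^ n * l t)%N U')%:R :> R.
Proof.
move=> vU vU' lL lamL R; have pn0 : (0 < p ^ n)%N by rewrite expn_gt0 ltnW.
have expS : (p ^ n.+1 = p * p ^ n)%N by rewrite expnS.
apply: sum_unique_pred => [V V' |].
  move=> /and3P[vV _ /eqeP[k hk]] /and3P[vV' _ /eqeP[k' hk']].
  apply: (@valid_eqe_inj _ _ (k - k')) => // t.
  by move: (hk t) (hk' t); rewrite expn1; case: (sgv t); lia.
split=> [/eqeP[k hk]|[V /and3P[vV /eqeP[k hk] /eqeP[k' hk']]]]; last first.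
  apply/eqeP; exists (k + (p ^ n)%:Z * k') => t.
  move: (hk t) (hk' t); rewrite expS expn1 => h h'.
  have -> : (U t + p.-1 * (lam t + p ^ n * l t))%:Z =
     (U t + p.-1 * lam t)%:Z + (p ^ n)%:Z * (p.-1 * l t)%:Z by lia.
  rewrite h; have -> : (p ^ n * V t)%:Z = (p ^ n)%:Z * ((V t + p.-1 * l t)%:Z - (p.-1 * l t)%:Z) by lia.
  by rewrite h'; lia.
pose W t := (p * U' t)%:Z - (p.-1 * l t)%:Z.
have [] := @valid_witness W (p ^ n) (fun t => U t + p.-1 * lam t)%N pn0.
- move=> t; have /andP[_ /forallP /(_ t)] := vU'.
  move=> h; have -> : W t + (c t)%:Z - sgv t * (W t0 + (c t0)%:Z) =
     ((U' t + c t)%:Z - sgv t * (U' t0 + c t0)%:Z) +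
     (p.-1)%:Z * ((U' t)%:Z - (l t)%:Z - sgv t * ((U' t0)%:Z - (l t0)%:Z)).
    by rewrite /W; move: (sgv t) => e; nia.
  by rewrite rpredD // dvdz_mulr.
- exists (- k) => t; move: (hk t); rewrite /W expS => h.
  by move: (sgv t) h => e; nia.
- have /andP[/existsP[k0 /andP[sk0 /eqP Uk0]] _] := vU.
  exists k0 => // t; rewrite Uk0 add0n.
  have := lamL t; have := lamL k0; have := ltn_ord (U t); rewrite ltnS => h1 h2 h3.
  apply: (@leq_trans (B + 2 * (L * (p ^ n).-1))); first by lia.
  rewrite mulnA; apply: (@leq_trans (B + B * (p ^ n).-1)).
    by rewrite leq_add2l leq_mul2r BL orbT.
  by rewrite -mulnS prednK // mulnC.
move=> V vV [k' hV]; exists V; rewrite vV /=; apply/andP; split; apply/eqeP.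
  exists (k - (p ^ n)%:Z * k') => t; move: (hk t) (hV t); rewrite expS /W.
  by move: (sgv t) => e; nia.
exists k' => t; move: (hV t); rewrite /W expn1.
by move: (sgv t) => e; nia.
Qed.

(** A closed path satisfies [(p - 1) lam = (p^R - 1) U] modulo the relation line. It has at most one
    normalized solution, and solvability is exactly the orthogonality condition that appears in
    [torus_char_sum]. *)
Lemma closed_path_count R (lam : T -> nat) : (0 < R)%N -> (forall t, p.-1 * lam t <= L * (p ^ R).-1)%N ->
  forall K : nzRingType,
  \sum_(U : vec) (valid U && rel_step R U lam U)%:R =
  [forall t, ((p ^ R).-1%:Z %| (lam t + (\sum_(j < R) p ^ j) * c t)%:Z -
      sgv t * (lam t0 + (\sum_(j < R) p ^ j) * c t0)%:Z)%Z]%:R :> K.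
Proof.
move=> R0 lamL K; set C := (\sum_(j < R) p ^ j)%N; set Q1 := (p ^ R).-1 in lamL *.
have CE : (Q1 = p.-1 * C)%N by rewrite /Q1 predn_exp.
have pR : (1 < p ^ R)%N by rewrite -(expn0 p) ltn_exp2l.
have pRE : (p ^ R = Q1.+1)%N by rewrite prednK // ltnW.
have Q10 : (0 < Q1)%N by rewrite -ltnS -pRE.
have Q1n0 : Q1%:Z != 0 by move: Q10; clear; case: Q1.
have pp0 : (p.-1)%:Z != 0 by move: p1; clear; case: p => [|[]].
have rel1 (U : vec) : rel_step R U lam U <->
    forall t, (p.-1)%:Z * ((lam t)%:Z - sgv t * (lam t0)%:Z) = Q1%:Z * ((U t)%:Z - sgv t * (U t0)%:Z).
  split=> [/forallP H t|H].
    have /eqP := H t; rewrite pRE -[Q1.+1]addn1 !(PoszD, PoszM).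
    by move: (sgv t) (Posz p.-1) (Posz Q1) => e a q; clear; lia.
  apply/forallP => t; apply/eqP; have := H t; rewrite pRE -[Q1.+1]addn1 !(PoszD, PoszM).
  move: (sgv t) (Posz p.-1) (Posz Q1) => e a q h; apply: subr0_eq.
  by move/eqP: h; rewrite -subr_eq0 => /eqP <-; ring.
apply: sum_unique_pred => [U V|].
  move=> /andP[vU /rel1 hU] /andP[vV /rel1 hV].
  apply: (@valid_eqe_inj _ _ ((U t0)%:Z - (V t0)%:Z)) => // t.
  have := hU t; rewrite hV => /(mulfI Q1n0) h.
  by rewrite -[LHS](subrK (sgv t * (U t0)%:Z)) -h; ring.
split=> [/forallP H|[U /andP[/andP[_ /forallP cU] /rel1 hk]]]; last first.
  apply/forallP => t; have /dvdzP[x xE] := cU t.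
  apply/dvdzP; exists x; apply: (mulfI pp0).
  transitivity (Q1%:Z * (((U t + c t)%:Z) - sgv t * (U t0 + c t0)%:Z)); last first.
    by rewrite xE; ring.
  have := hk t; rewrite !PoszD !PoszM; move: (sgv t) => e h.
  transitivity (p.-1%:Z * ((lam t)%:Z - e * (lam t0)%:Z) +
    p.-1%:Z * C%:Z * ((c t)%:Z - e * (c t0)%:Z)); first by ring.
  by rewrite h -PoszM -CE; ring.
pose w t := (((lam t + C * c t)%:Z - sgv t * (lam t0 + C * c t0)%:Z) %/ Q1%:Z)%Z.
have wE t : (lam t + C * c t)%:Z - sgv t * (lam t0 + C * c t0)%:Z = w t * Q1%:Z.
  by rewrite /w divzK.
have w0 : w t0 = 0.
  have := wE t0; rewrite {1}/sgv sg0 mul1r subrr => /esym/eqP.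
  by rewrite mulf_eq0 (negPf Q1n0) orbF => /eqP.
pose W t := (p.-1)%:Z * w t - (c t)%:Z + sgv t * (c t0)%:Z.
have QW t : Q1%:Z * W t = (p.-1)%:Z * ((lam t)%:Z - sgv t * (lam t0)%:Z).
  have := wE t; rewrite /W !PoszD !PoszM CE !PoszM; move: (w t) (sgv t) => x e h.
  have -> : p.-1%:Z * C%:Z * (p.-1%:Z * x - (c t)%:Z + e * (c t0)%:Z) =
     p.-1%:Z * (x * (p.-1%:Z * C%:Z) - C%:Z * (c t)%:Z + e * (C%:Z * (c t0)%:Z)) by ring.
  by rewrite -h; ring.
have [] := @valid_witness W Q1 (fun t => p.-1 * lam t)%N Q10.
- move=> t; rewrite {2}/W w0 /W /sgv sg0; set e := if _ then _ else _.
  have -> : p.-1%:Z * w t - (c t)%:Z + e * (c t0)%:Z + (c t)%:Z -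
    e * (p.-1%:Z * 0 - (c t0)%:Z + 1 * (c t0)%:Z + (c t0)%:Z) = p.-1%:Z * w t by ring.
  exact: dvdz_mulr.
- exists (- (p.-1 * lam t0)%:Z) => t; rewrite QW !PoszM; ring.
- exists t0 => // t; apply: (@leq_trans (2 * (L * Q1))).
    by rewrite mul2n -addnn leq_add.
  by rewrite mulnA mulnC leq_mul2l BL orbT.
move=> V vV [k' hV]; exists V; rewrite vV; apply/rel1 => t; rewrite -QW; congr (_ * _).
have := hV t; have := hV t0; rewrite [sgv t0]/sgv sg0 => -> ->.
have W0 : W t0 = 0 by rewrite /W w0 /sgv sg0; ring.
by rewrite W0; ring.
Qed.

End Lattice.

(** * The transfer matrix and the traces of its powers *)

Section Transfer.
Variables (F : comNzRingType) (T : finType) (p L : nat).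
Hypothesis p1 : (1 < p)%N.
Variable wt : {ffun T -> 'I_L.+1} -> F.

(* The value at phi of the coefficient functional of \prod_(j < n) G (z ^ (p ^ j)),
   where G = \sum_l wt l z^l: it maps the monomial functional phi to the sum of
   the coefficients weighted by phi of the exponents. *)
Fixpoint coef_functional n (phi : (T -> nat) -> F) : F :=
  if n is m.+1 then
    coef_functional m (fun lam => \sum_l wt l * phi (fun t => lam t + p ^ m * l t)%N)
  else phi (fun=> 0%N).

Lemma eq_coef_functional n phi psi :
  (forall lam, (forall t, p.-1 * lam t <= L * (p ^ n).-1)%N -> phi lam = psi lam) ->
  coef_functional n phi = coef_functional n psi.
Proof.
elim: n phi psi => [|n IHn] phi psi H /=; first by apply: H => t; rewrite muln0.
apply: IHn => lam lamL; apply: eq_bigr => l _; congr (_ * _); apply: H => t.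
have := lamL t; have := ltn_ord (l t); rewrite ltnS expnS.
have : (0 < p ^ n)%N by rewrite expn_gt0 ltnW.
move: (p ^ n)%N (lam t) (nat_of_ord (l t)) p1 => q a b; case: p => // p' /= _ q0 bL aL.
have h : (p' * (q * b) <= L * (p' * q))%N by rewrite mulnA mulnC leq_mul2r bL orbT.
by rewrite mulnDr; nia.
Qed.

Lemma coef_functional1 phi : (forall lam lam', lam =1 lam' -> phi lam = phi lam') ->
  coef_functional 1 phi = \sum_l wt l * phi (fun t => l t).
Proof.
by move=> H /=; apply: eq_bigr => l _; congr (_ * _); apply: H => t; rewrite mul1n.
Qed.

Lemma coef_functional_sum n (I : finType) (P : pred I) phi :
  coef_functional n (fun lam => \sum_(i | P i) phi i lam) =
  \sum_(i | P i) coef_functional n (phi i).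
Proof.
elim: n phi => [|n IHn] phi //=; rewrite -IHn; apply: eq_coef_functional => lam _.
rewrite exchange_big; apply: eq_bigr => l _; exact: mulr_sumr.
Qed.

Lemma coef_functional_scale n a phi :
  coef_functional n (fun lam => a * phi lam) = a * coef_functional n phi.
Proof.
elim: n phi => [|n IHn] phi //=; rewrite -IHn; apply: eq_coef_functional => lam _.
by rewrite mulr_sumr; apply: eq_bigr => l _; rewrite mulrCA.
Qed.

Lemma coef_functional_monomial n (w : T -> F) (a : F) :
  coef_functional n (fun lam => a * \prod_t w t ^+ lam t) =
  a * \prod_(j < n) \sum_l wt l * \prod_t (w t ^+ (p ^ j)) ^+ l t.
Proof.
elim: n a => [|n IHn] a /=.
  by rewrite big_ord0 big1 // => t _; rewrite expr0.
rewrite big_ord_recr /= [X in _ = a * X]mulrC mulrA -IHn; apply: eq_coef_functional => lam _.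
rewrite [X in _ = X * _]mulr_sumr mulr_suml; apply: eq_bigr => l _.
have -> : \prod_t w t ^+ (lam t + p ^ n * l t) =
    \prod_t w t ^+ lam t * \prod_t (w t ^+ (p ^ n)) ^+ l t.
  by rewrite -big_split; apply: eq_bigr => t _; rewrite exprD exprM.
by ring.
Qed.

Variables (sg : pred T) (t0 : T) (B s : nat) (c : T -> nat) (A : F).
Hypotheses (sg0 : sg t0) (BL : (2 * L <= B)%N) (s0 : (0 < s)%N) (As : A ^+ (p ^ s) = A).

Local Notation vec := {ffun T -> 'I_B.+1}.
Local Notation J := ('I_s * vec)%type.
Local Notation valid := (valid sg t0 p c).
Local Notation rel := (@rel_step T sg t0 p B).

Lemma A_mod i : A ^+ (p ^ (i %% s)) = A ^+ (p ^ i).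
Proof.
have H m : A ^+ (p ^ (m * s)) = A.
  elim: m => [|m IHm]; first by rewrite mul0n expn0 expr1.
  by rewrite mulSn expnD exprM As.
by rewrite {2}(divn_eq i s) expnD exprM H.
Qed.

Definition geom n := (\sum_(j < n) p ^ j)%N.

(** Each step replaces the parameter [A] by [A^p], so the operator is only semilinear. The component
    in ['I_s], which records the current conjugate of [A], makes it linear; [A_mod] closes the
    cycle. *)
Definition transfer_path n (a b : J) : F :=
  ((b.1 == (a.1 + n) %% s :> nat)%N)%:R * (valid a.2 && valid b.2)%:R *
  coef_functional n (fun lam =>
    (A ^+ (p ^ a.1)) ^+ (lam t0 + geom n * c t0) * (rel n a.2 lam b.2)%:R).

Lemma rel_ext n (U V : vec) lam lam' : lam =1 lam' -> rel n U lam V = rel n U lam' V.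
Proof. by move=> E; rewrite /rel_step /eqe; apply: eq_forallb => t; rewrite !E. Qed.

#[local] Arguments coef_functional : simpl never.

Lemma transfer_pathS n a b :
  \sum_d transfer_path n a d * transfer_path 1 d b = transfer_path n.+1 a b.
Proof.
case: a b => [i U] [i' U']; rewrite /transfer_path /=.
have [vU|] := boolP (valid U); last first.
  by rewrite mulr0 mul0r big1 // => d _; rewrite mulr0 !mul0r.
have [vU'|] := boolP (valid U'); last first.
  by rewrite mulr0 mul0r big1 // => d _; rewrite andbF mulr0 mul0r mulr0.
rewrite mulr1.
pose i1 : 'I_s := Ordinal (ltn_pmod (i + n) s0).
rewrite -(pair_bigA _ (fun (d1 : 'I_s) (V : vec) => ((d1 == (i + n) %% s :> nat)%N)%:R *
   (true && valid V)%:R * coef_functional n (fun lam => (A ^+ (p ^ i)) ^+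
   (lam t0 + geom n * c t0) * (rel n U lam V)%:R) *
   (((i' == (d1 + 1) %% s :> nat)%N)%:R * (valid V && true)%:R *
   coef_functional 1 (fun lam => (A ^+ (p ^ d1)) ^+
   (lam t0 + geom 1 * c t0) * (rel 1 V lam U')%:R)))) /=.
rewrite (bigD1 i1) //= [X in _ + X]big1 ?addr0; last first.
  move=> d1; rewrite -val_eqE /= => /negPf di; rewrite big1 // => V _.
  by rewrite di !mul0r.
rewrite eqxx modnDml addn1 addnS.
under eq_bigr => V _ do rewrite mul1r andbT.
set e := (_ == _)%:R; have g1 : geom 1 = 1%N by rewrite /geom big_ord1 expn0.
rewrite g1.
transitivity (e * coef_functional n (fun lam => \sum_(V : vec)
   (valid V)%:R * ((A ^+ (p ^ i)) ^+ (lam t0 + geom n * c t0) * (rel n U lam V)%:R) *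
   \sum_l wt l * ((A ^+ (p ^ (i + n))) ^+ (l t0 + c t0) * (rel 1 V (fun t => l t) U')%:R))).
  rewrite coef_functional_sum mulr_sumr; apply: eq_bigr => V _.
  rewrite A_mod coef_functional1; last first.
    by move=> lam lam' E; rewrite (rel_ext _ _ _ E) E.
  rewrite mul1n.
  set X := \sum_l _.
  rewrite [RHS](congr1 _ (_ : _ = coef_functional n (fun lam => ((valid V)%:R * X) *
    ((A ^+ (p ^ i)) ^+ (lam t0 + geom n * c t0) * (rel n U lam V)%:R)))).
    rewrite coef_functional_scale; move: (coef_functional n _) => Y.
    by case: (valid V); rewrite /= ?mulr0n ?mulr1n; ring.
  by apply: eq_coef_functional => lam _; exact: mulrAC.
congr (_ * _); apply: eq_coef_functional => lam lamL /=.
under eq_bigr => V _ do rewrite mulr_sumr.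
rewrite exchange_big; apply: eq_bigr => l _.
have lL t : (l t <= L)%N by rewrite -ltnS.
rewrite -(rel_stepS sg0 p1 BL vU vU' lL lamL F) mulrA mulr_sumr; apply: eq_bigr => V _.
have -> : (A ^+ (p ^ i)) ^+ (lam t0 + p ^ n * l t0 + geom n.+1 * c t0) =
    (A ^+ (p ^ i)) ^+ (lam t0 + geom n * c t0) * (A ^+ (p ^ (i + n))) ^+ (l t0 + c t0).
  rewrite expnD [A ^+ (p ^ i * _)]exprM -[X in _ * X]exprM -exprD /geom big_ord_recr /=.
  by congr (_ ^+ _); ring.
set x := _ ^+ (lam t0 + _); set y := _ ^+ (l t0 + _).
by case: (valid V); case: (rel n U lam V) => /=; rewrite ?mulr0n ?mulr1n; ring.
Qed.

(* The rank of this matrix grows with L and B, but its power traces only see wt. *)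
Definition transfer_mx : 'M[F]_#|{: J}| :=
  \matrix_(a, b) transfer_path 1 (enum_val a) (enum_val b).

Lemma transfer_mxX n a b :
  (transfer_mx ^+ n.+1) a b = transfer_path n.+1 (enum_val a) (enum_val b).
Proof.
elim: n a b => [|n IHn] a b; first by rewrite expr1 mxE.
rewrite exprSr mxE -transfer_pathS [RHS](reindex_onto enum_val enum_rank) /=; last first.
  by move=> d _; rewrite enum_rankK.
by apply: eq_big => [d|d _]; rewrite ?enum_valK ?eqxx // IHn mxE.
Qed.

Definition cyclic_cond n (lam : T -> nat) :=
  [forall t, ((p ^ n).-1%:Z %| (lam t + geom n * c t)%:Z -
      sgv sg t * (lam t0 + geom n * c t0)%:Z)%Z].

(** A path can close only if its length is a multiple of [s]; the [s] starting conjugates then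
    contribute one term each. *)
Lemma trace_transfer n : (0 < n)%N ->
  \tr (transfer_mx ^+ n) = if (s %| n)%N then
    \sum_(i < s) coef_functional n (fun lam =>
       (A ^+ (p ^ i)) ^+ (lam t0 + geom n * c t0) * (cyclic_cond n lam)%:R)
  else 0.
Proof.
case: n => // n _; rewrite /mxtrace.
under eq_bigr => a _ do rewrite transfer_mxX.
rewrite (reindex_onto enum_rank enum_val) /=; last by move=> d _; rewrite enum_valK.
under eq_bigl => a do rewrite enum_rankK eqxx.
under eq_bigr => a _ do rewrite enum_rankK.
rewrite -(pair_bigA _ (fun i U => transfer_path n.+1 (i, U) (i, U))) /=.
have modE (i : 'I_s) : ((i == (i + n.+1) %% s :> nat) = (s %| n.+1))%N.
  by rewrite -{1}(modn_small (ltn_ord i)) -[X in (X %% _)%N == _]addn0 eqn_modDl mod0n eq_sym.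
case: ifP => sn; last first.
  rewrite big1 // => i _; rewrite big1 // => U _.
  by rewrite /transfer_path /= modE sn !mul0r.
apply: eq_bigr => i _; rewrite /transfer_path /=.
under eq_bigr => U _ do rewrite modE sn mul1r andbb -coef_functional_scale.
rewrite -coef_functional_sum; apply: eq_coef_functional => lam lamL.
have := closed_path_count sg0 c p1 BL (ltn0Sn n) lamL F; rewrite -/(geom _) => <-.
rewrite mulr_sumr; apply: eq_bigr => U _.
by case: (valid U); case: (rel n.+1 U lam U) => /=; rewrite ?mulr0n ?mulr1n; ring.
Qed.

End Transfer.

(** * Exponential sums on the torus *)

Section CharacterSums.
Variables (Om : closedFieldType) (v : Om -> rat) (p : nat).
Hypotheses (vP : is_valuation v) (p_pr : prime p).
Hypotheses (pn0 : (p%:R : Om) != 0) (vp : 0 < v p%:R).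
Variables (L : finFieldType) (om : L -> Om) (R : nat).
Hypotheses (omP : teichmuller v om) (R0 : (0 < R)%N) (cardL : #|L| = (p ^ R)%N).

Let N1 := (p ^ R).-1.

Lemma N1_gt0 : (0 < N1)%N.
Proof. by rewrite /N1 -cardL; move: (finNzRing_gt1 L); case: #|L| => [|[]]. Qed.

Lemma N1_coprime : coprime p N1.
Proof.
rewrite /N1 -(coprime_pexpl _ _ R0) coprimenP // expn_gt0 prime_gt0 //.
Qed.

Lemma expN1 (x : L) : x != 0 -> x ^+ N1 = 1.
Proof.
move=> x0; apply: (mulfI x0); rewrite -exprS /N1 prednK ?expn_gt0 ?prime_gt0 //.
by rewrite -cardL expf_card mulr1.
Qed.

Lemma omN1 x : x != 0 -> om x ^+ N1 = 1.
Proof. by move=> x0; rewrite -(omX omP) expN1 // (om1 omP). Qed.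

Lemma om_eq1 x : om x = 1 -> x = 1.
Proof.
move=> x1; have [_ _] := omD vP omP (x - 1) 1; rewrite subrK x1 (om1 omP) opprD.
rewrite addrCA subrr addr0 => /(vgtN vP) x10; apply/eqP; rewrite -subr_eq0.
apply: contraT => x0; have y0 := om_neq0 omP x0.
case: x10 => [/eqP|]; first by rewrite (negPf y0).
by rewrite (nu_unity vP N1_gt0 (omN1 x0)) ltxx.
Qed.

Lemma char_sum E :
  \sum_(x : L) (x != 0)%:R * om x ^+ E = if (N1 %| E)%N then N1%:R else 0.
Proof.
case: ifP => NE.
  transitivity (\sum_(x : L) (x != 0)%:R : Om).
    apply: eq_bigr => x _; have [->|x0] := eqVneq x 0; first by rewrite mul0r.
    by case/dvdnP: NE => k ->; rewrite mulnC exprM omN1 // expr1n mulr1.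
  under eq_bigr => x _ do rewrite mulrb.
  by rewrite -big_mkcond sumr_const (cardC1 (0 : L)) cardL.
have [g gp] := finField_prim_root L; rewrite cardL -/N1 in gp.
have g0 : g != 0.
  apply: contra_eq_neq (prim_expr_order gp) => ->.
  by rewrite expr0n gtn_eqF ?N1_gt0 // eq_sym oner_eq0.
set S := \sum_(x : L) _.
have SE : S = om g ^+ E * S.
  rewrite {1}/S (reindex_inj (mulfI g0)) /S mulr_sumr; apply: eq_bigr => x _ /=.
  by rewrite mulf_eq0 (negPf g0) /= (omM omP) exprMn mulrCA.
have /eqP : (1 - om g ^+ E) * S = 0 by rewrite mulrBl mul1r -SE subrr.
rewrite mulf_eq0 => /orP[|/eqP //]; rewrite subr_eq0 eq_sym -(omX omP) => /eqP/om_eq1/eqP.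
by rewrite -(prim_order_dvd gp) NE.
Qed.

Variables (T : finType) (sg : pred T) (t0 : T).
Hypothesis sg0 : sg t0.

Definition torus_point (b : L) (z : {ffun T -> L}) :=
  [forall t, z t != 0] && (\prod_(t | sg t) z t == b * \prod_(t | ~~ sg t) z t).

Lemma om_prod (P : pred T) (z : T -> L) :
  om (\prod_(t | P t) z t) = \prod_(t | P t) om (z t).
Proof. by rewrite (big_morph om (omM omP) (om1 omP)). Qed.

Lemma torus_char_sum b (E : T -> nat) : b != 0 ->
  \sum_(z | torus_point b z) \prod_t om (z t) ^+ E t =
  N1%:R ^+ #|T|.-1 * (om b ^+ E t0 *
   [forall t, (N1%:Z %| (E t)%:Z - sgv sg t * (E t0)%:Z)%Z]%:R).
Proof.
move=> b0; have N0 := N1_gt0.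
have [Nn0 vN] := nu_coprime vP p_pr pn0 vp N1_coprime.
(* [N1.-1] stands for -1 modulo [N1]: inverses in [L] are written as powers, so all exponents remain
   natural numbers. *)
pose m t := if sg t then 1%N else N1.-1.
pose bk := om b ^+ N1.-1.
have delta (z : {ffun T -> L}) : N1%:R * (torus_point b z)%:R =
    \sum_(k < N1) bk ^+ k * \prod_t ((z t != 0)%:R * om (z t) ^+ (k * m t)).
  rewrite /torus_point; have [/forallP zn0|] := boolP [forall t, z t != 0]; last first.
    rewrite negb_forall => /existsP[t]; rewrite negbK => zt.
    by rewrite mulr0 big1 // => k _; rewrite (bigD1 t) //= zt mul0r mul0r mulr0.
  set u := \prod_(t | sg t) z t * (b * \prod_(t | ~~ sg t) z t) ^+ N1.-1.
  have y0 : b * \prod_(t | ~~ sg t) z t != 0.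
    by rewrite mulf_neq0 //; apply/prodf_neq0 => t _.
  have u0 : u != 0 by rewrite mulf_neq0 ?expf_neq0 //; apply/prodf_neq0 => t _.
  have uE k : om u ^+ k = bk ^+ k * \prod_t ((z t != 0)%:R * om (z t) ^+ (k * m t)).
    rewrite /u (omM omP) (omX omP) (omM omP) [(om b * _) ^+ _]exprMn -/bk exprMn [(bk * _) ^+ k]exprMn mulrCA.
    congr (_ * _); rewrite !om_prod -!prodrXl.
    rewrite [RHS](bigID sg) /=; congr (_ * _); apply: eq_bigr => t st.
      by rewrite zn0 mul1r /m st muln1.
    by rewrite zn0 mul1r /m (negPf st) -exprM mulnC.
  transitivity (\sum_(k < N1) om u ^+ k); last by apply: eq_bigr => k _; exact: uE.
  have -> : (\prod_(t | sg t) z t == b * \prod_(t | ~~ sg t) z t) = (u == 1).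
    by rewrite -(inj_eq (mulIf y0) u) -[u * _]mulrA -exprSr prednK // expN1 // mulr1 mul1r.
  case: eqP => [->|u1].
    under eq_bigr => k _ do rewrite (om1 omP) expr1n.
    by rewrite mulr1 sumr_const card_ord.
  rewrite mulr0; have := subrX1 (om u) N1; rewrite omN1 // subrr => /esym/eqP.
  by rewrite mulf_eq0 subr_eq0 => /orP[/eqP/om_eq1 //|/eqP ->].
apply: (mulfI Nn0); rewrite mulr_sumr big_mkcond /=.
transitivity (\sum_(k < N1) bk ^+ k * \prod_t (if (N1 %| E t + k * m t)%N then N1%:R else 0 : Om)).
  transitivity (\sum_(z : {ffun T -> L}) \sum_(k < N1) bk ^+ k *
      \prod_t ((z t != 0)%:R * om (z t) ^+ (E t + k * m t))).
    apply: eq_bigr => z _; transitivity (N1%:R * (torus_point b z)%:R * \prod_t om (z t) ^+ E t).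
      by case: (torus_point b z); rewrite ?mulr1 ?mulr0 ?mul0r.
    rewrite delta mulr_suml; apply: eq_bigr => k _; rewrite -mulrA; congr (_ * _).
    rewrite -big_split; apply: eq_bigr => t _ /=.
    by rewrite exprD mulrAC -mulrA.
  rewrite exchange_big; apply: eq_bigr => k _; rewrite -mulr_sumr; congr (_ * _).
  rewrite -(bigA_distr_bigA (fun t x => (x != 0)%:R * om x ^+ (E t + k * m t))).
  by apply: eq_bigr => t _; exact: char_sum.
(* The coordinate [t0], of positive sign, leaves only the index [k0] congruent to [- E t0]; this is
   where [om b ^+ E t0] comes from. *)
have [k0 k0P] : exists k0 : 'I_N1, (N1 %| E t0 + k0)%N.
  exists (Ordinal (ltn_pmod (N1 - E t0 %% N1) N0)) => /=.
  rewrite /dvdn modnDmr -modnDml subnKC ?modnn //; exact/ltnW/ltn_pmod.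
rewrite (bigD1 k0) //= [X in _ + X]big1 ?addr0; last first.
  move=> k kk0; rewrite (bigD1 t0) //= /m sg0 muln1 ifF ?mul0r ?mulr0 //.
  apply/negbTE; apply: contra kk0 => kP; rewrite -val_eqE /=.
  have : (E t0 + k == E t0 + k0 %[mod N1])%N.
    by rewrite (eqP kP) (eqP k0P).
  by rewrite eqn_modDl !modn_small.
have condE : [forall t, (N1 %| E t + k0 * m t)%N] =
    [forall t, (N1%:Z %| (E t)%:Z - sgv sg t * (E t0)%:Z)%Z].
  apply: eq_forallb => t; rewrite -(dvdzE N1%:Z (E t + k0 * m t)%:Z).
  have h : (N1%:Z %| (E t0 + k0)%:Z)%Z by rewrite dvdzE.
  case/dvdzP: h => x xE.
  rewrite /m /sgv; case: (sg t).
    have -> : (E t + k0 * 1)%:Z = ((E t)%:Z - 1 * (E t0)%:Z) + x * N1%:Z.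
      by rewrite -xE muln1 !PoszD; ring.
    by rewrite rpredDr // dvdz_mull.
  have -> : (E t + k0 * N1.-1)%:Z = ((E t)%:Z - (-1) * (E t0)%:Z) + (k0%:Z - x) * N1%:Z.
    have N1E : N1%:Z = (N1.-1)%:Z + 1 by rewrite -PoszD addn1 prednK.
    by rewrite mulrBl -xE N1E !PoszD PoszM; ring.
  by rewrite rpredDr // dvdz_mull.
rewrite -condE.
have bkE : bk ^+ k0 = om b ^+ E t0.
  rewrite /bk -exprM; apply: (mulIf (expf_neq0 k0 (om_neq0 omP b0))).
  rewrite -!exprD -mulSnr prednK // exprM omN1 // expr1n.
  by case/dvdnP: k0P => x ->; rewrite mulnC exprM omN1 // expr1n.
rewrite bkE; case: (boolP [forall t, _]) => [/forallP H|].
  rewrite (eq_bigr (fun=> N1%:R)) => [|t _]; last by rewrite H.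
  rewrite prodr_const mulr1 mulrA -exprS prednK; first by rewrite mulrC cardT.
  by apply/card_gt0P; exists t0.
rewrite negb_forall => /existsP[t tP].
by rewrite (bigD1 t) //= (negPf tP) mul0r !mulr0.
Qed.

Variables (D : nat) (wt : {ffun T -> 'I_D.+1} -> Om) (c : T -> nat).

Definition expsum b : Om := \sum_(z | torus_point b z)
  (\prod_t om (z t) ^+ (geom p R * c t)) *
  \prod_(j < R) \sum_l wt l * \prod_t (om (z t) ^+ (p ^ j)) ^+ l t.

Lemma expsumE b : b != 0 -> expsum b = N1%:R ^+ #|T|.-1 *
  coef_functional p wt R (fun lam =>
    om b ^+ (lam t0 + geom p R * c t0) * (cyclic_cond p sg t0 c R lam)%:R).
Proof.
move=> b0; rewrite -(coef_functional_scale (prime_gt1 p_pr)) /expsum.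
transitivity (\sum_(z | torus_point b z) coef_functional p wt R (fun lam =>
    (\prod_t om (z t) ^+ (geom p R * c t)) * \prod_t om (z t) ^+ lam t)).
  apply: eq_bigr => z _.
  by rewrite (coef_functional_monomial (prime_gt1 p_pr) wt R (fun t => om (z t))).
rewrite -(coef_functional_sum (prime_gt1 p_pr)); apply: (eq_coef_functional (prime_gt1 p_pr)).
move=> lam _; rewrite -(torus_char_sum (fun t => lam t + geom p R * c t)%N b0).
apply: eq_bigr => z _; rewrite -big_split; apply: eq_bigr => t _.
by rewrite exprD mulrC.
Qed.

(** Used to substitute [z^p] for [z] in the sum: all conjugates of [b] give the same exponential
    sum, whence the factor [s] in the trace. *)
Lemma frobenius_inj : injective (fun x : L => x ^+ p).
Proof.
move=> x y /= xy; have := congr1 (fun z => z ^+ (p ^ R.-1)) xy.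
by rewrite -!exprM -expnS prednK // -cardL !expf_card.
Qed.

Lemma expsum_frobenius b : expsum (b ^+ p) = expsum b.
Proof.
pose fr (z : {ffun T -> L}) : {ffun T -> L} := [ffun t => z t ^+ p].
have frI : injective fr.
  move=> x y /ffunP xy; apply/ffunP => t; apply: frobenius_inj.
  by have := xy t; rewrite !ffunE.
rewrite /expsum (reindex_inj frI).
have frn0 (z : {ffun T -> L}) t : (fr z t != 0) = (z t != 0).
  by rewrite ffunE expf_eq0 prime_gt0.
apply: eq_big => [z|z /andP[/forallP zn0 _]].
  rewrite /torus_point; congr (_ && _); first by apply: eq_forallb => t.
  have frP (P : pred T) : \prod_(t | P t) fr z t = (\prod_(t | P t) z t) ^+ p.
    by rewrite -prodrXl; apply: eq_bigr => t _; rewrite ffunE.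
  by rewrite !frP -exprMn (inj_eq frobenius_inj).
have z0 t : z t != 0 by rewrite -frn0.
congr (_ * _).
  apply: eq_bigr => t _; rewrite ffunE (omX omP) -exprM mulnA.
  have -> : (p * geom p R = geom p R + N1)%N.
    by rewrite /N1 predn_exp -/(geom p R) -{1}(prednK (prime_gt0 p_pr)) mulSn.
  by rewrite mulnDl exprD exprM [X in _ * X]exprM omN1 // expr1n mulr1 -exprM.
pose H j := \sum_l wt l * \prod_t (om (z t) ^+ (p ^ j)) ^+ l t.
have HR : H R = H 0%N.
  apply: eq_bigr => l _; congr (_ * _); apply: eq_bigr => t _.
  by rewrite expn0 expr1 -(omX omP) -cardL expf_card.
transitivity (\prod_(j < R) H j.+1).
  apply: eq_bigr => j _; apply: eq_bigr => l _; congr (_ * _); apply: eq_bigr => t _.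
  by rewrite ffunE (omX omP) expnS exprM.
rewrite -[RHS]/(\prod_(j < R) H j) -(prednK R0) big_ord_recr big_ord_recl /= prednK //.
by rewrite HR mulrC.
Qed.

End CharacterSums.

(** [X^q - X] has at most [q] roots, and the image of [h] already supplies that many. It serves both
    for the prime field and for [pullback]. *)
Lemma frobenius_fixed (L : finFieldType) (I : finType) (h : I -> L) q z :
  injective h -> #|I| = q -> (1 < q)%N -> (forall i, h i ^+ q = h i) ->
  z ^+ q = z -> exists i, h i = z.
Proof.
move=> hI Iq q1 hq zq; case: (boolP (z \in codom h)) => [/codomP[i ->]|zh].
  by exists i.
pose f : {poly L} := 'X^q - 'X.
have sf : size f = q.+1 by rewrite size_polyDl size_polyXn // size_polyN size_polyX.
have f0 : f != 0 by rewrite -size_poly_gt0 sf.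
have rf x : x ^+ q = x -> root f x by move=> xq; rewrite /root !hornerE xq subrr.
have : all (root f) (z :: codom h).
  by rewrite /= rf //; apply/allP => x /codomP[i ->]; exact: rf.
move/(max_poly_roots f0) => /(_ _); rewrite /= zh map_inj_uniq ?enum_uniq //.
by move=> /(_ isT); rewrite sf size_codom Iq ltnn.
Qed.

Lemma geom_mul p s r : (1 < p)%N ->
  geom p (s * r) = (geom p s * \sum_(i < r) (p ^ s) ^ i)%N.
Proof.
move=> p1; have pp : (0 < p.-1)%N by rewrite -ltnS prednK // ltnW.
by apply/eqP; rewrite -(eqn_pmul2l pp) mulnA /geom -!predn_exp expnM.
Qed.

Section PrimeFieldCharacter.
Variables (Om : fieldType) (L : finFieldType) (p R : nat) (psi1 : Om).
Hypotheses (p_pr : prime p) (cardL : #|L| = (p ^ R)%N) (psi1p : psi1 ^+ p = 1).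

Let pchL : p \in [pchar L]. Proof. exact: card_finPcharP cardL p_pr. Qed.

Lemma natL_inj (i j : nat) : (i < p)%N -> (j < p)%N -> i%:R = j%:R :> L -> i = j.
Proof.
wlog ij : i j / (i <= j)%N.
  by move=> H ip jp E; case: (leqP i j) => h; [exact: H | apply/esym/H => //; exact: ltnW].
move=> ip jp E; apply/eqP; rewrite eqn_leq ij /= -subn_eq0; apply/eqP.
have : (p %| j - i)%N by rewrite (dvdn_pcharf pchL) natrB // E subrr.
by case: (j - i)%N (leq_ltn_trans (leq_subr i j) jp) => // k kp /dvdn_leq; lia.
Qed.

Lemma Fp_index_nat i : (i < p)%N -> Fp_index p (i%:R : L) = i.
Proof.
move=> ip; rewrite /Fp_index; case: pickP => [j /eqP /(natL_inj (ltn_ord j) ip) //|] /=.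
by move/(_ (Ordinal ip)); rewrite eqxx.
Qed.

Lemma psiF_nat a : psiF p psi1 (a%:R : L) = psi1 ^+ a.
Proof.
have p0 := prime_gt0 p_pr.
rewrite -(GRing.natr_mod_pchar pchL) /psiF Fp_index_nat ?ltn_mod // [in RHS](divn_eq a p).
by rewrite exprD mulnC exprM psi1p expr1n mul1r.
Qed.

Lemma prime_subfield (y : L) : y ^+ p = y -> exists a : nat, y = a%:R.
Proof.
move=> yp; have [|||||i <-] := @frobenius_fixed L 'I_p (fun i => i%:R) p y.
- by move=> i j /(natL_inj (ltn_ord i) (ltn_ord j)) ij; apply: val_inj.
- exact: card_ord.
- exact: prime_gt1.
- by move=> i; rewrite -[LHS]/(pFrobenius_aut pchL i%:R) rmorph_nat.
- by [].
by exists i.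
Qed.

Lemma pnat_expL i : [pchar L].-nat (p ^ i)%N.
Proof. by rewrite pnatX (eq_pnat _ (pcharf_eq pchL)) pnat_id. Qed.

Lemma trace_pD x y : trace_p p R (x + y : L) = trace_p p R x + trace_p p R y.
Proof.
by rewrite /trace_p -big_split; apply: eq_bigr => i _; rewrite exprDn_pchar ?pnat_expL.
Qed.

Lemma trace_p0 : trace_p p R (0 : L) = 0.
Proof.
by rewrite /trace_p big1 // => i _; rewrite expr0n gtn_eqF ?expn_gt0 ?prime_gt0.
Qed.

Lemma trace_p_frobenius (x : L) : trace_p p R x ^+ p = trace_p p R x.
Proof.
have E : trace_p p R x ^+ p = \sum_(i < R) x ^+ (p ^ i.+1).
  rewrite -[LHS]/(pFrobenius_aut pchL _) /trace_p rmorph_sum /=.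
  by apply: eq_bigr => i _; rewrite pFrobenius_autE -exprM -expnSr.
rewrite E /trace_p; case: R cardL => [|R'] cL; first by rewrite !big_ord0.
by rewrite big_ord_recr big_ord_recl /= -cL expf_card expn0 expr1 addrC.
Qed.

Lemma trace_p_nat (x : L) : exists a : nat, trace_p p R x = a%:R.
Proof. exact: prime_subfield (trace_p_frobenius x). Qed.

Lemma psiF_trace_sum (I : finType) (G : I -> L) :
  psiF p psi1 (trace_p p R (\sum_i G i)) = \prod_i psiF p psi1 (trace_p p R (G i)).
Proof.
have psiD (x y : L) : psiF p psi1 (trace_p p R (x + y)) =
    psiF p psi1 (trace_p p R x) * psiF p psi1 (trace_p p R y).
  have [a xa] := trace_p_nat x; have [b yb] := trace_p_nat y.
  by rewrite trace_pD xa yb -natrD !psiF_nat exprD.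
apply: (big_morph (fun x : L => psiF p psi1 (trace_p p R x))) => //.
by rewrite trace_p0 -[0]/(0%:R) psiF_nat.
Qed.

End PrimeFieldCharacter.

(** * Approximation of the hypergeometric sums *)

Section HypApproximation.
Variables (Om : closedFieldType) (v : Om -> rat) (p s : nat) (pi psi1 : Om).
Hypotheses (vP : is_valuation v) (p_pr : prime p).
Hypotheses (pn0 : (p%:R : Om) != 0) (vp : 0 < v p%:R).
Hypotheses (piE : dwork_pi p pi) (psiE : dwork_psi v p pi psi1).
Variables (k : finFieldType) (om : k -> Om).
Hypotheses (s0 : (0 < s)%N) (cardk : #|k| = (p ^ s)%N) (omP : teichmuller v om).
Variables (L : finFieldType) (io : {rmorphism k -> L}) (omL : L -> Om) (r : nat).
Hypotheses (r0 : (0 < r)%N) (cardL : #|L| = (p ^ (s * r))%N).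
Hypotheses (omLP : teichmuller v omL) (omLE : forall c, omL (io c) = om c).
Variables (D : nat) (ga : Om).
Hypotheses (D0 : (0 < D)%N) (gaE : (logAH Om p D).[ga] = 0)
  (gapi : val_ge v (ga - pi) (2%:R * v pi)).
Variables (n m : nat) (A B : seq nat) (a' b' : nat -> nat).
Hypotheses (AE : forall i, (i < n)%N -> nth 0%N A i = (a' i * geom p s)%N)
  (BE : forall i, (i < m)%N -> nth 0%N B i = (b' i * geom p s)%N)
  (b'p : forall i, (i < m)%N -> (b' i <= p.-1)%N).

(** The inverse characters are given exponents [p - 1 - b'], since [(p - 1) * geom p R] is [p^R - 1]
    and acts trivially. *)
Definition char_exponents (t : 'I_n + 'I_m) := match t with
  | inl i => a' i | inr j => (p.-1 - b' j)%N end.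

Local Notation T := ('I_n + 'I_m)%type.
Local Notation R := (s * r)%N.

Definition neg_twist (w : Om) (t : T) : Om := if is_inl t then 1 else w.
Definition ah_weight (w : Om) (l : {ffun T -> 'I_D.+1}) : Om :=
  \prod_t (ah Om p (l t) * (ga * neg_twist w t) ^+ l t).

Let R0 : (0 < R)%N. Proof. by rewrite muln_gt0 s0. Qed.

(** Thus the sign in the character of [- y] is a Frobenius-invariant rescaling of [ga], stored once
    and for all in [ah_weight]. *)
Lemma omL_neg1 j : omL (-1) ^+ (p ^ j) = omL (-1).
Proof.
have E : omL (-1) ^+ p = omL (-1).
  rewrite -(omX omLP); congr omL; have [p2|po] := even_prime p_pr.
    rewrite p2 sqrrN expr1n; apply/eqP; rewrite -subr_eq0 opprK.
    by have := pcharf0 (card_finPcharP cardL p_pr); rewrite p2 => /eqP.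
  by rewrite -signr_odd po expr1.
by elim: j => [|j IHj]; rewrite ?expn0 ?expr1 // expnS exprM E.
Qed.

Lemma splitting_at (x : L) :
  val_ge v (\prod_(j < R) (AH Om p D).[ga * omL x ^+ (p ^ j)] -
     psiF p psi1 (trace_p p R x)) (D.+1%:R * (v pi / 2%:R) - p.-1%:R * v pi).
Proof.
have [a xa] := trace_p_nat p_pr cardL x; have [psip _] := psiE.
rewrite xa (psiF_nat p_pr cardL) //.
apply: (dwork_splitting vP p_pr pn0 vp piE D0 gaE gapi) => //.
- exact: om_integral.
- by rewrite -(omX omLP) -cardL expf_card.
have nat_om b : cong v (omL b%:R) b%:R.
  elim: b => [|b IHb]; first by rewrite (om0 omLP); apply: cong_refl; left.
  rewrite -!natr1; apply: (cong_trans vP (omD vP omLP _ _)); apply: congD => //.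
  by rewrite (om1 omLP); apply: cong_refl; right; rewrite (nu1 vP).
have h := om_sum vP omLP (index_enum 'I_R) xpredT (fun j => x ^+ (p ^ j)).
rewrite -/(trace_p p R x) xa in h.
have := cong_trans vP (cong_sym vP h) (nat_om a) => -[_ _].
by under eq_bigr => j _ do rewrite (omX omLP).
Qed.

Lemma pullback_norm (x : L) : x != 0 ->
  om (pullback io (norm_k (p ^ s) r x)) = omL x ^+ (\sum_(i < r) (p ^ s) ^ i).
Proof.
move=> x0; rewrite -(omX omLP) -/(norm_k (p ^ s) r x) -omLE /pullback; congr omL.
have zq : norm_k (p ^ s) r x ^+ (p ^ s) = norm_k (p ^ s) r x.
  rewrite /norm_k -exprM.
  have -> : ((\sum_(i < r) (p ^ s) ^ i) * p ^ s = \sum_(i < r) (p ^ s) ^ i + (p ^ R).-1)%N.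
    have q0 : (0 < p ^ s)%N by rewrite expn_gt0 prime_gt0.
    by rewrite expnM (predn_exp (p ^ s)) mulnC -{1}(prednK q0) mulSn.
  by rewrite exprD expN1 ?mulr1.
have [|||||c cE] := @frobenius_fixed L k io (p ^ s) (norm_k (p ^ s) r x).
- exact: fmorph_inj.
- exact: cardk.
- by rewrite -(expn0 p) ltn_exp2l // prime_gt1.
- by move=> c; rewrite -rmorphXn /= -cardk expf_card.
- exact: zq.
by case: pickP => [d /eqP //|/(_ c)]; rewrite cE eqxx.
Qed.

Lemma hyp_approx (a : k) : 
  let C := D.+1%:R * (v pi / 2%:R) - p.-1%:R * v pi in 0 <= C ->
  val_ge v (expsum p omL R is_inl (ah_weight (omL (-1))) char_exponents (io a) -
     Hyp io p s r n m psi1 om A B a) C.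
Proof.
move=> C C0; have [psip _] := psiE.
pose ch (t : T) (z : L) := omL z ^+ (geom p R * char_exponents t).
pose sgz (t : T) (z : L) := if is_inl t then z else - z.
have HypE : Hyp io p s r n m psi1 om A B a = \sum_(z : {ffun T -> L} | torus_point is_inl (io a) z)
    (\prod_t ch t (z t)) * \prod_t psiF p psi1 (trace_p p R (sgz t (z t))).
  rewrite /Hyp pair_big_dep /=.
  pose f (z : {ffun T -> L}) : {ffun 'I_n -> L} * {ffun 'I_m -> L} :=
    ([ffun i => z (inl i)], [ffun j => z (inr j)]).
  pose f' (xy : {ffun 'I_n -> L} * {ffun 'I_m -> L}) : {ffun T -> L} :=
    [ffun t => match t with inl i => xy.1 i | inr j => xy.2 j end].
  have fK : cancel f f' by move=> z; apply/ffunP => -[i|j]; rewrite !ffunE /= ?ffunE.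
  have f'K : cancel f' f.
    by move=> [x y]; congr pair; apply/ffunP => i; rewrite !ffunE.
  rewrite (reindex f) /=; last by apply: onW_bij; exists f'.
  apply: eq_big => [z|z].
    rewrite /torus_point !big_sumType /= [X in _ * X == _]big_pred0 //.
    rewrite [X in _ == _ * (X * _)]big_pred0 // mulr1 mul1r.
    under eq_bigr => i _ do rewrite ffunE.
    under [X in _ == _ * X]eq_bigr => i _ do rewrite ffunE.
    rewrite andbA; congr (_ && _).
    apply/andP/forallP => [[/forallP h1 /forallP h2] [i|j]|h].
    - by have := h1 i; rewrite ffunE.
    - by have := h2 j; rewrite ffunE.
    by split; apply/forallP => i; rewrite ffunE.
  move=> /andP[/forallP x0 /andP[/forallP y0 _]].
  have -> : \sum_i [ffun i => z (inl i)] i - \sum_j [ffun j => z (inr j)] j =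
     \sum_t sgz t (z t).
    rewrite big_sumType /= -sumrN; congr (_ + _); apply: eq_bigr => i _; rewrite ffunE //.
  rewrite (psiF_trace_sum p_pr cardL psip) -mulrA mulrC; congr (_ * _).
  rewrite big_sumType /=; congr (_ * _); apply: eq_bigr => i _; rewrite ffunE.
    have := x0 i; rewrite ffunE => z0; rewrite pullback_norm // /ch /= AE //.
    by rewrite -exprM (geom_mul _ _ (prime_gt1 p_pr)); congr (_ ^+ _); ring.
  have := y0 i; rewrite ffunE => z0; rewrite pullback_norm // /ch /= BE // exprVn -exprM.
  have nz : omL (z (inr i)) != 0 by exact: (om_neq0 omLP z0).
  apply: (mulIf (expf_neq0 ((\sum_(j < r) (p ^ s) ^ j) * (b' i * geom p s))%N nz)).
  rewrite mulVf ?expf_neq0 // -exprD.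
  have -> : (geom p R * (p.-1 - b' i) + (\sum_(j < r) (p ^ s) ^ j) * (b' i * geom p s) =
      (p ^ R).-1 * 1)%N.
    rewrite (predn_exp p R) -/(geom p R) (geom_mul _ _ (prime_gt1 p_pr)).
    have := b'p (ltn_ord i); move: (\sum_(j < r) _)%N (geom p s) (p.-1) (b' i) => a1 a2 a3 a4 h.
    by rewrite -{2}(subnK h); ring.
  by rewrite exprM expr1 (omN1 p_pr omLP cardL).
have expE : expsum p omL R is_inl (ah_weight (omL (-1))) char_exponents (io a) =
    \sum_(z : {ffun T -> L} | torus_point is_inl (io a) z) (\prod_t ch t (z t)) *
    \prod_t \prod_(j < R) (AH Om p D).[ga * omL (sgz t (z t)) ^+ (p ^ j)].
  apply: eq_bigr => z _; congr (_ * _); rewrite [RHS]exchange_big /=.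
  apply: eq_bigr => j _.
  transitivity (\prod_(t : T) \sum_(l < D.+1) ah Om p l * (ga * neg_twist (omL (-1)) t) ^+ l *
     (omL (z t) ^+ (p ^ j)) ^+ l).
    rewrite bigA_distr_bigA; apply: eq_bigr => l _.
    by rewrite /ah_weight -big_split.
  apply: eq_bigr => t _; rewrite /AH horner_poly; apply: eq_bigr => l _.
  rewrite -mulrA -exprMn; congr (_ * _ ^+ _); rewrite -mulrA; congr (_ * _).
  rewrite /neg_twist /sgz; case: (is_inl t); first by rewrite mul1r.
  by rewrite -[X in _ = omL X ^+ _]mulN1r (omM omLP) exprMn omL_neg1.
rewrite HypE expE -sumrB; apply: vge_sum => // z _.
rewrite -mulrBr mulrC; apply: vgeM0 => //; last first.
  by apply: vge_prod0 => // t _; apply: vgeX0 => //; exact: om_integral.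
apply: vge_prodB => // t _; last exact: splitting_at.
have z0 : psi1 != 0.
  by apply: contra_eq_neq psip => ->; rewrite expr0n gtn_eqF ?prime_gt0 // eq_sym oner_eq0.
apply: vgeX0 => //; right; rewrite (nu_unity vP _ psip) //; exact: prime_gt0.
Qed.

End HypApproximation.

(** * Unit minors of the transfer matrix *)

Section Triangularization.
Variables (Om : closedFieldType) (v : Om -> rat) (p : nat).
Hypotheses (vP : is_valuation v) (p_pr : prime p).
Hypotheses (pn0 : (p%:R : Om) != 0) (vp : 0 < v p%:R).
Variable u0 : nat.
Hypothesis u0p : (u0 < p)%N.

Local Notation ah := (ah Om p).

Definition shifted_ah x b : Om := if (b <= x)%N then ah (x - b) else 0.

(* Modulo p, the coefficients in the basis t^(V0 + b), V0 = u0 / (p - 1) = - u0, of the iterates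
   on t^V0 of D + t, where D = t d/dt.  If E is the Artin-Hasse exponential, then
   D (E f) = E (D + t + t^p + ...) f, and U_p D = p D U_p for U_p : t^(p j) |-> t^j, so that
   U_p (E (D + t) f) = - (t + t^p + ...) U_p (E f) mod p: each iteration raises the order
   of U_p (E f), whence the triangularity of triangular_sum. *)
Fixpoint triangular_coef a b : Om :=
  if a is a'.+1 then
    (b%:R - u0%:R) * triangular_coef a' b + (if b is b'.+1 then triangular_coef a' b' else 0)
  else (b == 0%N)%:R.

Lemma triangular_coef_gt a b : (a < b)%N -> triangular_coef a b = 0.
Proof.
elim: a b => [|a IHa] [|b] //= ab; by rewrite !IHa ?mulr0 ?addr0 // ltnW.
Qed.

Lemma triangular_coef_diag a : triangular_coef a a = 1.
Proof. by elim: a => //= a IHa; rewrite IHa triangular_coef_gt // mulr0 add0r. Qed.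

Lemma vge_triangular_coef a b : val_ge v (triangular_coef a b) 0.
Proof.
elim: a b => [|a IHa] b /=; first exact: vge_nat.
apply: vgeD => //; first by apply: vgeM0 => //; apply: vgeB => //; exact: vge_nat.
by case: b => [|b] //; left.
Qed.

(** This is [ah_rec] at [u0 + p j - b]: its term [m = 0] is [shifted_ah x b.+1], and a term
    [p^(m+1)] lowers [j] by [p^m]. *)
Lemma shifted_ah_rec j b (x := (u0 + p * j)%N) :
  (b%:R - u0%:R) * shifted_ah x b + shifted_ah x b.+1 =
  p%:R * j%:R * shifted_ah x b - \sum_(m < x | (p ^ m <= j)%N) shifted_ah (u0 + p * (j - p ^ m)) b.
Proof.
have p0 := prime_gt0 p_pr.
have [bx|xb] := leqP b x; last first.
  rewrite /shifted_ah leqNgt xb leqNgt (leq_trans xb) //= !mulr0 addr0 add0r big1 ?oppr0 // => m pmj.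
  rewrite ifF //; apply/negbTE; rewrite -ltnNge; apply: leq_ltn_trans xb.
  by rewrite leq_add2l leq_mul2l leq_subr orbT.
pose l := (x - b)%N; have lE : (l%:R : Om) = u0%:R + p%:R * j%:R - b%:R.
  by rewrite natrB // natrD natrM.
have := @ah_rec Om p p_pr (nat_neq0 vP p_pr pn0 vp) l x.+1 (leqW (leq_subr _ _)).
rewrite big_mkcond big_ord_recl /= expn0 lE => h.
have E1 : shifted_ah x b = ah l by rewrite /shifted_ah bx.
have E2 : shifted_ah x b.+1 = if (0 < l)%N then ah (l - 1) else 0.
  by rewrite /shifted_ah subn_gt0 subnS subn1.
rewrite E1 E2 big_mkcond.
have -> : \sum_(m < x) (if (p ^ m <= j)%N then shifted_ah (u0 + p * (j - p ^ m)) b else 0) =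
   \sum_(m < x) (if (p ^ bump 0 m <= l)%N then ah (l - p ^ bump 0 m) else 0).
  apply: eq_bigr => m _; rewrite /bump /= add1n expnS.
  have pm0 : (0 < p ^ m)%N by rewrite expn_gt0 p0.
  case: (leqP (p ^ m) j) => [pmj|jpm]; last first.
    rewrite ifF //; apply/negbTE; rewrite -ltnNge /l /x.
    apply: (@leq_ltn_trans (u0 + p * j)); first exact: leq_subr.
    apply: (@leq_trans (p * j.+1)); last by rewrite leq_mul2l jpm orbT.
    by rewrite mulnS ltn_add2r.
  have xE : (u0 + p * (j - p ^ m) = x - p * p ^ m)%N by rewrite mulnBr addnBA // leq_mul2l pmj orbT.
  have xp : (p * p ^ m <= x)%N by rewrite (leq_trans (leq_mul (leqnn p) pmj)) // leq_addl.
  rewrite /shifted_ah xE; have -> : (b <= x - p * p ^ m)%N = (p * p ^ m <= l)%N by rewrite /l; lia.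
  by case: ifP => // _; congr ah; rewrite /l; lia.
have -> : (b%:R - u0%:R) * ah l = p%:R * j%:R * ah l - (u0%:R + p%:R * j%:R - b%:R) * ah l by ring.
by rewrite h -addrA; congr (_ + _); rewrite opprD addrAC addNr add0r.
Qed.

Definition triangular_sum a j : Om := \sum_(b < a.+1) triangular_coef a b * shifted_ah (u0 + p * j) b.

Lemma triangular_sumS a j : triangular_sum a.+1 j = p%:R * j%:R * triangular_sum a j -
  \sum_(m < u0 + p * j | (p ^ m <= j)%N) triangular_sum a (j - p ^ m).
Proof.
rewrite /triangular_sum /=; under eq_bigr => b _ do rewrite mulrDl.
rewrite big_split /=.
rewrite [X in X + _]big_ord_recr /= (triangular_coef_gt (ltnSn a)) mulr0 mul0r addr0.
rewrite [X in _ + X]big_ord_recl /= mul0r add0r -big_split /=.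
rewrite mulr_sumr exchange_big -sumrB; apply: eq_bigr => b _ /=.
rewrite /bump /= add1n -mulr_sumr.
have := shifted_ah_rec j b; set x := (u0 + p * j)%N => h.
have -> : (b%:R - u0%:R) * triangular_coef a b * shifted_ah x b + triangular_coef a b * shifted_ah x b.+1 =
   triangular_coef a b * ((b%:R - u0%:R) * shifted_ah x b + shifted_ah x b.+1) by ring.
by rewrite h; ring.
Qed.

Lemma vge_triangular_sum a j : val_ge v (triangular_sum a j) 0.
Proof.
apply: vge_sum => // b _; apply: vgeM0 => //; first exact: vge_triangular_coef.
by rewrite /shifted_ah; case: ifP => _; [exact: vge_ah | left].
Qed.

(** In [triangular_sumS] the first term is divisible by [p], and every other term lowers [a] by one
    and [j] by at least one. *)
Lemma triangular_sum_small a j : (j < a)%N -> val_gt v (triangular_sum a j) 0.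
Proof.
elim: a j => // a IHa j ja; rewrite triangular_sumS; apply: vgtB => //.
  rewrite -mulrA; apply: vgtM0 => //; first by right.
  by apply: vgeM0 => //; [exact: vge_nat | exact: vge_triangular_sum].
apply: vgt_sum => // m pm; apply: IHa.
have : (0 < p ^ m)%N by rewrite expn_gt0 prime_gt0.
by move: (p ^ m)%N pm => q; lia.
Qed.

Lemma prime_dvd_fact l : (p %| l`!)%N = (p <= l)%N.
Proof.
elim: l => [|l IHl]; first by rewrite fact0 dvdn1 leqn0; case: p p_pr => [|[]].
rewrite factS Euclid_dvdM // IHl; apply/orP/idP => [[/dvdn_leq ->//|/leqW //]|].
by rewrite leq_eqVlt => /orP[/eqP ->|]; [left | right].
Qed.

(** On the diagonal only the term [m = 0] of the recursion survives, with factor -1. At the bottom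
    [ah u0] is the inverse of [u0!], a unit as [u0 < p]. *)
Lemma triangular_sum_diag a : triangular_sum a a != 0 /\ v (triangular_sum a a) = 0.
Proof.
suff H : cong v (triangular_sum a a) ((-1) ^+ a * ah u0).
  apply: (cong_unit vP H).
    rewrite mulf_neq0 ?signr_eq0 //; apply/eqP => e0.
    have := ah_small p_pr (nat_neq0 vP p_pr pn0 vp) u0p.
    by rewrite e0 mul0r => /eqP; rewrite eq_sym oner_eq0.
  have := ah_small p_pr (nat_neq0 vP p_pr pn0 vp) u0p => e1.
  have e0 : ah u0 != 0.
    by apply: contra_eq_neq e1 => ->; rewrite mul0r eq_sym oner_eq0.
  have [f0 vf] : (u0`!%:R : Om) != 0 /\ v (u0`!%:R : Om) = 0.
    apply: (nu_coprime vP p_pr pn0 vp); rewrite prime_coprime //; apply/negP.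
    by rewrite prime_dvd_fact leqNgt u0p.
  have := nuM vP e0 f0; rewrite e1 (nu1 vP) vf => h.
  by rewrite -signr_odd mulr_sign; case: ifP; rewrite ?(nuN vP); lra.
elim: a => [|a IHa].
  rewrite /triangular_sum big_ord_recl big_ord0 /= mul1r addr0 muln0 addn0 expr0 mul1r /shifted_ah subn0.
  by apply: cong_refl; exact: vge_ah.
rewrite triangular_sumS.
have x0 : (0 < u0 + p * a.+1)%N by rewrite addn_gt0 muln_gt0 (prime_gt0 p_pr) orbT.
rewrite (bigD1 (Ordinal x0)) ?expn0 //= subn1 /= opprD addrCA.
rewrite exprS mulN1r mulNr -[- (_ * _)]addr0; apply: congD => //; first exact: congN.
split; [|by left|].
  apply: vgeB => //; last first.
    apply: vge_sum => // m _; exact: vge_triangular_sum.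
  by rewrite -mulrA; apply: vgeM0 => //; [right; apply: ltW | apply: vgeM0 => //; [exact: vge_nat|exact: vge_triangular_sum]].
rewrite subr0; apply: vgtB => //.
  rewrite -mulrA; apply: vgtM0 => //; first by right.
  by apply: vgeM0 => //; [exact: vge_nat | exact: vge_triangular_sum].
apply: vgt_sum => // m /andP[pm m0]; apply: triangular_sum_small.
have : (1 < p ^ m)%N.
  rewrite -(expn0 p) ltn_exp2l ?prime_gt1 //.
  by move: m0; rewrite -val_eqE /= lt0n.
by move: (p ^ m)%N pm => q; lia.
Qed.

End Triangularization.

Section UnitDeterminant.
Variables (Om : fieldType) (v : Om -> rat).
Hypothesis vP : is_valuation v.

(** Modulo the maximal ideal, an entry survives only if it raises [w] or lies on [s]. A permutation
    through such entries never lowers [w], hence preserves it because the total is invariant, and so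
    equals [s]. *)
Lemma det_unit n (X : 'M[Om]_n) (w : 'I_n -> nat) (s : {perm 'I_n}) :
  (forall i j, val_ge v (X i j) 0) ->
  (forall i, w (s i) = w i) ->
  (forall i j, ~~ ((w i < w j)%N || (j == s i)) -> val_gt v (X i j) 0) ->
  (forall i, X i (s i) != 0 /\ v (X i (s i)) = 0) ->
  \det X != 0 /\ v (\det X) = 0.
Proof.
move=> Xi ws Xm Xu.
have prod_val : \prod_i X i (s i) != 0 /\ v (\prod_i X i (s i)) = 0.
  apply: (big_ind (fun x => x != 0 /\ v x = 0)) => // [|x y [x0 vx] [y0 vy]].
    by rewrite oner_neq0 (nu1 vP).
  by rewrite mulf_neq0 // (nuM vP) // vx vy addr0.
suff H : cong v (\det X) ((-1) ^+ s * \prod_i X i (s i)).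
  apply: (cong_unit vP H); first by rewrite mulf_neq0 ?signr_eq0 //; case: prod_val.
  by rewrite mulr_sign; case: ifP; rewrite ?(nuN vP); case: prod_val.
have sgi (t : 'S_n) x c : val_gt v x c -> val_gt v ((-1) ^+ t * x) c.
  by rewrite mulr_sign; case: ifP => // _ ?; apply/vgtN.
have sge (t : 'S_n) x c : val_ge v x c -> val_ge v ((-1) ^+ t * x) c.
  by rewrite mulr_sign; case: ifP => // _ ?; apply/vgeN.
split.
- by apply: vge_sum => // t _; apply: sge; apply: vge_prod0.
- by apply: sge; apply: vge_prod0.
rewrite /determinant (bigD1 s) //= addrC addrK; apply: vgt_sum => // t ts; apply: sgi.
have [i hi] : exists i, ~~ ((w i < w (t i))%N || (t i == s i)).
  apply/existsP; rewrite -negb_forall; apply: contra ts => /forallP H.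
  have le i : (w i <= w (t i))%N.
    by case/orP: (H i) => [/ltnW //|/eqP ->]; rewrite ws.
  have eqw i : w i = w (t i).
    apply/eqP; have : (\sum_i w i == \sum_i w (t i))%N.
      by rewrite [X in _ == X](_ : _ = \sum_i w i)%N // [RHS](reindex_inj (@perm_inj _ t)).
    by rewrite (leqif_sum (fun i _ => leqif_eq (le i))) => /forallP /(_ i).
  by apply/eqP/permP => i; case/orP: (H i) => [|/eqP //]; rewrite -eqw ltnn.
rewrite (bigD1 i) //=; apply: vgtM0 => //; last exact: vge_prod0.
exact: Xm.
Qed.

(** A contributing permutation fixes the complement of [S], so the columns outside [S] may be
    cleared too; such block forms can be multiplied. *)
Lemma pminor_block n (M : 'M[Om]_n) (S : {set 'I_n}) :
  pminor M S = \det (\matrix_(i, j) (if (i \in S) && (j \in S) then M i j else (i == j)%:R)).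
Proof.
apply: eq_bigr => t _; congr (_ * _).
have [/forallP tS|] := boolP [forall i, (i \notin S) ==> (t i == i)].
  have tE i : (t i \in S) = (i \in S).
    have [iS|iS] := boolP (i \in S); last by rewrite (eqP (implyP (tS i) iS)) (negPf iS).
    apply: contraLR iS => siS; have /eqP := implyP (tS (t i)) siS.
    by move/perm_inj => sii; rewrite -sii.
  by apply: eq_bigr => i _; rewrite !mxE tE andbb.
rewrite negb_forall => /existsP[i]; rewrite negb_imply => /andP[iS ti].
by rewrite (bigD1 i) //= [RHS](bigD1 i) //= !mxE (negPf iS) eq_sym (negPf ti) !mul0r.
Qed.

Lemma pminor_scale n (M : 'M[Om]_n) (a b : 'I_n -> Om) (S : {set 'I_n}) :
  pminor (\matrix_(i, j) (a i * M i j * b j)) S = (\prod_(i in S) (a i * b i)) * pminor M S.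
Proof.
rewrite !pminor_block.
pose a' i := if i \in S then a i else 1; pose b' i := if i \in S then b i else 1.
have -> : \prod_(i in S) (a i * b i) = (\prod_i a' i) * \prod_i b' i.
  rewrite -big_split big_mkcond; apply: eq_bigr => i _ /=; rewrite /a' /b'.
  by case: ifP; rewrite ?mulr1.
rewrite /determinant mulr_sumr; apply: eq_bigr => t _.
rewrite mulrCA; congr (_ * _).
rewrite [\prod_i b' i](reindex_inj (@perm_inj _ t)) -big_split -big_split /=.
apply: eq_bigr => i _; rewrite !mxE /a' /b'.
case: (boolP (i \in S)) => iS; case: (boolP (t i \in S)) => tS /=; first by ring.
- by case: eqVneq tS => [<-|_ _]; rewrite ?iS ?mulr0 ?mul0r.
- by case: eqVneq iS => [->|_ _]; rewrite ?tS ?mulr0 ?mul0r.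
by rewrite !mul1r.
Qed.

End UnitDeterminant.

(** * The one-variable factor of the matrix modulo the maximal ideal *)

Section OneVariable.
Variables (Om : closedFieldType) (v : Om -> rat) (p : nat).
Hypotheses (vP : is_valuation v) (p_pr : prime p).
Hypotheses (pn0 : (p%:R : Om) != 0) (vp : 0 < v p%:R).

Local Notation ah := (ah Om p).
Local Notation q := p.-1.

Let p1 : (1 < p)%N. Proof. exact: prime_gt1. Qed.
Let q0 : (0 < q)%N. Proof. by rewrite -ltnS prednK // ltnW. Qed.
Let pE : p = q.+1. Proof. by rewrite prednK // ltnW. Qed.

Definition residual (X : Om) (u w : nat) : Om :=
  if (u <= p * w)%N && (q %| p * w - u)%N then
    ah ((p * w - u) %/ q)%N * X ^+ ((p * w - u) %/ q)%N else 0.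

Lemma ltn_div_eqmod u w : (u %% q = w %% q)%N -> (u < w)%N -> (u %/ q < w %/ q)%N.
Proof.
move=> E uw; rewrite -(ltn_pmul2r q0) -(ltn_add2r (u %% q)) -divn_eq.
by rewrite E -divn_eq.
Qed.

(** The base change of [triangular_coef], applied within each residue class modulo [p - 1] and
    rescaled by powers of [X]. *)
Definition eliminator (X : Om) (u w : nat) : Om :=
  if (w %% q == u %% q)%N then triangular_coef Om (u %% q)%N (u %/ q)%N (w %/ q)%N * X ^+ (w %/ q)%N else 0.

Lemma residual_sum X L u w : (p * w <= q * L)%N ->
  \sum_(l < L.+1) (u + q * l == p * w)%N%:R * (ah l * X ^+ l) = residual X u w.
Proof.
move=> wL; rewrite /residual; case: ifP => [/andP[uw /dvdnP[l lE]]|H]; last first.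
  rewrite big1 // => l _; case: eqP => [E|]; last by rewrite mul0r.
  by move: H; rewrite -E leq_addr addKn dvdn_mulr.
have lL : (l < L.+1)%N by rewrite ltnS -(leq_pmul2l q0) mulnC -lE (leq_trans (leq_subr _ _)).
rewrite lE mulnK // (bigD1 (Ordinal lL)) //= [X in _ + X]big1 ?addr0.
  by rewrite mulnC -lE subnKC // eqxx mul1r.
move=> i; rewrite -val_eqE /= => /negPf il; case: eqP => [E|]; last by rewrite mul0r.
have : (q * i = q * l)%N by rewrite [(q * l)%N]mulnC -lE -E addKn.
by move/eqP; rewrite eqn_pmul2l // il.
Qed.

Lemma vge_residual X u w : val_ge v X 0 -> val_ge v (residual X u w) 0.
Proof.
move=> X0; rewrite /residual; case: ifP => _; last by left.
by apply: vgeM0 => //; [exact: vge_ah | exact: vgeX0].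
Qed.

Lemma vge_eliminator X u w : val_ge v X 0 -> val_ge v (eliminator X u w) 0.
Proof.
move=> X0; rewrite /eliminator; case: ifP => _; last by left.
by apply: vgeM0 => //; [exact: vge_triangular_coef | exact: vgeX0].
Qed.

Lemma eliminator_gt X u w : (u < w)%N -> eliminator X u w = 0.
Proof.
move=> uw; rewrite /eliminator; case: eqP => // E.
by rewrite triangular_coef_gt ?mul0r // ltn_div_eqmod.
Qed.

Lemma eliminator_neq0 X u w : eliminator X u w != 0 -> (w <= u)%N /\ (w %% q = u %% q)%N.
Proof.
move=> H; split; last by apply/eqP; apply: contraNT H => /negPf; rewrite /eliminator => ->.
by rewrite leqNgt; apply: contraNN H => uw; rewrite eliminator_gt.
Qed.

Lemma eliminator_diag X u : eliminator X u u = X ^+ (u %/ q).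
Proof. by rewrite /eliminator eqxx triangular_coef_diag mul1r. Qed.

Definition reduced (X : Om) (u w : nat) : Om :=
  if (w %% q == u %% q)%N then X ^+ (u %% q + p * (w %/ q))%N * triangular_sum Om p (u %% q)%N (u %/ q)%N (w %/ q)%N else 0.

(** With [u0] the common residue, put [x = q b + u0] and [w = q a2 + u0]. Then
    [p w - x = q (u0 + p a2 - b)], so the residual entry is a [shifted_ah] and the sum over [x] is a
    [triangular_sum]. *)
Lemma eliminator_residual X B u w : (u <= B)%N ->
  \sum_(x < B.+1) eliminator X u x * residual X x w = reduced X u w.
Proof.
move=> uB; set u0 := (u %% q)%N; set a := (u %/ q)%N.
have uE : u = (a * q + u0)%N by rewrite /a /u0 -divn_eq.
have u0q : (u0 < q)%N by rewrite ltn_mod.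
have modE b : ((q * b + u0) %% q)%N = u0 by rewrite mulnC modnMDl modn_small.
have divE b : ((q * b + u0) %/ q)%N = b by rewrite mulnC divnMDl // divn_small // addn0.
rewrite (bigID (fun x : 'I_B.+1 => (x <= u)%N && (x %% q == u %% q)%N)) /= [X in _ + X]big1 ?addr0; last first.
  move=> x H; have [->|/eliminator_neq0[xu /eqP xE]] := eqVneq (eliminator X u x) 0.
    by rewrite mul0r.
  by move: H; rewrite xu xE.
have bB (b : 'I_a.+1) : (q * b + u0 < B.+1)%N.
  by rewrite ltnS (leq_trans _ uB) // uE leq_add2r mulnC leq_mul2r -ltnS ltn_ord orbT.
rewrite (reindex_onto (fun b : 'I_a.+1 => inord (q * b + u0)) (fun x => inord (x %/ q))) /=; last first.
  move=> x /andP[xu /eqP xm]; apply: val_inj.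
  have xa : (x %/ q < a.+1)%N by rewrite ltnS leq_div2r.
  rewrite /= inordK ?(inordK xa) //.
    by rewrite [RHS](divn_eq x q) mulnC xm.
  by rewrite /u0 -xm mulnC -divn_eq.
rewrite (eq_bigl xpredT); last first.
  move=> b; rewrite inordK // modE eqxx andbT divE inord_val eqxx andbT.
  by rewrite [X in (_ <= X)%N]uE leq_add2r mulnC leq_mul2r -ltnS ltn_ord orbT.
rewrite /reduced -/u0 -/a; case: ifP => wm; last first.
  rewrite big1 // => b _; rewrite /residual inordK //; case: ifP; last by rewrite mulr0.
  move=> /andP[h1 h2]; case/negP: wm; rewrite -(eqn_mod_dvd _ h1) in h2.
  move: h2; rewrite {1}pE mulSn [(q * w)%N]mulnC addnC modnMDl modE.
  by move=> /eqP ->.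
rewrite /triangular_sum mulr_sumr; apply: eq_bigr => b _; rewrite inordK //.
rewrite /eliminator modE -/u0 -/a eqxx divE /shifted_ah /residual.
have wE : w = (q * (w %/ q) + u0)%N by rewrite {1}(divn_eq w q) (eqP wm) mulnC.
set a2 := (w %/ q)%N in wE *.
have pwE : (p * w = q * (u0 + p * a2) + u0)%N.
  suff E P Q : P = Q.+1 -> (P * (Q * a2 + u0) = Q * (u0 + P * a2) + u0)%N by rewrite wE E.
  by move=> ->; rewrite -[Q.+1]addn1; ring.
rewrite pwE leq_add2r leq_pmul2l // subnDr -mulnBr dvdn_mulr // andbT mulKn //.
case: ifP => [h|_]; last by rewrite !mulr0.
have -> : X ^+ (u0 + p * a2) = X ^+ b * X ^+ (u0 + p * a2 - b) by rewrite -exprD subnKC.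
ring.
Qed.

Lemma reduced_small X u w : val_ge v X 0 -> (w < u)%N -> val_gt v (reduced X u w) 0.
Proof.
move=> X0 wu; rewrite /reduced; case: eqP => [E|_]; last by left.
rewrite mulrC; apply: vgtM0 => //; last exact: vgeX0.
apply: triangular_sum_small => //; first by rewrite (leq_trans (ltn_pmod _ q0)) // leq_pred.
exact: ltn_div_eqmod.
Qed.

Lemma vge_reduced X u w : val_ge v X 0 -> val_ge v (reduced X u w) 0.
Proof.
move=> X0; rewrite /reduced; case: eqP => [E|_]; last by left.
by apply: vgeM0 => //; [exact: vgeX0 | exact: vge_triangular_sum].
Qed.

Lemma reduced_diag X u : X != 0 -> v X = 0 -> reduced X u u != 0 /\ v (reduced X u u) = 0.
Proof.
move=> X0 vX; rewrite /reduced eqxx.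
have u0 : (u %% q < p)%N by rewrite (leq_trans (ltn_pmod _ q0)) // leq_pred.
have [y0 vy] := triangular_sum_diag vP p_pr pn0 vp u0 (u %/ q).
by rewrite mulf_neq0 ?expf_neq0 // (nuM vP) ?expf_neq0 // (nuX vP) // vX vy mulr0 addr0.
Qed.

End OneVariable.

Section Scaling.
Variables (Om : fieldType) (v : Om -> rat).
Hypothesis vP : is_valuation v.

Lemma vge_scale x c (a : Om) : a != 0 -> val_ge v (a * x) c <-> val_ge v x (c - v a).
Proof.
move=> a0; have [->|x0] := eqVneq x 0; first by rewrite mulr0; split; left.
rewrite /val_ge (nuM vP) // lerBlDl; split=> -[/eqP|h]; try by right.
  by rewrite mulf_eq0 (negPf a0) (negPf x0).
by rewrite (negPf x0).
Qed.

Lemma vgt_scale x c (a : Om) : a != 0 -> val_gt v (a * x) c <-> val_gt v x (c - v a).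
Proof.
move=> a0; have [->|x0] := eqVneq x 0; first by rewrite mulr0; split; left.
rewrite /val_gt (nuM vP) // ltrBlDl; split=> -[/eqP|h]; try by right.
  by rewrite mulf_eq0 (negPf a0) (negPf x0).
by rewrite (negPf x0).
Qed.

Lemma cong_det n (M N : 'M[Om]_n) : (forall i j, cong v (M i j) (N i j)) ->
  cong v (\det M) (\det N).
Proof.
move=> MN; apply: cong_sum => // t _; apply: congM => //.
  by apply: cong_refl; apply: vgeX0 => //; apply/vgeN => //; exact: vge1.
by apply: cong_prod.
Qed.

End Scaling.

(** * Minors of the transfer matrix on weight windows *)

Section TransferMinor.
Variables (Om : closedFieldType) (v : Om -> rat) (p : nat).
Hypotheses (vP : is_valuation v) (p_pr : prime p).
Hypotheses (pn0 : (p%:R : Om) != 0) (vp : 0 < v p%:R).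
Variables (T : finType) (sg : pred T) (t0 : T) (L B s : nat) (c : T -> nat) (A : Om).
Hypotheses (sg0 : sg t0) (sum_sg : 0 < \sum_t sgv sg t) (s0 : (0 < s)%N).
Hypotheses (A0 : A != 0) (vA : v A = 0).
Variable xi : T -> Om.
Hypotheses (xi0 : forall t, xi t != 0) (vxi : forall t, v (xi t) = 0).
Variables (ga eta : Om).
Hypotheses (etaE : eta ^+ p.-1 = ga) (eta0 : eta != 0) (veta : 0 < v eta).

Local Notation ah := (ah Om p).
Local Notation q := p.-1.
Local Notation vec := {ffun T -> 'I_B.+1}.
Local Notation J := ('I_s * vec)%type.
Local Notation valid := (valid sg t0 p c).
Local Notation rel := (@rel_step T sg t0 p B).

Let p1 : (1 < p)%N. Proof. exact: prime_gt1. Qed.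
Let q0 : (0 < q)%N. Proof. by rewrite -ltnS prednK // ltnW. Qed.

Definition twisted_weight (l : {ffun T -> 'I_L.+1}) : Om :=
  \prod_t (ah (l t) * (ga * xi t) ^+ l t).

Definition wdeg (U : vec) := (\sum_t U t)%N.

Local Notation M := (transfer_mx p twisted_weight sg t0 B s c A).

(** The displacement [k] along the relation is nonnegative, because some positive-sign coordinate of
    [V] is 0. Since [sum_sg] is positive, a nonzero displacement costs weight, and only exact
    equality reaches leading order. *)
Lemma rel_degree (U V : vec) (l : T -> nat) : valid V -> rel 1 U l V ->
  exists2 k : nat, (wdeg U + q * (\sum_t l t) >= p * wdeg V + k)%N &
    (k = 0)%N -> forall t, (U t + q * l t = p * V t)%N.
Proof.
move=> /andP[/existsP[x /andP[sx /eqP Vx]] _] /(eqeP sg0)[k H]; rewrite expn1 in H.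
have k0 : 0 <= k by have := H x; rewrite /sgv sx Vx; lia.
have := sum_sg; set d := \sum_t sgv sg t => d0.
exists `|k|%N; last first.
  by move=> kz t; have := H t; have -> : k = 0 by [lia]; lia.
have E : (wdeg U + q * \sum_t l t)%:Z = (p * wdeg V)%:Z + d * k.
  rewrite /wdeg !big_distrr -big_split /= !(big_morph Posz PoszD (erefl _)).
  by rewrite /d mulr_suml -big_split /=; apply: eq_bigr => t _; exact: H.
by nia.
Qed.

Let term (i : nat) (U V : vec) (l : {ffun T -> 'I_L.+1}) : Om :=
  twisted_weight l * ((A ^+ (p ^ i)) ^+ (l t0 + c t0) * (rel 1 U (fun t => l t) V)%:R).

Lemma transfer_mxE a b : M a b = 
  (((enum_val b).1 == ((enum_val a).1 + 1) %% s :> nat)%N)%:R *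
  (valid (enum_val a).2 && valid (enum_val b).2)%:R *
  \sum_l term (enum_val a).1 (enum_val a).2 (enum_val b).2 l.
Proof.
rewrite mxE /transfer_path; congr (_ * _); rewrite coef_functional1; last first.
  by move=> lam lam' E; rewrite (rel_ext _ _ _ _ _ _ E) E.
by apply: eq_bigr => l _; rewrite /geom big_ord1 expn0 mul1n.
Qed.

Let ga0 : ga != 0. Proof. by rewrite -etaE expf_neq0. Qed.
Let vga : v ga = q%:R * v eta. Proof. by rewrite -etaE (nuX vP). Qed.

Lemma vge_term i (U V : vec) l : valid V ->
  val_ge v (term i U V l) ((p * wdeg V)%:R * v eta - (wdeg U)%:R * v eta) /\
  (~~ [forall t, (U t + q * l t == p * V t)%N] ->
   val_gt v (term i U V l) ((p * wdeg V)%:R * v eta - (wdeg U)%:R * v eta)).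
Proof.
move=> vV; rewrite /term; have [R|_] := boolP (rel _ _ _ _); last first.
  by rewrite !mulr0; split=> [|_]; left.
have [k kE k0] := rel_degree vV R.
have X0 : val_ge v ((A ^+ (p ^ i)) ^+ (l t0 + c t0) * true%:R) 0.
  rewrite mulr1; right; rewrite !(nuX vP) ?expf_neq0 // vA !mulr0 //.
have wl : val_ge v (twisted_weight l) ((q * (\sum_t l t))%:R * v eta).
  rewrite big_distrr natr_sum mulr_suml; apply: vge_prod => // t _.
  rewrite -[_ * v eta]add0r; apply: vgeM => //; first exact: vge_ah.
  right; rewrite (nuX vP) ?mulf_neq0 // (nuM vP) // vga vxi addr0 natrM.
  by rewrite mulrA [q%:R * _]mulrC.
have h : (p * wdeg V)%:R * v eta - (wdeg U)%:R * v eta + k%:R * v eta <=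
    (q * (\sum_t l t))%:R * v eta.
  rewrite -mulrBl -mulrDl ler_wpM2r ?(ltW veta) //.
  move: kE; rewrite -(ler_nat rat) !natrD => kE'; lra.
split.
  apply: vgeM0 => //; apply: vgeW wl; apply: le_trans h; rewrite lerDl.
  by rewrite mulr_ge0 ?ler0n // ltW.
move=> /negP H; apply: vgtM0 => //; apply: vgt_ge wl; apply: lt_le_trans h.
rewrite ltrDl mulr_gt0 // ltr0n lt0n; apply/eqP => /k0 E; apply: H.
by apply/forallP => t; rewrite E.
Qed.

Definition row_height (a : J) : rat := if valid a.2 then (wdeg a.2)%:R * v eta else 0.
(** Columns of vectors that are not [valid] vanish, so their height [C] is free; it is later chosen
    to keep them out of the window. *)
Definition col_height C (a : J) : rat := if valid a.2 then (p * wdeg a.2)%:R * v eta else C.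

Lemma vge_transfer_mx C a b :
  val_ge v (M a b) (col_height C (enum_val b) - row_height (enum_val a)).
Proof.
rewrite transfer_mxE /row_height /col_height.
case: (boolP (valid (enum_val a).2)) => va; last by rewrite mulr0 mul0r; left.
case: (boolP (valid (enum_val b).2)) => vb; last by rewrite mulr0 mul0r; left.
rewrite mulr1; case: eqP => _; last by rewrite mul0r; left.
by rewrite mul1r; apply: vge_sum => // l _; case: (vge_term (enum_val a).1 (enum_val a).2 l vb).
Qed.

Variable wmax : nat.
Hypothesis wmaxL : (p * wmax <= q * L)%N.

Let S := [set a : 'I_#|{: J}| | valid (enum_val a).2 && (wdeg (enum_val a).2 < wmax)%N].

Let X i t : Om := xi t * (if t == t0 then A ^+ (p ^ i) else 1).

Let X0 i t : X i t != 0.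
Proof. by rewrite mulf_neq0 //; case: ifP => _; rewrite ?oner_neq0 ?expf_neq0. Qed.

Let vX i t : v (X i t) = 0.
Proof.
rewrite (nuM vP) // ?vxi; last by case: ifP => _; rewrite ?oner_neq0 ?expf_neq0.
by case: ifP => _; rewrite ?(nu1 vP) ?(nuX vP) // ?vA mulr0 addr0.
Qed.

Let Xi i t : val_ge v (X i t) 0. Proof. by right; rewrite vX. Qed.

Let unit_factor i : Om := (A ^+ (p ^ i)) ^+ c t0.

Let residual_entry (a b : J) : Om :=
  (b.1 == (a.1 + 1) %% s :> nat)%N%:R * unit_factor a.1 *
   \prod_t residual p (X a.1 t) (a.2 t) (b.2 t).

Lemma residual_term i (U V : vec) : (wdeg V < wmax)%N ->
  \sum_(l : {ffun T -> 'I_L.+1} | [forall t, (U t + q * l t == p * V t)%N]) term i U V l =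
  unit_factor i * (eta ^+ (p * wdeg V) / eta ^+ wdeg U) * \prod_t residual p (X i t) (U t) (V t).
Proof.
move=> Vw; have VL t : (p * V t <= q * L)%N.
  rewrite (leq_trans _ wmaxL) // leq_mul2l (leq_trans _ (ltnW Vw)) ?orbT //.
  by rewrite /wdeg (bigD1 t) //= leq_addr.
under [in RHS]eq_bigr => t _ do rewrite -(residual_sum p_pr (X i t) (U t) (VL t)).
rewrite bigA_distr_bigA mulr_sumr big_mkcond; apply: eq_bigr => l _.
case: (boolP [forall t, _]) => [/forallP H|]; last first.
  rewrite negb_forall => /existsP[t /negPf ht].
  by rewrite (bigD1 t) //= ht !mul0r mulr0.
have R : rel 1 U (fun t => l t) V.
  by apply/(eqeP sg0); exists 0 => t; rewrite mulr0 addr0 expn1 (eqP (H t)).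
rewrite /term R mulr1 /unit_factor.
under [in RHS]eq_bigr => t _ do rewrite H mul1r /X exprMn.
have wE : (p * wdeg V = q * (\sum_t l t) + wdeg U)%N.
  by rewrite /wdeg !big_distrr -big_split /=; apply: eq_bigr => t _; rewrite -(eqP (H t)) addnC.
rewrite wE [eta ^+ (_ + _)]exprD mulfK ?expf_neq0 // exprM etaE exprD.
rewrite -prodrXr /twisted_weight.
have -> : \prod_t (ah (l t) * (xi t ^+ l t * (if t == t0 then A ^+ (p ^ i) else 1) ^+ l t)) =
   (\prod_t (ah (l t) * xi t ^+ l t)) * (A ^+ (p ^ i)) ^+ l t0.
  under eq_bigr => t _ do rewrite mulrA.
  rewrite big_split /=; congr (_ * _); rewrite (bigD1 t0) //= eqxx big1 ?mulr1 // => t /negPf ->.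
  by rewrite expr1n.
have -> : \prod_t (ah (l t) * (ga * xi t) ^+ l t) =
   (\prod_t ga ^+ l t) * \prod_t (ah (l t) * xi t ^+ l t).
  by rewrite -big_split; apply: eq_bigr => t _ /=; rewrite exprMn mulrCA.
by ring.
Qed.

Let scaled (a b : 'I_#|{: J}|) : Om := eta ^+ wdeg (enum_val a).2 * M a b *
   (eta ^+ (p * wdeg (enum_val b).2))^-1.

(** The exact solutions of [U + q l = p V] give the product of one-variable entries; all other terms
    lie in the maximal ideal after rescaling. *)
Lemma scaled_cong a b : a \in S -> b \in S ->
  cong v (scaled a b) (residual_entry (enum_val a) (enum_val b)).
Proof.
rewrite !inE => /andP[vU Uw] /andP[vV Vw]; rewrite /scaled transfer_mxE vU vV mulr1.
rewrite /residual_entry; case: eqP => E; last first.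
  by rewrite !(mul0r, mulr0); apply: cong_refl; exact: vge0.
rewrite !mul1r; set i := (enum_val a).1; set U := (enum_val a).2; set V := (enum_val b).2.
have eU : eta ^+ wdeg U != 0 by rewrite expf_neq0.
have eV : eta ^+ (p * wdeg V) != 0 by rewrite expf_neq0.
set x := eta ^+ wdeg U; set y := eta ^+ _.
have y0 : y^-1 != 0 by rewrite invr_eq0 expf_neq0.
have xy0 : x / y != 0 by rewrite mulf_neq0 // expf_neq0.
have vxy : v (x / y) = (wdeg U)%:R * v eta - (p * wdeg V)%:R * v eta.
  by rewrite (nuM vP) ?expf_neq0 // (nuV vP) ?expf_neq0 // !(nuX vP).
rewrite mulrAC.
have vs l c0 := vge_scale vP l c0 xy0; have vs' l c0 := vgt_scale vP l c0 xy0.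
rewrite vxy in vs vs'.
rewrite (bigID (fun l : {ffun T -> 'I_L.+1} => [forall t, (U t + q * l t == p * V t)%N])) /=.
rewrite residual_term // mulrDr.
set R1 := (X in cong v (X + _)).
have -> : R1 = unit_factor i * \prod_t residual p (X i t) (U t) (V t).
  rewrite /R1 -/x -/y; set P := \prod_t _.
  by field; rewrite eU eV.
rewrite -[X in cong v _ X]addr0; apply: congD => //.
  apply: cong_refl; apply: vgeM0 => //.
    by right; rewrite /unit_factor !(nuX vP) ?expf_neq0 // vA !mulr0.
  by apply: vge_prod0 => // t _; exact: vge_residual.
split; [|by left|].
  apply/vs; rewrite sub0r opprB; apply: vge_sum => // l _; by case: (vge_term i U l vV).
rewrite subr0; apply/vs'; rewrite sub0r opprB; apply: vgt_sum => // l H.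
by case: (vge_term i U l vV) => _; apply.
Qed.

Let eliminator_entry (a b : J) : Om :=
  (b.1 == a.1)%:R * \prod_t eliminator p (X a.1 t) (a.2 t) (b.2 t).

Let reduced_entry (a b : J) : Om :=
  (b.1 == (a.1 + 1) %% s :> nat)%N%:R * unit_factor a.1 *
   \prod_t reduced p (X a.1 t) (a.2 t) (b.2 t).

Let in_window (a : J) := valid a.2 && (wdeg a.2 < wmax)%N.

Let block (F : J -> J -> Om) : 'M[Om]_#|{: J}| := \matrix_(a, b)
  if (a \in S) && (b \in S) then F (enum_val a) (enum_val b) else (a == b)%:R.

Lemma eliminator_entry_neq0 a b : eliminator_entry a b != 0 ->
  a.1 = b.1 /\ forall t, (b.2 t <= a.2 t)%N /\ (b.2 t %% q = a.2 t %% q)%N.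
Proof.
rewrite /eliminator_entry; case: (b.1 =P a.1) => [->|_]; last by rewrite mul0r eqxx.
rewrite mul1r => /prodf_neq0 H.
by split=> // t; apply: (eliminator_neq0 p_pr (H t isT)).
Qed.

(** The base change only lowers coordinates, by multiples of [p - 1]: zeros stay zero, classes are
    kept and the weight does not grow. It therefore restricts to the window. *)
Lemma eliminator_window a b : in_window a -> eliminator_entry a b != 0 -> in_window b.
Proof.
move=> /andP[/andP[/existsP[x /andP[sx Ux]] /forallP cU] Uw] /eliminator_entry_neq0[_ H].
apply/andP; split; last first.
  by apply: leq_ltn_trans Uw; apply: leq_sum => t _; case: (H t).
apply/andP; split.
  by apply/existsP; exists x; rewrite sx -leqn0 (leq_trans (proj1 (H x))) // leqn0.
pose k u := ((a.2 u - b.2 u) %/ q)%N.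
have K u : (a.2 u = b.2 u + q * k u :> nat)%N.
  have [bu /eqP E] := H u; rewrite eq_sym eqn_mod_dvd // in E.
  by rewrite /k mulnC divnK // subnKC.
apply/forallP => t; have /dvdzP[x0 E] := cU t.
apply/dvdzP; exists (x0 - ((k t)%:Z - sgv sg t * (k t0)%:Z)).
move: E; rewrite !K !PoszD !PoszM; move: (sgv sg t) (Posz q) => e r E.
by rewrite mulrBl -E; ring.
Qed.

Let blockE F a b : block F a b =
  if (a \in S) && (b \in S) then F (enum_val a) (enum_val b) else (a == b)%:R.
Proof. by rewrite mxE. Qed.

Let SE a : (a \in S) = in_window (enum_val a). Proof. by rewrite inE. Qed.

Lemma eliminator_residual_block :
  block eliminator_entry *m block residual_entry = block reduced_entry.
Proof.
apply/matrixP => a b; rewrite mxE blockE.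
have [aS|aS] := boolP (a \in S); last first.
  rewrite (bigD1 a) //= !blockE (negPf aS) eqxx mul1r big1 ?addr0 // => d da.
  by rewrite blockE (negPf aS) eq_sym (negPf da) mul0r.
have [bS|bS] := boolP (b \in S); last first.
  rewrite (bigD1 b) //= !blockE (negPf bS) !andbF eqxx mulr1 big1 ?addr0 // => d da.
  by rewrite [X in _ * X]blockE (negPf bS) andbF (negPf da) mulr0.
transitivity (\sum_(d : J) eliminator_entry (enum_val a) d * residual_entry d (enum_val b)).
  rewrite [RHS](reindex_onto enum_val enum_rank) /=; last by move=> d _; rewrite enum_rankK.
  apply: eq_big => [d|d _]; first by rewrite enum_valK eqxx.
  rewrite !blockE aS bS andbT /=; case: ifP => // dS.
  have -> : (a == d) = false by apply: contraFF dS => /eqP <-.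
  have -> : eliminator_entry (enum_val a) (enum_val d) = 0; last by rewrite !mul0r.
  by apply: contraFeq dS => H; rewrite SE (eliminator_window _ H) // -SE.
case: (enum_val a) (enum_val b) => [i U] [j V] /=.
rewrite -(pair_bigA _ (fun i' W => eliminator_entry (i, U) (i', W) * residual_entry (i', W) (j, V))).
rewrite (bigD1 i) //= [X in _ + X]big1 ?addr0; last first.
  move=> i' /negPf ii; rewrite big1 // => W _.
  by rewrite /eliminator_entry /= ii !mul0r.
rewrite /eliminator_entry /residual_entry /reduced_entry /=; set e := _%:R * unit_factor i.
under eq_bigr => W _ do rewrite eqxx mul1r mulrCA -big_split /=.
rewrite -mulr_sumr; congr (_ * _).
under [in RHS]eq_bigr => t _ do rewrite -(eliminator_residual p_pr (X i t) (V t) (leq_ord (U t))).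
by rewrite bigA_distr_bigA.
Qed.

Lemma eliminator_unit :
  \det (block eliminator_entry) != 0 /\ v (\det (block eliminator_entry)) = 0.
Proof.
(* Off the diagonal these entries lower the weight, whereas [det_unit] wants it raised; inside the
   window the subtraction from [wmax] is exact. *)
apply: (@det_unit _ _ vP _ _ (fun a => wmax - wdeg (enum_val a).2)%N 1).
- move=> a b; rewrite blockE; case: ifP => _; last by apply: vge_nat.
  by apply: vgeM0 => //; [exact: vge_nat | apply: vge_prod0 => // t _; exact: vge_eliminator].
- by move=> a; rewrite perm1.
- move=> a b; rewrite perm1 blockE; case: ifP => [/andP[aS bS]|_ H]; last first.
    by left; move: H; rewrite negb_or eq_sym => /andP[_ /negPf ->].
  move=> H; left; apply/eqP; apply: contraNT H => /eliminator_entry_neq0[E1 H].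
  move: aS bS; rewrite !inE => /andP[_ aw] /andP[_ bw].
  have le t : (true -> ((enum_val b).2 t <= (enum_val a).2 t)%N) by move=> _; case: (H t).
  have [E|] := eqVneq (wdeg (enum_val b).2) (wdeg (enum_val a).2).
    apply/orP; right; apply/eqP; apply: enum_val_inj.
    move: E1 E le; case: (enum_val a) (enum_val b) => [i U] [j V] /= -> /eqP E le.
    congr (_, _); apply/ffunP => t; apply: val_inj; apply/eqP.
    move: E; rewrite /wdeg (leqif_sum (fun t _ => leqif_eq (le t isT))).
    by move=> /forallP /(_ t).
  move=> E; apply/orP; left.
  have : (wdeg (enum_val b).2 <= wdeg (enum_val a).2)%N by apply: leq_sum => t _; exact: le.
  by move: E aw bw; move: (wdeg _) (wdeg _) => x y; lia.
- move=> a; rewrite perm1 blockE andbb; case: ifP => _; last by rewrite eqxx oner_neq0 (nu1 vP).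
  rewrite /eliminator_entry eqxx mul1r.
  apply: (big_ind (fun x => x != 0 /\ v x = 0)) => [|x y [x0 vx] [y0 vy]|t _].
  + by rewrite oner_neq0 (nu1 vP).
  + by rewrite mulf_neq0 // (nuM vP) // vx vy addr0.
  + by rewrite eliminator_diag expf_neq0 // (nuX vP) // vX mulr0.
Qed.

(** The leading permutation of the reduced matrix advances the Frobenius index by one and fixes the
    exponent vector. *)
Let shift (a : 'I_#|{: J}|) : 'I_#|{: J}| :=
  if a \in S then enum_rank (Ordinal (ltn_pmod ((enum_val a).1 + 1) s0), (enum_val a).2) else a.

Let shiftS a : (shift a \in S) = (a \in S).
Proof.
rewrite /shift; case: ifP => // aS; rewrite SE enum_rankK.
by move: aS; rewrite SE.
Qed.

Let shift_inj : injective shift.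
Proof.
move=> a b E; have := shiftS a; rewrite E shiftS => abS.
move: E; rewrite /shift abS; case: ifP => // _ /enum_rank_inj.
case E1: (enum_val a) => [i U]; case E2: (enum_val b) => [j V] [] /= E EU.
apply: enum_val_inj; rewrite E1 E2 EU; congr (_, _); apply: val_inj => /=.
by move/eqP: E; rewrite eqn_modDr !modn_small // => /eqP.
Qed.

Lemma reduced_unit :
  \det (block reduced_entry) != 0 /\ v (\det (block reduced_entry)) = 0.
Proof.
have unit_factor0 i : unit_factor i != 0 /\ v (unit_factor i) = 0.
  by rewrite /unit_factor !expf_neq0 // !(nuX vP) ?expf_neq0 // vA !mulr0.
apply: (@det_unit _ _ vP _ _ (fun a => wdeg (enum_val a).2) (perm shift_inj)).
- move=> a b; rewrite blockE; case: ifP => _; last by apply: vge_nat.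
  apply: vgeM0 => //; last by apply: vge_prod0 => // t _; exact: vge_reduced.
  apply: vgeM0 => //; first exact: vge_nat.
  by case: (unit_factor0 (enum_val a).1) => _ e; right; rewrite e.
- by move=> a; rewrite permE /shift; case: ifP => // _; rewrite enum_rankK.
- move=> a b; rewrite permE blockE /shift.
  have [aS|aS] := boolP (a \in S); last first.
    by rewrite /= negb_or eq_sym => /andP[_ /negPf ->]; left.
  have [bS|bS] := boolP (b \in S); last first.
    move=> _ /=; have -> : (a == b) = false by apply: contraNF bS => /eqP <-.
    by left.
  move=> H; rewrite /= /reduced_entry; case: eqP => [E|_]; last by rewrite !mul0r; left.
  have [/forallP|] := boolP [forall t, ((enum_val a).2 t <= (enum_val b).2 t)%N]; last first.
    rewrite negb_forall => /existsP[t]; rewrite -ltnNge => lt.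
    rewrite mul1r mulrC; apply: vgtM0 => //; last first.
      by case: (unit_factor0 (enum_val a).1) => _ e; right; rewrite e.
    rewrite (bigD1 t) //=; apply: vgtM0 => //; first exact: reduced_small.
    by apply: vge_prod0 => // t' _; exact: vge_reduced.
  move=> le; case/negP: H; have [EU|] := eqVneq (wdeg (enum_val a).2) (wdeg (enum_val b).2); last first.
    by move=> ne; rewrite ltn_neqAle ne leq_sum.
  apply/orP; right; rewrite -(inj_eq enum_val_inj) enum_rankK.
  move: EU E le; case: (enum_val a) (enum_val b) => [i U] [j V] /= /eqP EU E le.
  apply/eqP; congr (_, _); first exact: val_inj.
  apply/ffunP => t; apply: val_inj; apply/eqP; rewrite eq_sym.
  by move: EU; rewrite /wdeg (leqif_sum (fun t _ => leqif_eq (le t))) => /forallP /(_ t).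
- move=> a; rewrite permE blockE shiftS andbb; case: ifP => aS; last first.
    by rewrite /shift aS eqxx oner_neq0 (nu1 vP).
  rewrite /shift aS enum_rankK /reduced_entry /= eqxx mul1r.
  case: (unit_factor0 (enum_val a).1) => u0 vu.
  have [r0 vr] : \prod_t reduced p (X (enum_val a).1 t) ((enum_val a).2 t) ((enum_val a).2 t) != 0 /\
    v (\prod_t reduced p (X (enum_val a).1 t) ((enum_val a).2 t) ((enum_val a).2 t)) = 0.
    apply: (big_ind (fun x => x != 0 /\ v x = 0)) => [|x y [x0 vx] [y0 vy]|t _].
    + by rewrite oner_neq0 (nu1 vP).
    + by rewrite mulf_neq0 // (nuM vP) // vx vy addr0.
    + exact: reduced_diag.
  by rewrite mulf_neq0 // (nuM vP) // vu vr addr0.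
Qed.

Lemma residual_unit :
  \det (block residual_entry) != 0 /\ v (\det (block residual_entry)) = 0.
Proof.
have [e0 ve] := eliminator_unit; have [r0 vr] := reduced_unit.
move: r0 vr; rewrite -eliminator_residual_block det_mulmx mulf_eq0 negb_or => /andP[_ n0].
by rewrite (nuM vP) // ve add0r.
Qed.

(** Scaling row [a] by [eta^w] and column [a] by [eta^(- p w)] makes the minor a unit, and the two
    factors multiply to [ga^(- w)]. *)
Lemma pminor_transfer : pminor M S != 0 /\
  v (pminor M S) = \sum_(a in S) (wdeg (enum_val a).2)%:R * v ga.
Proof.
pose r (a : 'I_#|{: J}|) := eta ^+ wdeg (enum_val a).2.
pose l (a : 'I_#|{: J}|) := (eta ^+ (p * wdeg (enum_val a).2))^-1.
have [d0 vd] : pminor (\matrix_(a, b) (r a * M a b * l b)) S != 0 /\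
     v (pminor (\matrix_(a, b) (r a * M a b * l b)) S) = 0.
  have [n0 vn] := residual_unit; rewrite pminor_block; apply: (cong_unit vP _ n0 vn).
  apply: cong_det => // a b; rewrite mxE blockE; case: ifP => [/andP[aS bS]|_].
    by rewrite mxE; exact: scaled_cong.
  by apply: cong_refl; exact: vge_nat.
move: d0 vd; rewrite pminor_scale mulf_eq0 negb_or => /andP[l0 m0].
rewrite (nuM vP) // => E; split=> //.
have -> : \sum_(a in S) (wdeg (enum_val a).2)%:R * v ga = - v (\prod_(a in S) (r a * l a)).
  suff [_ ->] : \prod_(a in S) (r a * l a) != 0 /\ v (\prod_(a in S) (r a * l a)) =
     \sum_(a in S) - ((wdeg (enum_val a).2)%:R * v ga) by rewrite sumrN opprK.
  apply: (big_ind2 (fun x y => x != 0 /\ v x = y)) => [|x y x' y' [x0 vx] [y0 vy]|a _].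
  + by rewrite oner_neq0 (nu1 vP).
  + by rewrite mulf_neq0 // (nuM vP) // vx vy.
  + rewrite mulf_neq0 ?invr_eq0 ?expf_neq0 // (nuM vP) ?invr_eq0 ?expf_neq0 //.
    rewrite (nuV vP) ?expf_neq0 // !(nuX vP) // vga natrM.
    by rewrite -[in p%:R](prednK (ltnW p1)) -natr1; split=> //; ring.
by move: E; lra.
Qed.

(** The index counts vectors with all coordinates below [wmax], which gives a bound free of [L] and
    [B]. *)
Lemma gauss_norm_transfer cc : (forall w : nat, (w%:R * v ga <= cc) = (w < wmax)%N) ->
  exists2 k, (k <= s * wmax ^ #|T|)%N &
    gauss_norm v (det_series M) cc
      (s%:R * \sum_(U : vec | valid U) Num.min 0 ((wdeg U)%:R * v ga - cc)) k.
Proof.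
move=> wE; exists #|S|.
  pose f (b : 'I_s * {ffun T -> 'I_wmax}) : J :=
    (b.1, [ffun t => inord (b.2 t)]).
  have -> : (s * wmax ^ #|T|)%N = #|{: 'I_s * {ffun T -> 'I_wmax}}|.
    by rewrite card_prod card_ffun !card_ord.
  rewrite -(card_imset _ (@enum_val_inj _ _)); apply: leq_trans (leq_imset_card f _).
  apply: subset_leq_card; apply/subsetP => x /imsetP[a]; rewrite SE => /andP[_ aw] ->.
  have lt t : ((enum_val a).2 t < wmax)%N.
    by apply: leq_ltn_trans aw; rewrite /wdeg (bigD1 t) //= leq_addr.
  apply/imsetP; exists ((enum_val a).1, [ffun t => Ordinal (lt t)]) => //.
  rewrite /f /=; case: (enum_val a) lt => i U lt /=; congr (_, _).
  by apply/ffunP => t; rewrite !ffunE /= inord_val.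
(* The height [cc + 1] puts the vectors that are not [valid] outside the window. *)
pose h (a : 'I_#|{: J}|) := col_height (cc + 1) (enum_val a).
pose l (a : 'I_#|{: J}|) := row_height (enum_val a).
have hl (a : 'I_#|{: J}|) : h a - l a = if valid (enum_val a).2 then (wdeg (enum_val a).2)%:R * v ga else cc + 1.
  rewrite /h /l /col_height /row_height; case: ifP => _; last by rewrite subr0.
  rewrite vga natrM -[in p%:R](prednK (ltnW p1)) -natr1; ring.
have SE' : S = [set a | h a - l a <= cc].
  apply/setP => a; rewrite !inE hl; case: ifP => _; last by rewrite gerDl ler10.
  by rewrite wE.
have [m0 vm] := pminor_transfer.
have sumS F : \sum_(a in S) (h a - l a - F a) = \sum_(a in S) ((wdeg (enum_val a).2)%:R * v ga - F a) :> rat.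
  by apply: eq_bigr => a; rewrite inE hl => /andP[-> _].
have -> : s%:R * \sum_(U : vec | valid U) Num.min 0 ((wdeg U)%:R * v ga - cc) =
    \sum_(a in S) (h a - l a - cc).
  rewrite sumS mulr_natl -{1}[s]card_ord -sumr_const.
  rewrite (pair_big (mem 'I_s) (fun U : vec => valid U)
    (fun (_ : 'I_s) (U : vec) => Num.min 0 ((wdeg U)%:R * v ga - cc))) /=.
  rewrite [RHS](reindex_onto enum_rank enum_val) /=; last by move=> d _; rewrite enum_valK.
  rewrite [RHS](eq_bigl in_window); last by move=> d; rewrite SE !enum_rankK eqxx andbT.
  rewrite big_mkcond [RHS]big_mkcond; apply: eq_bigr => -[i U] _ /=.
  rewrite enum_rankK /in_window /=; case: (valid U) => //=.
  by rewrite -wE -subr_le0; case: leP.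
rewrite SE'; apply: gauss_norm_det => //.
- by move=> a b; exact: vge_transfer_mx.
- by rewrite -SE'.
- by rewrite -SE' vm; have := sumS (fun=> 0); under eq_bigr do rewrite subr0;
    under [RHS]eq_bigr do rewrite subr0.
Qed.

End TransferMinor.

(** * Orthants and Hodge slopes *)

(* (1 - X)^d (1 + X + ... + X^B)^d = (1 - X^(B+1))^d, read through X^i |-> H i. *)
Lemma alternating_orthant_sum (T : finType) (t1 : T) (B d : nat) (H : nat -> rat) :
  #|T| = d.+1 -> (forall i, (B < i)%N -> H i = 0) ->
  \sum_(j < d.+1) (-1) ^+ j * 'C(d, j)%:R *
    (\sum_(f : {ffun T -> 'I_B.+1} | f t1 == 0%N :> nat) H (j + \sum_t f t)%N) = H 0%N.
Proof.
move=> cT HB; pose Lam (P : {poly rat}) := \sum_(i < B.+1) P`_i * H i.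
have LamX i : Lam 'X^i = H i.
  rewrite /Lam; case: (leqP i B) => [iB|Bi]; last first.
    rewrite HB // big1 // => l _; rewrite coefXn ltn_eqF ?mul0r //.
    by apply: leq_ltn_trans Bi; rewrite -ltnS.
  rewrite (bigD1 (inord i)) //= inordK ?ltnS // coefXn eqxx mul1r big1 ?addr0 // => l.
  rewrite -val_eqE /= inordK ?ltnS // => /negPf li; by rewrite coefXn li mul0r.
have LamS (I : finType) (P : pred I) (F : I -> {poly rat}) : Lam (\sum_(i | P i) F i) = \sum_(i | P i) Lam (F i).
  rewrite /Lam exchange_big; apply: eq_bigr => l _.
  by rewrite coef_sum mulr_suml.
have LamZ a P : Lam (a *: P) = a * Lam P.
  by rewrite /Lam mulr_sumr; apply: eq_bigr => l _; rewrite coefZ mulrA.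
pose G : {poly rat} := \sum_(f : {ffun T -> 'I_B.+1} | f t1 == 0%N :> nat) 'X^(\sum_t f t).
have GE : G = (\sum_(x < B.+1) 'X^x) ^+ d.
  transitivity (\prod_(t : T) \sum_(x < B.+1) (((t == t1) ==> (x == 0%N :> nat))%:R * 'X^x : {poly rat})).
    rewrite bigA_distr_bigA /G big_mkcond; apply: eq_bigr => f _.
    rewrite big_split /= prodrXr.
    case: ifP => ft; last by rewrite (bigD1 t1) //= eqxx ft /= !mul0r.
    rewrite [X in _ = X * _]big1 ?mul1r // => t _; case: eqP => [->|//]; by rewrite ft.
  rewrite (bigD1 t1) //= (bigD1 ord0) //= eqxx mul1r big1 ?addr0 ?expr0 ?mul1r; last first.
    by move=> x; rewrite -val_eqE /= => /negPf ->; rewrite mul0r.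
  transitivity (\prod_(t | t != t1) (\sum_(x < B.+1) 'X^x : {poly rat})).
    by apply: eq_bigr => t /negPf ->; apply: eq_bigr => x _; rewrite mul1r.
  by rewrite prodr_const cardC1 cT.
have E : (1 - 'X) ^+ d * G = (1 - 'X^(B.+1)) ^+ d.
  by rewrite GE -exprMn -[1 in RHS](expr1n _ B.+1) subrXX; congr ((_ * _) ^+ _);
    apply: eq_bigr => i _; rewrite expr1n mul1r.
transitivity (Lam ((1 - 'X) ^+ d * G)).
  rewrite exprBn mulr_suml LamS; apply: eq_bigr => j _.
  have -> : ((-1) ^+ j * 1 ^+ (d - j) * 'X^j *+ 'C(d, j)) * G =
     ((-1) ^+ j * 'C(d, j)%:R) *: \sum_(f : {ffun T -> 'I_B.+1} | f t1 == 0%N :> nat) 'X^(j + \sum_t f t).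
    rewrite expr1n mulr1 -mulr_natr -mul_polyC polyCM rmorphXn rmorphN rmorph1 rmorph_nat /=.
    rewrite /G !mulr_sumr; apply: eq_bigr => f _; rewrite exprD; ring.
  by rewrite LamZ LamS; congr (_ * _); apply: eq_bigr => f _.
rewrite E; have [r ->] : exists r, (1 - 'X^(B.+1)) ^+ d = 1 + 'X^(B.+1) * r :> {poly rat}.
  elim: (d) => [|e [r IHe]]; first by exists 0; rewrite expr0 mulr0 addr0.
  by exists (r - 1 - 'X^(B.+1) * r); rewrite exprS IHe; ring.
rewrite /Lam big_ord_recl big1 ?addr0 => [|i _].
  by rewrite coefD coefXnM coef1 /= addr0 mul1r.
by rewrite coefD coefXnM coef1 ltn_ord /= addr0 mul0r.
Qed.

Section Orthants.
Variables (n m p B : nat) (a b : nat -> nat) (i0 : 'I_n).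
Hypothesis q0 : (0 < p.-1)%N.
Hypothesis aq : forall i, (i < n)%N -> (a i < p.-1)%N.
Hypothesis bq : forall j, (j < m)%N -> (b j < p.-1)%N.
Hypothesis a_mono : forall i j, (i <= j)%N -> (j < n)%N -> (a i <= a j)%N.

Local Notation q := p.-1.
Local Notation T := ('I_n + 'I_m)%type.
Local Notation vec := {ffun T -> 'I_B.+1}.
Local Notation c := (@char_exponents p n m a b).
Local Notation valid := (valid (@is_inl 'I_n 'I_m) (inl i0) p c).

(** The residues modulo [q] of [a k - a i] and of [b j - a k]. For [k < i] a zero residue is
    represented by [q], because [last_zero] forbids further zeros after [k]. *)
Definition corner (k : 'I_n) (t : T) : nat := match t with
  | inl i => (a k + q * (k < i)%N - a i)%N
  | inr j => (b j + q * (b j < a k)%N - a k)%N end.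

(** Taking the last vanishing coordinate makes the orthants disjoint. *)
Definition last_zero (k : 'I_n) (U : vec) :=
  (U (inl k) == 0%N :> nat) && [forall i : 'I_n, (k < i)%N ==> (U (inl i) != 0%N :> nat)].

Lemma cornerE k t : exists z : int,
  (corner k t)%:Z + (c t)%:Z = sgv (@is_inl 'I_n 'I_m) t * (a k)%:Z + q%:Z * z.
Proof.
case: t => [i|j] /=; rewrite /sgv /=.
  exists (k < i)%N%:Z; have := aq (ltn_ord i).
  case: (leqP i k) => [/a_mono /(_ (ltn_ord k))|]; rewrite /= ?muln0 ?muln1; lia.
exists ((b j < a k)%N%:Z + 1); have := aq (ltn_ord k); have := bq (ltn_ord j).
case: leqP; rewrite /= ?muln0 ?muln1; lia.
Qed.

Lemma corner_self k : corner k (inl k) = 0%N.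
Proof. by rewrite /= ltnn muln0 addn0 subnn. Qed.

Lemma corner_le k t : (corner k t <= q)%N.
Proof.
case: t => [i|j] /=.
  have := aq (ltn_ord i); have := aq (ltn_ord k).
  case: (leqP i k) => [/a_mono /(_ (ltn_ord k))|/ltnW /a_mono /(_ (ltn_ord i))];
    rewrite /= ?muln0 ?muln1; lia.
have := aq (ltn_ord k); have := bq (ltn_ord j).
case: leqP; rewrite /= ?muln0 ?muln1; lia.
Qed.

Lemma corner_eq_q k t : corner k t = q -> exists2 i : 'I_n, t = inl i & (k < i)%N.
Proof.
case: t => [i|j] /=.
  have := aq (ltn_ord i); have := aq (ltn_ord k).
  case: (leqP i k) => [/a_mono /(_ (ltn_ord k))|ki]; last by exists i.
  by rewrite /= ?muln0; lia.
have := aq (ltn_ord k); have := bq (ltn_ord j).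
case: leqP; rewrite /= ?muln0 ?muln1; lia.
Qed.

Definition cell (k : 'I_n) (U : vec) : vec := [ffun t => inord ((U t - corner k t) %/ q)].
Definition from_cell (k : 'I_n) (f : vec) : vec := [ffun t => inord (corner k t + q * f t)].

Lemma cell_eq k U : valid U -> last_zero k U ->
  forall t, (U t = corner k t + q * cell k U t :> nat)%N.
Proof.
move=> /andP[_ /forallP H] /andP[/eqP Uk /forallP kl] t.
have /dvdzP[x xE] := H t; have /dvdzP[y yE] := H (inl k).
have [z zE] := cornerE k t.
have E : (U t)%:Z - (corner k t)%:Z = q%:Z * (x - sgv (@is_inl 'I_n 'I_m) t * y - z).
  move: xE yE zE; rewrite !PoszD Uk {2}/sgv /=; move: (sgv _ t) (Posz q) => e r.
  move=> xE yE zE.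
  have -> : (U t)%:Z - (corner k t)%:Z = ((U t)%:Z + (c t)%:Z) - ((corner k t)%:Z + (c t)%:Z) by ring.
  rewrite zE; have -> : (U t)%:Z + (c t)%:Z = x * r + e * ((U (inl i0))%:Z + (a i0)%:Z).
    by rewrite -xE; ring.
  have -> : (U (inl i0))%:Z + (a i0)%:Z = (a k)%:Z - y * r by rewrite -yE; ring.
  by ring.
(* A coordinate below its corner would lie at least [q] below it. As corners are at most [q], the
   coordinate would be 0 with corner [q], which [last_zero] excludes. *)
have le : (corner k t <= U t)%N.
  rewrite leqNgt; apply/negP => lt.
  have cq := corner_le k t.
  have Uq : (corner k t = q /\ U t = 0%N :> nat).
    move: E; set w := (x - _ - z) => E; have w1 : w = -1 by move: lt cq q0 E; clear; nia.
    by move: E; rewrite w1; split; lia.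
  have [i ti ki] := corner_eq_q (proj1 Uq).
  by have /implyP /(_ ki) := kl i; rewrite -ti (proj2 Uq).
rewrite ffunE inordK; last by rewrite ltnS (leq_trans (leq_div _ _)) // (leq_trans (leq_subr _ _)) // -ltnS.
rewrite mulnC divnK ?subnKC //.
move: E le q0; set w := (x - _ - z); move=> E le q0'.
have w0 : 0 <= w by clear -E le q0'; nia.
apply/dvdnP; exists (absz w); move: E; rewrite -{1}(gez0_abs w0); move: (absz w) => u E.
by have -> : (U t = corner k t + q * u :> nat)%N by [clear -E; lia]; rewrite addKn mulnC.
Qed.

Lemma valid_from_cell k (U f : vec) : f (inl k) = 0%N :> nat ->
  (forall t, (U t = corner k t + q * f t :> nat)%N) -> valid U && last_zero k U.
Proof.
move=> fk UE; have Uk : U (inl k) = 0%N :> nat by rewrite UE corner_self fk muln0.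
rewrite /last_zero Uk eqxx /=; apply/andP; split.
  apply/andP; split; first by apply/existsP; exists (inl k); rewrite Uk eqxx.
  apply/forallP => t; have [z zE] := cornerE k t; have [z' zE'] := cornerE k (inl i0).
  apply/dvdzP; exists (z + (f t)%:Z - sgv (@is_inl 'I_n 'I_m) t * (z' + (f (inl i0))%:Z)).
  rewrite !UE !PoszD !PoszM; move: zE zE'; rewrite {2}/sgv /=.
  set e := sgv _ t; set ct := (c t)%:Z; set r := Posz q => zE zE'.
  transitivity (((corner k t)%:Z + ct) + r * (f t)%:Z -
    e * (((corner k (inl i0))%:Z + (a i0)%:Z) + r * (f (inl i0))%:Z)); first by rewrite /=; ring.
  by rewrite zE zE'; ring.
apply/forallP => i; apply/implyP => ki; rewrite UE /= ki muln1 -lt0n.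
have := aq (ltn_ord i); lia.
Qed.

Lemma last_zero_unique (U : vec) : valid U -> \sum_k (last_zero k U)%:R = 1 :> rat.
Proof.
move=> /andP[/existsP[[i|j] //= /eqP Ui] _].
rewrite (@sum_unique_pred _ _ (fun k => last_zero k U) true) // => [k l|].
  move=> /andP[Uk /forallP kl] /andP[Ul /forallP ll]; apply: val_inj; apply/eqP.
  rewrite eqn_leq; apply/andP; split; rewrite leqNgt; apply/negP => h.
    by have := ll k; rewrite h Uk.
  by have := kl l; rewrite h Ul.
split=> // _; case: (@arg_maxnP _ i (fun k : 'I_n => U (inl k) == 0%N :> nat) (fun k => k : nat)).
  by rewrite /= Ui.
move=> k /= Uk km; exists k; rewrite /last_zero Uk /=.
apply/forallP => l; apply/implyP => kl; apply: contraTN kl => /km; by rewrite -leqNgt.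
Qed.

(** Both sides run over boxes cut at [B], which do not correspond; the difference is invisible
    because [F] vanishes on weights above [B]. *)
Lemma orthant_sum (F : nat -> rat) : (forall w, (B < w)%N -> F w = 0) ->
  \sum_(U : vec | valid U) F (wdeg U) =
  \sum_(k < n) \sum_(f : vec | f (inl k) == 0%N :> nat) F (\sum_t corner k t + q * \sum_t f t)%N.
Proof.
move=> FB.
transitivity (\sum_(k < n) \sum_(U : vec | valid U) (last_zero k U)%:R * F (wdeg U)).
  rewrite exchange_big /=; apply: eq_bigr => U vU.
  by rewrite -mulr_suml last_zero_unique // mul1r.
apply: eq_bigr => k _.
have degE (U f : vec) : (forall t, (U t = corner k t + q * f t :> nat)%N) ->
    wdeg U = (\sum_t corner k t + q * \sum_t f t)%N.
  by move=> UE; rewrite /wdeg big_distrr -big_split /=; apply: eq_bigr => t _; exact: UE.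
transitivity (\sum_(U : vec | [&& valid U, last_zero k U & (wdeg U <= B)%N]) F (wdeg U)).
  rewrite big_mkcond [RHS]big_mkcond; apply: eq_bigr => U _.
  case: (valid U) => //=; case: (last_zero k U) => /=; rewrite ?mul0r ?mul1r //.
  by case: leqP => // /FB.
rewrite (reindex_onto (from_cell k) (cell k)) /=; last first.
  move=> U /and3P[vU lU _]; apply/ffunP => t; apply: val_inj.
  by rewrite ffunE -cell_eq // inord_val.
rewrite big_mkcond [RHS]big_mkcond; apply: eq_bigr => f _.
case: ifP => [/andP[/and3P[vU lU _] /eqP cf]|H].
  have UE := cell_eq vU lU; rewrite cf in UE.
  have fk : f (inl k) = 0%N :> nat.
    have := UE (inl k); rewrite corner_self add0n; case/andP: lU => /eqP -> _ /esym/eqP.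
    by rewrite muln_eq0 eqn0Ngt q0 => /eqP.
  by rewrite fk eqxx (degE _ _ UE).
case: eqP => // fk; apply/esym/FB; rewrite ltnNge; apply/negP => le.
have lt t : (corner k t + q * f t < B.+1)%N.
  rewrite ltnS; apply: leq_trans le; rewrite big_distrr -big_split /= (bigD1 t) //=.
  exact: leq_addr.
have UE t : (from_cell k f t = corner k t + q * f t :> nat)%N by rewrite ffunE inordK.
have /andP[vU lU] := valid_from_cell fk UE.
case/negP: H; rewrite vU lU (degE _ _ UE) le /=; apply/eqP/ffunP => t; apply: val_inj.
have := cell_eq vU lU t; rewrite UE => /eqP; rewrite eqn_add2l eqn_pmul2l // => /eqP.
by move=> /esym.
Qed.

(** The wrap-arounds of the residues are the counting terms of [theta]: [k < i] yields [n - k.+1]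
    and [b j < a k] the count over [B']. The shift is due to [theta] counting from 1. *)
Lemma theta_corner (s : nat) (A B' : seq nat) (k : 'I_n) : (m <= n)%N -> (0 < s)%N ->
  size A = n -> size B' = m ->
  (forall i, (i < n)%N -> nth 0%N A i = (a i * geom p s)%N) ->
  (forall j, (j < m)%N -> nth 0%N B' j = (b j * geom p s)%N) ->
  theta (p ^ s) n m A B' k.+1 = (\sum_t corner k t)%:R / q%:R.
Proof.
move=> mn s0 sA sB AE BE.
have p1 : (1 < p)%N by rewrite -ltn_predRL.
have qE : ((p ^ s).-1 = q * geom p s)%N by rewrite /geom predn_exp.
have q0r : (q%:R : rat) != 0 by rewrite pnatr_eq0 -lt0n.
have cst N (x : rat) : N%:R * x = \sum_(i < N) x by rewrite sumr_const card_ord mulr_natl.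
have g0 : (geom p s)%:R != 0 :> rat.
  rewrite pnatr_eq0 -lt0n; case: (s) s0 => // s' _.
  by rewrite /geom big_ord_recl expn0.
have frac x : (x * geom p s)%:R / (p ^ s).-1%:R = x%:R / q%:R :> rat.
  by rewrite qE !natrM; field; rewrite q0r g0.
rewrite /theta /= AE // frac.
have -> : count (fun e => e%:R / (p ^ s).-1%:R < (a k)%:R / q%:R :> rat) B' =
    (\sum_(j < m) (b j < a k))%N.
  rewrite -sum1_count (big_nth 0%N) sB big_mkord big_mkcond; apply: eq_bigr => j _ /=.
  rewrite BE // frac ltr_pM2r ?invr_gt0 ?ltr0n // ltr_nat.
  by case: (_ < _)%N.
have -> : \sum_(e <- A) (e%:R / (p ^ s).-1%:R) = \sum_(i < n) ((a i)%:R / q%:R) :> rat.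
  by rewrite (big_nth 0%N) sA big_mkord; apply: eq_bigr => i _; rewrite AE.
have -> : \sum_(e <- B') (e%:R / (p ^ s).-1%:R) = \sum_(j < m) ((b j)%:R / q%:R) :> rat.
  by rewrite (big_nth 0%N) sB big_mkord; apply: eq_bigr => i _; rewrite BE.
rewrite big_sumType /= natrD !natr_sum mulrDl !mulr_suml.
have -> : \sum_(i < n) ((a k + q * (k < i)%N - a i)%:R / q%:R) =
    n%:R * ((a k)%:R / q%:R) + (n - k.+1)%:R - \sum_(i < n) ((a i)%:R / q%:R) :> rat.
  have -> : (n - k.+1)%:R = \sum_(i < n) (k < i)%N%:R :> rat.
    rewrite -natr_sum; congr _%:R; rewrite -(big_mkord xpredT (fun i => (k < i)%N : nat)).
    rewrite (@big_cat_nat _ _ _ k.+1) //= big_nat big1 ?add0n => [|i /andP[_]]; last first.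
      by rewrite ltnS ltnNge => ->.
    rewrite big_nat (eq_bigr (fun=> 1%N)) => [|i /andP[-> _]] //.
    by rewrite -big_nat sum_nat_const_nat muln1.
  rewrite cst -big_split -sumrB /=.
  apply: eq_bigr => i _; rewrite natrB ?natrD ?natrM; first by field.
  case: (leqP i k) => [ik|_]; first by rewrite muln0 addn0 a_mono.
  by rewrite muln1 (leq_trans (ltnW (aq (ltn_ord i)))) // leq_addl.
have -> : \sum_(j < m) ((b j + q * (b j < a k)%N - a k)%:R / q%:R) =
    \sum_(j < m) ((b j)%:R / q%:R) + (\sum_(j < m) (b j < a k))%N%:R - m%:R * ((a k)%:R / q%:R) :> rat.
  rewrite cst natr_sum -big_split -sumrB /=.
  apply: eq_bigr => j _; rewrite natrB ?natrD ?natrM; first by field.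
  case: (leqP (a k) (b j)) => [|_]; first by rewrite muln0 addn0.
  by rewrite muln1 (leq_trans (ltnW (aq (ltn_ord k)))) // leq_addl.
rewrite [in (n - m)%:R]natrB // natr_sum; ring.
Qed.

(** A unit step inside an orthant adds [q] to the weight, hence 1 after division, exactly like one
    factor [p] of [p^j]; so [alternating_orthant_sum] applies to each orthant. *)
Lemma alternating_valid_sum d (sigma : rat) : (n + m)%N = d.+1 -> q%:R * sigma <= B%:R ->
  \sum_(j < d.+1) (-1) ^+ j * 'C(d, j)%:R *
    (\sum_(U : vec | valid U) Num.min 0 ((wdeg U)%:R / q%:R + j%:R - sigma)) =
  \sum_(k < n) Num.min 0 ((\sum_t corner k t)%:R / q%:R - sigma).
Proof.
move=> nm sB; have q0r : (0 : rat) < q%:R by rewrite ltr0n.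
have q1r : (1 : rat) <= q%:R by rewrite ler1n.
have big w j : (B < w)%N -> Num.min 0 (w%:R / q%:R + j%:R - sigma) = 0 :> rat.
  move=> Bw; apply/min_idPl; have j0 : (0 : rat) <= j%:R by rewrite ler0n.
  suff : sigma <= w%:R / q%:R by lra.
  rewrite ler_pdivlMr // mulrC (le_trans sB) // ler_nat ltnW //.
under eq_bigr => j _ do rewrite (orthant_sum (fun w h => big w j h)) mulr_sumr.
rewrite exchange_big; apply: eq_bigr => k _ /=.
pose H i := Num.min 0 ((\sum_t corner k t)%:R / q%:R - sigma + i%:R) : rat.
have -> : Num.min 0 ((\sum_t corner k t)%:R / q%:R - sigma) = H 0%N by rewrite /H addr0.
rewrite -(@alternating_orthant_sum ('I_n + 'I_m)%type (inl k) B d H); last first.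
- move=> i Bi; apply/min_idPl.
  have c0 : 0 <= (\sum_t corner k t)%:R / q%:R :> rat by rewrite divr_ge0 ?ler0n.
  suff : sigma <= i%:R by lra.
  have Bi' : (B%:R : rat) <= i%:R by rewrite ler_nat ltnW.
  have [s0|s0] := lerP sigma 0; first by apply: le_trans s0 _; rewrite ler0n.
  apply: le_trans Bi'; apply: le_trans sB; rewrite -[leLHS]mul1r ler_wpM2r // ltW //.
- by rewrite card_sum !card_ord.
apply: eq_bigr => j _; congr (_ * _); apply: eq_bigr => f _; congr Num.min.
by rewrite !natrD natrM; field; rewrite gt_eqF.
Qed.

End Orthants.

Lemma separation (x : rat) (r : seq rat) :
  exists2 e, 0 < e & forall y, y \in r -> y != x -> e <= `|y - x|.
Proof.
elim: r => [|z r [e e0 IHr]]; first by exists 1.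
have [->|zx] := eqVneq z x.
  by exists e => // y; rewrite inE => /orP[/eqP ->|/IHr //]; rewrite eqxx.
exists (Num.min e `|z - x|); first by rewrite lt_min e0 normr_gt0 subr_eq0.
move=> y; rewrite inE ge_min => /orP[/eqP -> _|/IHr h /h -> //].
by rewrite lexx orbT.
Qed.

(* The second difference in sigma at x detects the multiplicity of x. *)
Lemma perm_eq_min_sums (r r' : seq rat) :
  (forall sigma, \sum_(x <- r) Num.min 0 (x - sigma) = \sum_(x <- r') Num.min 0 (x - sigma)) ->
  perm_eq r r'.
Proof.
move=> H; apply/allP => x _ /=.
have [e e0 sep] := separation x (r ++ r').
have count_of s : (forall y, y \in s -> y != x -> e <= `|y - x|) ->
    \sum_(y <- s) Num.min 0 (y - (x + e)) + \sum_(y <- s) Num.min 0 (y - (x - e)) -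
    2%:R * \sum_(y <- s) Num.min 0 (y - x) = - e * (count_mem x s)%:R.
  elim: s => [|z s IHs] sep'; first by rewrite !big_nil /=; ring.
  have sub y : y \in s -> y \in z :: s by rewrite inE orbC => ->.
  rewrite !big_cons /= natrD; move: (IHs (fun y ys => sep' y (sub y ys))).
  have [->|zx] := eqVneq z x.
    by rewrite /= ?mulr1n ?mulr0n !minEle; do ?[case: leP => ?]; lra.
  have := sep' z (mem_head _ _) zx; case: (ltrgt0P (z - x)) => ? ?; last 1 first.
  - by rewrite /= ?mulr0n; lra.
  - by rewrite /= ?mulr1n ?mulr0n !minEle; do ?[case: leP => ?]; lra.
  - by rewrite /= ?mulr1n ?mulr0n !minEle; do ?[case: leP => ?]; lra.
have in1 y : y \in r -> y \in r ++ r' by rewrite mem_cat => ->.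
have in2 y : y \in r' -> y \in r ++ r' by rewrite mem_cat orbC => ->.
have E : - e * (count_mem x r)%:R = - e * (count_mem x r')%:R.
  rewrite -(count_of r (fun y ys => sep y (in1 y ys))).
  by rewrite -(count_of r' (fun y ys => sep y (in2 y ys))) !H.
have en0 : - e != 0 by rewrite oppr_eq0 gt_eqF.
by move/(mulfI en0)/eqP: E; rewrite eqr_nat.
Qed.

(** * Comparison of Newton polygons *)

Section Comparison.
Variables (Om : fieldType) (v : Om -> rat) (p : nat).
Hypotheses (vP : is_valuation v) (pn0 : (p%:R : Om) != 0).
Hypothesis char0 : forall k, (0 < k)%N -> (k%:R : Om) != 0.

Lemma nu_fact_mono i j : (i <= j)%N -> v i`!%:R <= v j`!%:R.
Proof.
move=> ij; have := ffact_fact (leq_subr i j); rewrite subKn // => <-.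
rewrite natrM (nuM vP) ?char0 ?fact_gt0 ?ffact_gt0 ?leq_subr // lerDr.
case: (vge_nat vP (j ^_ (j - i))) => // /eqP.
by rewrite (negPf (char0 _)) // ffact_gt0 leq_subr.
Qed.

Lemma integral_polyM (f g : {poly Om}) : (forall i, val_ge v f`_i 0) ->
  (forall i, val_ge v g`_i 0) -> forall i, val_ge v (f * g)`_i 0.
Proof. by move=> f0 g0 i; rewrite coefM; apply: vge_sum => // j _; apply: vgeM0. Qed.

Lemma coef0_det_series n (M : 'M[Om]_n) : (det_series M)`_0 = 1.
Proof.
rewrite coef_det_series expr0 mul1r (big_pred1 set0) => [|S]; last by rewrite cards_eq0.
have -> : pminor M set0 = \det (1%:M : 'M[Om]_n).
  by congr (\det _); apply/matrixP => i j; rewrite !mxE inE.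
by rewrite det1.
Qed.

Lemma integral_det_series n (M : 'M[Om]_n) : (forall i j, val_ge v (M i j) 0) ->
  forall i, val_ge v (det_series M)`_i 0.
Proof.
move=> Mi i; rewrite coef_det_series -signr_odd mulr_sign.
have h : val_ge v (\sum_(S : {set 'I_n} | #|S| == i) pminor M S) 0.
  apply: vge_sum => // S _; rewrite -[0](_ : \sum_(j in S) (0 - 0) = 0 :> rat).
    by apply: (@vge_pminor _ _ vP _ M (fun=> 0) (fun=> 0)) => j l; rewrite subr0.
  by rewrite big1 // subr0.
by case: ifP => // _; apply/vgeN.
Qed.

Lemma integral_mxX n (M : 'M[Om]_n) i : (forall i j, val_ge v (M i j) 0) ->
  forall a b, val_ge v ((M ^+ i) a b) 0.
Proof.
move=> Mi; elim: i => [|i IHi] a b; first by rewrite expr0 mxE; exact: vge_nat.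
by rewrite exprS mxE; apply: vge_sum => // j _; apply: vgeM0.
Qed.

(** [K] bounds the last indices on both sides of the comparison. At those indices coefficients have
    valuation at most [K |c|], which stays below the precision left after Newton's identities. *)
Lemma compare_norms N (M : 'M[Om]_N) (gamma : seq Om) (s d : nat) (c C : rat)
    (Nj : 'I_d.+1 -> rat) (kj : 'I_d.+1 -> nat) (K : nat) :
  (0 < s)%N -> all (fun g => g != 0) gamma -> (forall a b, val_ge v (M a b) 0) ->
  0 <= C ->
  (forall r, (0 < r)%N -> val_ge v ((if (s %| r)%N then s%:R * \sum_(g <- gamma) g ^+ (r %/ s) else 0)
     - (1 - p%:R ^+ r) ^+ d * \tr (M ^+ r)) C) ->
  (forall j : 'I_d.+1, gauss_norm v (det_series M) (c - j%:R * v p%:R) (Nj j) (kj j)) ->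
  (forall j, Nj j <= 0) ->
  (s * size gamma + \sum_(j < d.+1) 'C(d, j) * kj j <= K)%N ->
  K%:R * `|c| < C - v K`!%:R ->
  \sum_(g <- gamma) Num.min 0 (v g - s%:R * c) = \sum_(j < d.+1) (-1) ^+ j * 'C(d, j)%:R * Nj j.
Proof.
move=> s0 gam0 Mi C0 close MN Nj0 Kb KC.
pose D j := det_series (p%:R ^+ j *: M).
(* The alternating product is a quotient; moving the factors of odd [j] to the side of [F] leaves an
   identity between polynomials. *)
pose half (b : bool) : {poly Om} := \prod_(j < d.+1 | odd j == b) D j ^+ 'C(d, j).
pose F := \prod_(g <- gamma) (1 - g *: 'X^s).
have pj0 j : (p%:R : Om) ^+ j != 0 by rewrite expf_neq0.
have DN (j : 'I_d.+1) : gauss_norm v (D j) c (Nj j) (kj j).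
  apply: (gauss_norm_scale vP (pj0 j) (coef_det_seriesZ _ _)).
  by rewrite (nuX vP).
have halfN b : gauss_norm v (half b) c (\sum_(j < d.+1 | odd j == b) 'C(d, j)%:R * Nj j)
    (\sum_(j < d.+1 | odd j == b) 'C(d, j) * kj j)%N.
  apply: (@gauss_norm_prod _ v vP 'I_d.+1 _ (fun j => odd j == b) (fun j => D j ^+ 'C(d, j)) c
    (fun j => 'C(d, j)%:R * Nj j) (fun j => 'C(d, j) * kj j)%N) => j _.
  exact: gauss_normX (DN j).
pose kF := (\sum_(g <- gamma) if (v g <= s%:R * c)%R then s else 0)%N.
have FN : gauss_norm v F c (\sum_(g <- gamma) Num.min 0 (v g - s%:R * c)) kF.
  rewrite /F /kF; elim: (gamma) gam0 => [_|g l IHl /= /andP[g0 /IHl h]].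
    by rewrite !big_nil; exact: gauss_norm1.
  by rewrite !big_cons; exact: (gauss_normM vP (gauss_norm_binomial vP _ s0 g0) h).
have kFb : (kF <= s * size gamma)%N.
  rewrite /kF; elim: (gamma) => [|g l IHl]; first by rewrite big_nil.
  by rewrite big_cons mulnS leq_add //; case: ifP.
have f0 : (F * half true)`_0 = (half false)`_0.
  have h0 b : (half b)`_0 = 1.
    rewrite -horner_coef0 horner_prod big1 // => j _.
    by rewrite horner_exp horner_coef0 coef0_det_series expr1n.
  rewrite coef0M !h0 mulr1 -horner_coef0 horner_prod big1 // => g _.
  by rewrite !hornerE expr0n eqn0Ngt s0 mulr0 subr0.
have psF : power_sums F (fun r => if (s %| r)%N then s%:R * \sum_(g <- gamma) g ^+ (r %/ s) else 0).
  apply: eq_power_sums (power_sums_prod _ (fun g _ => power_sums_binomial g s0)) => r r0.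
  by case: ifP => _; rewrite ?mulr_sumr // big1.
have psH b : power_sums (half b) (fun r => \sum_(j < d.+1 | odd j == b)
     'C(d, j)%:R * \tr ((p%:R ^+ j *: M) ^+ r)).
  by apply: power_sums_prod => j _; apply: power_sumsX; exact: power_sums_det.
have Mji j : forall a b, val_ge v ((p%:R ^+ j *: M) a b) 0.
  by move=> a b; rewrite mxE mulrC; apply: vgeM0 => //; apply: vgeX0 => //; exact: vge_nat.
have halfi b i : val_ge v (half b)`_i 0.
  apply: (big_ind (fun f : {poly Om} => forall i, val_ge v f`_i 0)) i.
  - by move=> i; rewrite coef1; exact: vge_nat.
  - exact: integral_polyM.
  move=> j _; elim: 'C(d, j) => [|e IHe].
    by move=> i; rewrite expr0 coef1; exact: vge_nat.
  by rewrite exprS; apply: integral_polyM => //; exact: integral_det_series.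
have pwi b r : val_ge v (\sum_(j < d.+1 | odd j == b) 'C(d, j)%:R * \tr ((p%:R ^+ j *: M) ^+ r)) 0.
  apply: vge_sum => // j _; apply: vgeM0 => //; first exact: vge_nat.
  by apply: vge_sum => // i _; exact: integral_mxX.
have trZ j r : \tr ((p%:R ^+ j *: M) ^+ r) = (p%:R ^+ r) ^+ j * \tr (M ^+ r).
  have -> : (p%:R ^+ j *: M) ^+ r = (p%:R ^+ j) ^+ r *: M ^+ r.
    elim: r => [|r IHr]; first by rewrite !expr0 scale1r.
    by rewrite !exprS IHr -[_ * _]scalemxAl -scalemxAr scalerA.
  by rewrite mxtraceZ -!exprM mulnC.
have binE r : (1 - p%:R ^+ r) ^+ d * \tr (M ^+ r) =
     \sum_(j < d.+1 | odd j == false) 'C(d, j)%:R * \tr ((p%:R ^+ j *: M) ^+ r) -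
     \sum_(j < d.+1 | odd j == true) 'C(d, j)%:R * \tr ((p%:R ^+ j *: M) ^+ r).
  rewrite exprBn mulr_suml (bigID (fun j : 'I_d.+1 => odd j == false)) /= -sumrN.
  congr (_ + _).
    apply: eq_bigr => j /eqP oj; rewrite trZ -signr_odd oj expr0 expr1n !mul1r.
    by rewrite -mulr_natl mulrA.
  apply: eq_big => [j|j]; first by case: (odd j).
  rewrite eqbF_neg negbK => oj; rewrite trZ -signr_odd oj expr1 expr1n mulr1 mulN1r.
  by rewrite -[in LHS]mulr_natl; ring.
have closeP r : (0 < r)%N -> val_ge v
   ((if (s %| r)%N then s%:R * \sum_(g <- gamma) g ^+ (r %/ s) else 0) +
     \sum_(j < d.+1 | odd j == true) 'C(d, j)%:R * \tr ((p%:R ^+ j *: M) ^+ r) -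
     \sum_(j < d.+1 | odd j == false) 'C(d, j)%:R * \tr ((p%:R ^+ j *: M) ^+ r)) C.
  by move=> /close; rewrite binE opprB -addrA.
have KP i : (i <= K)%N -> val_ge v ((F * half true)`_i - (half false)`_i) (C - v K`!%:R).
  move=> iK; apply: vgeW (close_power_sums vP char0 f0 (power_sumsM psF (psH true)) (psH false)
    _ _ _ iK).
  - by rewrite lerB // nu_fact_mono.
  - move=> r /andP[r0 _]; rewrite -[X in val_ge v X](subrK (\sum_(j < d.+1 | odd j == false)
      'C(d, j)%:R * \tr ((p%:R ^+ j *: M) ^+ r))); apply: vgeD => //.
    by apply: vgeW C0 _; exact: closeP.
  - by move=> r _; exact: halfi.
  - by move=> r /andP[r0 _]; exact: closeP.
have sumj_le b : (\sum_(j < d.+1 | odd j == b) 'C(d, j) * kj j <= \sum_(j < d.+1) 'C(d, j) * kj j)%N.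
  by rewrite [X in (_ <= X)%N](bigID (fun j : 'I_d.+1 => odd j == b)) leq_addr.
have kc k : (k <= K)%N -> k%:R * c < C - v K`!%:R.
  move=> kK; apply: le_lt_trans KC; apply: le_trans (ler_norm _) _.
  by rewrite normrM normr_nat ler_wpM2r // ler_nat.
have FtN := gauss_normM vP FN (halfN true).
have k1 : (kF + \sum_(j < d.+1 | odd j == true) 'C(d, j) * kj j <= K)%N.
  by apply: leq_trans Kb; apply: leq_add.
have k2 : (\sum_(j < d.+1 | odd j == false) 'C(d, j) * kj j <= K)%N.
  by apply: leq_trans Kb; apply: leq_trans (sumj_le false) _; exact: leq_addl.
have NjC b : \sum_(j < d.+1 | odd j == b) 'C(d, j)%:R * Nj j <= 0.
  by apply: sumr_le0 => j _; rewrite mulr_ge0_le0 ?ler0n.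
have FC : \sum_(g <- gamma) Num.min 0 (v g - s%:R * c) <= 0.
  by apply: sumr_le0 => g _; rewrite ge_min lexx.
have b1 := kc _ k1; have b2 := kc _ k2; have c1 := NjC true; have c2 := NjC false.
have E : \sum_(g <- gamma) Num.min 0 (v g - s%:R * c) +
    \sum_(j < d.+1 | odd j == true) 'C(d, j)%:R * Nj j =
    \sum_(j < d.+1 | odd j == false) 'C(d, j)%:R * Nj j.
  by apply: (gauss_norm_close vP FtN (halfN false) _ _ (KP _ k1) (KP _ k2)); lra.
have signed b : \sum_(j < d.+1 | odd j == b) (-1) ^+ j * 'C(d, j)%:R * Nj j =
    (-1) ^+ b * \sum_(j < d.+1 | odd j == b) 'C(d, j)%:R * Nj j.
  by rewrite mulr_sumr; apply: eq_bigr => j /eqP oj; rewrite -signr_odd oj mulrA.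
rewrite [RHS](bigID (fun j : 'I_d.+1 => odd j == true)) /= signed expr1.
rewrite (eq_bigl (fun j : 'I_d.+1 => odd j == false)) => [|j]; last by case: (odd j).
by rewrite signed -E expr0; ring.
Qed.

End Comparison.

Section HypTrace.
Variables (Om : closedFieldType) (v : Om -> rat) (p s : nat) (pi psi1 : Om).
Hypotheses (vP : is_valuation v) (p_pr : prime p).
Hypotheses (pn0 : (p%:R : Om) != 0) (vp : 0 < v p%:R).
Hypotheses (piE : dwork_pi p pi) (psiE : dwork_psi v p pi psi1).
Variables (k : finFieldType) (om : k -> Om).
Hypotheses (s0 : (0 < s)%N) (cardk : #|k| = (p ^ s)%N) (omP : teichmuller v om).
Variables (D : nat) (ga : Om).
Hypotheses (D0 : (0 < D)%N) (gaE : (logAH Om p D).[ga] = 0)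
  (gapi : val_ge v (ga - pi) (2%:R * v pi)).
Variables (n m : nat) (A B : seq nat) (a' b' : nat -> nat) (i0 : 'I_n).
Hypotheses (AE : forall i, (i < n)%N -> nth 0%N A i = (a' i * geom p s)%N)
  (BE : forall i, (i < m)%N -> nth 0%N B i = (b' i * geom p s)%N)
  (b'p : forall i, (i < m)%N -> (b' i <= p.-1)%N).
Variables (a : k) (a0 : a != 0).

Local Notation T := ('I_n + 'I_m)%type.
Local Notation sg := (@is_inl 'I_n 'I_m).
Local Notation M := (transfer_mx p (@ah_weight _ p D ga n m (om (-1))) sg (inl i0) (2 * D) s
  (char_exponents p a' b') (om a)).

Lemma om_fixed : om a ^+ (p ^ s) = om a.
Proof. by rewrite -(omX omP) -cardk expf_card. Qed.

Lemma hyp_trace (L : finFieldType) (io : {rmorphism k -> L}) (r d : nat) :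
  let C := D.+1%:R * (v pi / 2%:R) - p.-1%:R * v pi in 0 <= C ->
  (0 < r)%N -> #|L| = (p ^ (s * r))%N -> (n + m)%N = d.+1 ->
  val_ge v (s%:R * ((-1) ^+ d * Hyp io p s r n m psi1 om A B a) -
    (1 - p%:R ^+ (s * r)) ^+ d * \tr (M ^+ (s * r))) C.
Proof.
move=> C C0 r0 cardL nm.
have R0 : (0 < s * r)%N by rewrite muln_gt0 s0.
have p1 := prime_gt1 p_pr.
have cop : coprime p #|L|.-1.
  by rewrite cardL -(coprime_pexpl _ _ R0) coprimenP // expn_gt0 prime_gt0.
have [omL omLP omLE] := teichmuller_lift vP p_pr pn0 vp io cop omP.
have approx := hyp_approx vP p_pr pn0 vp piE psiE s0 cardk cardL omLP omLE D0 gaE gapi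
  AE BE b'p a C0.
set X := expsum _ _ _ _ _ _ _ in approx.
have XE : \tr (M ^+ (s * r)) * (p ^ (s * r)).-1%:R ^+ d = s%:R * X.
  rewrite (trace_transfer p1) ?om_fixed // dvdn_mulr //.
  have -> : s%:R * X = \sum_(i < s) X by rewrite sumr_const card_ord mulr_natl.
  rewrite mulr_suml;
  apply: eq_bigr => i _; rewrite -[X](_ : expsum p omL (s * r) sg (@ah_weight _ p D ga n m (omL (-1)))
    (char_exponents p a' b') (io a ^+ (p ^ i)) = _); last first.
    elim: (i : nat) => [|j IHj]; first by rewrite expn0 expr1.
    by rewrite expnSr exprM (expsum_frobenius p_pr omLP R0 cardL).
  rewrite (expsumE vP p_pr pn0 vp omLP R0 cardL (t0 := inl i0)) ?expf_neq0 ?fmorph_eq0 //.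
  rewrite card_sum !card_ord nm mulrC; congr (_ * _).
  have -> : omL (-1) = om (-1) by rewrite -omLE rmorphN1.
  by rewrite (omX omLP) omLE.
have -> : (1 - p%:R ^+ (s * r)) ^+ d * \tr (M ^+ (s * r)) = (-1) ^+ d * (s%:R * X).
  have -> : 1 - p%:R ^+ (s * r) = -1 * (p ^ (s * r)).-1%:R :> Om.
    by rewrite -subn1 natrB ?expn_gt0 ?prime_gt0 // natrX; ring.
  by rewrite -XE exprMn -mulrA; congr (_ * _); rewrite mulrC.
rewrite mulrCA -mulrBr -mulrBr.
apply/(@vgeN _ _ vP); rewrite -mulrN -mulrN opprB -signr_odd mulr_sign.
have h : val_ge v (s%:R * (X - Hyp io p s r n m psi1 om A B a)) C.
  by rewrite mulrC; apply: vgeM0 => //; exact: vge_nat.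
by case: ifP => // _; apply/vgeN.
Qed.

End HypTrace.

Lemma vge_transfer_mx0 (Om : closedFieldType) (v : Om -> rat) (p : nat)
    (T : finType) (sg : pred T) (t0 : T) (L B s : nat) (c : T -> nat) (A ga : Om) (xi : T -> Om) :
  is_valuation v -> prime p -> (p%:R : Om) != 0 -> 0 < v p%:R ->
  val_ge v A 0 -> val_ge v ga 0 -> (forall t, val_ge v (xi t) 0) ->
  forall a b, val_ge v (transfer_mx p (@twisted_weight Om p T L xi ga) sg t0 B s c A a b) 0.
Proof.
move=> vP p_pr pn0 vp A0 ga0 xi0 a b; rewrite transfer_mxE.
apply: vgeM0 => //; first by apply: vgeM0 => //; exact: vge_nat.
apply: vge_sum => // l _; apply: vgeM0 => //.
  apply: vge_prod0 => // t _; apply: vgeM0 => //; first exact: vge_ah.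
  by apply: vgeX0 => //; apply: vgeM0.
by apply: vgeM0 => //; [do 2 apply: vgeX0 => // | exact: vge_nat].
Qed.

Lemma window_bound (g c : rat) : 0 < g ->
  exists W : nat, forall w : nat, (w%:R * g <= c) = (w < W)%N.
Proof.
move=> g0; case: (lerP 0 c) => c0.
  exists (Num.truncn (c / g)).+1 => w.
  by rewrite ltnS truncn_ge_nat ?divr_ge0 ?(ltW g0) // ler_pdivlMr.
exists 0%N => w; apply/negbTE; rewrite -ltNge (lt_le_trans c0) //.
by rewrite mulr_ge0 ?ler0n ?(ltW g0).
Qed.

Lemma exists_nat_gt (x : rat) : exists N : nat, x < N%:R.
Proof.
exists (Num.bound `|x|); apply: le_lt_trans (ler_norm x) _.
by apply: archi_boundP; exact: normr_ge0.
Qed.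

(** * Frobenius slopes against orthant corners at a fixed cutoff *)

Section MinSums.
Variables (Om : closedFieldType) (v : Om -> rat) (p s : nat) (pi psi1 : Om).
Hypotheses (vP : is_valuation v) (p_pr : prime p).
Hypotheses (pn0 : (p%:R : Om) != 0) (vpE : v p%:R = s%:R^-1).
Hypotheses (piE : dwork_pi p pi) (psiE : dwork_psi v p pi psi1).
Variables (k : finFieldType) (om : k -> Om).
Hypotheses (s0 : (0 < s)%N) (cardk : #|k| = (p ^ s)%N) (omP : teichmuller v om).
Variables (n m d : nat) (A B : seq nat) (a' b' : nat -> nat) (i0 : 'I_n).
Hypotheses (nm : (n + m)%N = d.+1) (mn : (m < n)%N).
Hypotheses (AE : forall i, (i < n)%N -> nth 0%N A i = (a' i * geom p s)%N)
  (BE : forall i, (i < m)%N -> nth 0%N B i = (b' i * geom p s)%N)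
  (aq : forall i, (i < n)%N -> (a' i < p.-1)%N)
  (bq : forall i, (i < m)%N -> (b' i < p.-1)%N)
  (a_mono : forall i j, (i <= j)%N -> (j < n)%N -> (a' i <= a' j)%N).
Variables (a : k) (a0 : a != 0) (L : nat -> finFieldType)
  (io : forall r, {rmorphism k -> L r}) (gamma : seq Om).
Hypotheses (cardL : forall r, (0 < r)%N -> #|L r| = ((p ^ s) ^ r)%N)
  (gamma0 : all (fun g => g != 0) gamma)
  (hypE : forall r, (0 < r)%N -> Hyp (io r) p s r n m psi1 om A B a =
     - (-1) ^+ (n + m) * \sum_(g <- gamma) g ^+ r).

Local Notation q := p.-1.
Local Notation T := ('I_n + 'I_m)%type.
Local Notation sg := (@is_inl 'I_n 'I_m).

Let vp : 0 < v p%:R. Proof. by rewrite vpE invr_gt0 ltr0n. Qed.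
Let q0 : (0 < q)%N. Proof. by rewrite -ltnS prednK ?prime_gt1 ?prime_gt0. Qed.
Let g := v pi.
Let g0 : 0 < g. Proof. exact: g_gt0 vP p_pr pn0 vp piE. Qed.
Let qg : q%:R * g = s%:R^-1. Proof. by rewrite -vpE (nu_p vP p_pr pn0 piE). Qed.
Let char0 := nat_neq0 vP p_pr pn0 vp.

Let unit_om x : x != 0 -> om x != 0 /\ v (om x) = 0.
Proof.
move=> x0; split; first exact: (om_neq0 omP).
apply: (@nu_unity _ _ vP _ (p ^ s).-1); first by rewrite -cardk; move: (finNzRing_gt1 k); case: #|k| => [|[]].
exact: (@omN1 _ _ _ p_pr _ _ _ omP cardk).
Qed.

Lemma sum_sgv : 0 < \sum_t sgv sg t.
Proof.
rewrite big_sumType /= /sgv /= !sumr_const !card_ord; move: mn; clear; lia.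
Qed.

Lemma frobenius_min_sums (c : rat) :
  \sum_(x <- gamma) Num.min 0 (v x - s%:R * c) =
  \sum_(i < n) Num.min 0 ((\sum_(t : T) corner p a' b' i t)%:R / q%:R - s%:R * c).
Proof.
have s0r : (0 : rat) < s%:R by rewrite ltr0n.
have [W WE] := window_bound c g0.
(* [K] is fixed before [D]: it uses only the number of eigenvalues and the window [W], which also
   contains the windows of all lower cutoffs [c - j v(p)]. *)
pose K := (s * size gamma + \sum_(j < d.+1) 'C(d, j) * (s * W ^ d.+1))%N.
pose x1 := K%:R * `|c| + `|v K`!%:R| + q%:R * g.
have [N1 hN1] := exists_nat_gt (x1 / (g / 2%:R)).
have [N2 hN2] := exists_nat_gt (q%:R * (s%:R * c)).
(* [p * W] keeps truncation from cutting the window entries ([WD]), [N1] gives the precision [DC],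
   and [N2] makes the box [2 D] contain every weight below the cutoff ([BD]). *)
pose D := (1 + p * W + N1 + N2)%N.
have D0 : (0 < D)%N by [].
pose C := D.+1%:R * (g / 2%:R) - q%:R * g.
have DC : K%:R * `|c| < C - v K`!%:R.
  have h1 : x1 < D.+1%:R * (g / 2%:R).
    rewrite -ltr_pdivrMr ?divr_gt0 //; apply: lt_le_trans hN1 _.
    by rewrite ler_nat /D; move: (p * W)%N; clear; lia.
  have := ler_norm (v K`!%:R); move: h1; rewrite /x1 /C; lra.
have C0 : 0 <= C.
  have := ler_norm (v K`!%:R); have : v K`!%:R >= 0.
    by case: (vge_nat vP K`!) => // /eqP; rewrite (negPf (char0 (fact_gt0 K))).
  have : 0 <= K%:R * `|c| by rewrite mulr_ge0 ?ler0n.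
  move: DC; lra.
have WD : (p * W <= q * D)%N.
  apply: leq_trans (leq_pmull _ q0); rewrite /D; move: (p * W)%N; clear; lia.
have BD : q%:R * (s%:R * c) <= (2 * D)%:R :> rat.
  by apply: ltW; apply: lt_le_trans hN2 _; rewrite ler_nat /D; move: (p * W)%N; clear; lia.
have [ga gaE gapi] := exists_gamma vP p_pr pn0 vp piE D0.
have [ga0 vga] := nu_ga vP p_pr pn0 vp piE gapi.
have [eta etaE] : exists eta, eta ^+ q = ga.
  have /closed_rootP[eta] : size ('X^q - ga%:P) != 1%N by rewrite size_XnsubC // eqSS -lt0n.
  rewrite rootE !hornerE subr_eq0 => /eqP; by exists eta.
have eta0 : eta != 0.
  by apply: contraNneq ga0 => e0; rewrite -etaE e0 expr0n eqn0Ngt q0.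
have veta : 0 < v eta.
  by have := g0; rewrite /g -vga -etaE (nuX vP) // pmulr_rgt0 // ltr0n.
have [A0 vA] := unit_om a0.
have [w0 vw] : om (-1) != 0 /\ v (om (-1)) = 0 by apply: unit_om; rewrite oppr_eq0 oner_neq0.
pose xi : T -> Om := neg_twist (om (-1)).
have xi0 t : xi t != 0 by rewrite /xi /neg_twist; case: ifP => _; rewrite ?oner_neq0.
have vxi t : v (xi t) = 0 by rewrite /xi /neg_twist; case: ifP => _; rewrite ?(nu1 vP).
pose M := transfer_mx p (@twisted_weight Om p T D xi ga) sg (inl i0) (2 * D) s
  (char_exponents p a' b') (om a).
pose Nj (j : 'I_d.+1) := s%:R * \sum_(U : {ffun T -> 'I_(2 * D).+1} | valid sg (inl i0) p (char_exponents p a' b') U)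
   Num.min 0 ((wdeg U)%:R * v ga - (c - j%:R * v p%:R)).
have kjP (j : 'I_d.+1) : exists2 kj, (kj <= s * W ^ d.+1)%N &
     gauss_norm v (det_series M) (c - j%:R * v p%:R) (Nj j) kj.
  have [Wj WjE] := window_bound (c - j%:R * v p%:R) g0.
  have WjW : (Wj <= W)%N.
    rewrite leqNgt -WjE -ltNge.
    have := ltnn W; rewrite -WE => /negbT; rewrite -ltNge; apply: le_lt_trans.
    by rewrite gerBl mulr_ge0 ?ler0n ?(ltW vp).
  have [||kj kjb kjN] := @gauss_norm_transfer Om v p vP p_pr pn0 vp T sg (inl i0) D (2 * D) s
    (char_exponents p a' b') (om a) isT sum_sgv s0 A0 vA xi xi0 vxi ga eta etaE eta0 veta Wj _
    (c - j%:R * v p%:R).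
  - by apply: leq_trans WD; rewrite leq_mul2l WjW orbT.
  - by rewrite vga.
  exists kj => //; apply: leq_trans kjb _; rewrite leq_mul2l.
  by rewrite card_sum !card_ord nm leq_exp2r // WjW orbT.
have [kj kjb kjN] := fin_all_exists2 kjP.
have close r : (0 < r)%N -> val_ge v ((if (s %| r)%N then s%:R * \sum_(g <- gamma) g ^+ (r %/ s) else 0)
     - (1 - p%:R ^+ r) ^+ d * \tr (M ^+ r)) C.
  move=> r0; case: ifP => sr; last first.
    rewrite (trace_transfer (prime_gt1 p_pr)) ?sr ?mulr0 ?subrr //; first by left.
    by rewrite (om_fixed cardk omP).
  have [r' rE] := dvdnP sr; have r'0 : (0 < r')%N by move: r0; rewrite rE muln_gt0 => /andP[].
  have := hyp_trace vP p_pr pn0 vp piE psiE s0 cardk omP D0 gaE gapi i0 AE BE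
    (fun i im => ltnW (bq im)) a0 (io r') C0 r'0 _ nm.
  have -> : (-1) ^+ d * Hyp (io r') p s r' n m psi1 om A B a = \sum_(g <- gamma) g ^+ r'.
    rewrite hypE // nm exprS; set S := \sum_(_ <- _) _.
    transitivity (((-1) ^+ d) ^+ 2 * S); first by ring.
    by rewrite sqrr_sign mul1r.
  rewrite rE mulnK // [(s * r')%N]mulnC; apply.
  by rewrite cardL // mulnC expnM.
rewrite (compare_norms vP pn0 char0 (kj := kj) (Nj := Nj) (K := K) s0 gamma0 _ C0 close kjN _ _ DC).
- rewrite -(alternating_valid_sum i0 q0 aq bq a_mono nm BD); apply: eq_bigr => j _; congr (_ * _).
  rewrite /Nj mulr_sumr; apply: eq_bigr => U _.
  rewrite minr_pMr ?ler0n // mulr0; congr Num.min.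
  rewrite vga -/g vpE; have -> : g = (s%:R * q%:R)^-1.
    apply: (@mulfI _ q%:R); first by rewrite pnatr_eq0 -lt0n.
    rewrite qg; field; rewrite !pnatr_eq0 -!lt0n s0 q0 //.
  field; rewrite !pnatr_eq0 -!lt0n s0 q0 //.
- move=> x y; apply: vge_transfer_mx0 => //.
  + by right; rewrite vA.
  + by right; rewrite vga ltW.
  + by move=> t; right; rewrite vxi.
- by move=> j; rewrite mulr_ge0_le0 ?ler0n //; apply: sumr_le0 => U _; rewrite ge_min lexx.
- by rewrite leq_add2l; apply: leq_sum => j _; rewrite leq_mul2l kjb orbT.
Qed.

End MinSums.

Lemma polygon_perm (r r' : seq rat) : perm_eq r r' -> polygon r = polygon r'.
Proof.
move=> rr'; rewrite /polygon (perm_size rr').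
suff -> : sort (fun x y : rat => x <= y) r = sort (fun x y : rat => x <= y) r' by [].
by apply/perm_sortP => //; [exact: le_total | exact: le_trans | exact: le_anti].
Qed.

Theorem theorem4p1
  (p s : nat) (k : finFieldType) (L : nat -> finFieldType)
  (iota : forall r : nat, {rmorphism k -> L r})
  (Om : closedFieldType) (v : Om -> rat) (pi psi1 : Om) (om : k -> Om)
  (n m : nat) (A B : seq nat) :
  prime p -> (0 < s)%N -> #|k| = (p ^ s)%N ->
  (forall r : nat, (0 < r)%N -> #|L r| = ((p ^ s) ^ r)%N) ->
  is_valuation v -> (p%:R : Om) != 0 -> v p%:R = (s%:R)^-1 ->
  dwork_pi p pi -> dwork_psi v p pi psi1 -> teichmuller v om ->
  (m < n)%N -> size A = n -> size B = m ->
  sorted leq A -> sorted leq B ->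
  all (fun e => e <= p ^ s - 2)%N A -> all (fun e => e <= p ^ s - 2)%N B ->
  (forall x : k, x != 0 -> all (fun e => om x ^+ (e * p.-1) == 1) (A ++ B)) ->
  forall a : k, a != 0 ->
  forall gamma : seq Om, size gamma = n -> all (fun g => g != 0) gamma ->
  (forall r : nat, (0 < r)%N ->
     Hyp (iota r) p s r n m psi1 om A B a
     = - (-1) ^+ (n + m) * \sum_(g <- gamma) g ^+ r) ->
  polygon [seq v g | g <- gamma] = polygon (hodge_slopes (p ^ s) n m A B).
Proof.
move=> p_pr s0 cardk cardL vP pn0 vpE piE psiE omP mn sA sB sortA sortB boundA boundB ord
  a a0 gamma sg gamma0 hypE.
have p1 := prime_gt1 p_pr.
have q0 : (0 < p.-1)%N by rewrite -ltnS prednK // ltnW.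
have qE : ((p ^ s).-1 = p.-1 * geom p s)%N by rewrite /geom predn_exp.
have ps1 : (1 < p ^ s)%N by rewrite -(expn0 p) ltn_exp2l.
have geom0 : (0 < geom p s)%N.
  by have : (0 < (p ^ s).-1)%N; [rewrite -ltnS prednK // ltnW | rewrite qE muln_gt0 => /andP[]].
(* At a generator of the group of [k] the order hypothesis says that [p^s - 1] divides
   [e (p - 1)]. *)
have geom_dvd e : e \in A ++ B -> (geom p s %| e)%N.
  move=> eAB; have [z zP] := finField_prim_root k.
  have z0 : z != 0.
    apply/eqP => z0; have := prim_expr_order zP; rewrite z0 expr0n cardk qE muln_eq0.
    by rewrite (gtn_eqF q0) (gtn_eqF geom0) => /eqP; rewrite eq_sym oner_eq0.
  have /allP /(_ e eAB) /eqP := ord z z0; rewrite -(omX omP).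
  move=> /(om_eq1 vP p_pr omP cardk) /eqP.
  by rewrite -(prim_order_dvd zP) cardk qE mulnC dvdn_pmul2r.
have nthE e : e \in A ++ B -> (e <= p ^ s - 2)%N -> 
    e = (e %/ geom p s * geom p s)%N /\ (e %/ geom p s < p.-1)%N.
  move=> /geom_dvd eg eb; rewrite divnK //; split=> //.
  rewrite ltn_divLR // -qE; move: eb ps1; move: (p ^ s)%N; clear; lia.
pose a' i := (nth 0 A i %/ geom p s)%N; pose b' i := (nth 0 B i %/ geom p s)%N.
have hA i : (i < n)%N -> nth 0%N A i = (a' i * geom p s)%N /\ (a' i < p.-1)%N.
  move=> ni; have iA : nth 0%N A i \in A by rewrite mem_nth ?sA.
  by apply: nthE; [rewrite mem_cat iA | exact: (allP boundA)].
have hB i : (i < m)%N -> nth 0%N B i = (b' i * geom p s)%N /\ (b' i < p.-1)%N.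
  move=> ni; have iB : nth 0%N B i \in B by rewrite mem_nth ?sB.
  by apply: nthE; [rewrite mem_cat iB orbT | exact: (allP boundB)].
have a_mono i j : (i <= j)%N -> (j < n)%N -> (a' i <= a' j)%N.
  move=> ij jn; apply: leq_div2r; apply: (sorted_leq_nth leq_trans leqnn) => //.
  - by rewrite inE sA (leq_ltn_trans ij).
  - by rewrite inE sA.
have n0 : (0 < n)%N by apply: leq_ltn_trans mn.
have nm : (n + m)%N = (n + m).-1.+1 by rewrite prednK // addn_gt0 n0.
apply: polygon_perm; apply: perm_eq_min_sums => sigma; rewrite big_map.
(* Each eigenvalue enters as [1 - gamma X^s], so the cutoff for the matrix is [sigma / s]. *)
have sE : s%:R * (sigma / s%:R) = sigma by rewrite mulrC divfK // pnatr_eq0 -lt0n.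
have := frobenius_min_sums vP p_pr pn0 vpE piE psiE s0 cardk omP (Ordinal n0) nm mn
  (fun i h => (hA i h).1) (fun i h => (hB i h).1) (fun i h => (hA i h).2) (fun i h => (hB i h).2)
  a_mono a0 cardL gamma0 hypE (sigma / s%:R).
rewrite sE => ->; rewrite /hodge_slopes big_map -[1%N]addn0 iotaDl big_map.
rewrite -[n in seq.iota 0 n]subn0 big_mkord; apply: eq_bigr => i _.
rewrite (theta_corner q0 (fun i h => (hA i h).2) a_mono i (ltnW mn) s0 sA sB
  (fun i h => (hA i h).1) (fun i h => (hB i h).1)) //.
Qed.
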